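(* Let $r,s\ge 1$ be integers, let $c\in\mathbb{C}$, $c\ne 0$, let $q,t\in\mathbb{C}$ be not roots of unity, and let $a_i=c^i\frac{q^i-1}{1-t^i}$ for $i\ge 1$, $\mathbf a=(a_1,a_2,\dots)$. Then: (i) The algebra $\Lambda_{r,s,\mathbf a}$ is finitely generated if and only if $q^m\ne t^n$ for all integers $1\le m\le r$, $1\le n\le s$. (ii) If $q,t$ are Weil generic, then $\Lambda_{r,s,\mathbf a}$ is Cohen-Macaulay with Hilbert series $$ h_{r,s}(u)=\frac{1}{(u,u)_r}\sum_{i=0}^s\frac{u^{i(r+1)}}{(u,u)_i}. $$
   Context: For a sequence $\mathbf a=(a_1,a_2,\dots)$ of nonzero complex numbers, $\Lambda_{r,s,\mathbf a}$ is the subalgebra of $\mathbb{C}[y_1,\dots,y_r,z_1,\dots,z_s]$ generated by the polynomials $Q_i=a_i(y_1^i+\dots+y_r^i)+z_1^i+\dots+z_s^i$ for all $i\ge 1$. ''Finitely generated'' means finitely generated as a $\mathbb{C}$-algebra. The algebra is graded by polynomial degree, and its Hilbert series is the generating function (in $u$) of the dimensions of its homogeneous components. Notation: $(u,u)_m:=(1-u)(1-u^2)\cdots(1-u^m)$, with $(u,u)_0=1$. ''Weil generic $q,t$'' means: $(q,t)$ lies outside of a countable union of curves. Part (i) is attributed to Sergeev and Veselov. *)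

(* Defs.v *)
From HB Require Import structures.
From mathcomp Require Import all_boot all_order all_algebra.
From mathcomp Require Export ring_quotient complex boolp reals mpoly.

Set Implicit Arguments.
Unset Strict Implicit.
Unset Printing Implicit Defensive.

Import Order.TTheory GRing.Theory Num.Theory.

Local Open Scope ring_scope.

Section GeneratedSubalgebra.
Variables (K : comNzRingType) (A : comAlgType K) (S : A -> Prop).

Definition gen_subalg_pred : {pred A} := fun x =>
  `[< forall B : {pred A}, subalg_closed B -> (forall y, S y -> y \in B) ->
        x \in B >].

Lemma gen_subalg_closed : subalg_closed gen_subalg_pred.
Proof.
split=> [|a x y|x y]; rewrite ?inE.
- by apply/asboolP => B [].
- move=> /asboolP hx /asboolP hy; apply/asboolP => B cB SB.
  by have [_ lB _] := cB; apply: lB; [exact: hx | exact: hy].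
- move=> /asboolP hx /asboolP hy; apply/asboolP => B cB SB.
  by have [_ _ mB] := cB; apply: mB; [exact: hx | exact: hy].
Qed.

Record gen_subalg := GenSubalg {
  gen_subalg_val : A;
  _ : gen_subalg_val \in gen_subalg_pred }.

HB.instance Definition _ := [isSub for gen_subalg_val].
HB.instance Definition _ := [Choice of gen_subalg by <:].
HB.instance Definition _ := GRing.SubChoice_isSubAlgebra.Build
  K A gen_subalg_pred gen_subalg (GRing.subalg_closed_semi gen_subalg_closed).
HB.instance Definition _ := GRing.SubNzRing_isSubComNzRing.Build
  A gen_subalg_pred gen_subalg.

End GeneratedSubalgebra.

Definition finitely_generated (K : comNzRingType) (A : comAlgType K) : Prop :=
  exists l : seq A, forall x : A, x \in gen_subalg_pred (fun y => y \in l).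

(* Cohen-Macaulay is taken in the form of Eisenbud, Commutative Algebra, 18.2:
   a Noetherian ring such that depth M = codim M for every maximal ideal M,
   where depth M is the length of the longest regular sequences in M, and
   codim M, that is dim A_M, the length of the longest chains of primes that
   end at M.  The ideals of type [idealr] and [prime_idealr] are proper. *)

Section CohenMacaulay.
Variable A : comNzRingType.

Definition in_ideal (l : seq A) (x : A) : Prop :=
  exists c : nat -> A, x = \sum_(i < size l) c i * l`_i.

Definition noetherian : Prop :=
  forall I : idealr A, exists l : seq A, forall x, x \in I <-> in_ideal l x.

Definition maximal_ideal (M : idealr A) : Prop :=
  forall J : idealr A, {subset M <= J} -> {subset J <= M}.

Definition regular_sequence (l : seq A) : Prop :=
  (forall i, (i < size l)%N -> forall x,
      in_ideal (take i l) (l`_i * x) -> in_ideal (take i l) x)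
  /\ ~ in_ideal l 1.

Definition has_depth (I : idealr A) (d : nat) : Prop :=
  (exists l, [/\ regular_sequence l, {subset l <= I} & size l = d])
  /\ (forall l, regular_sequence l -> {subset l <= I} -> (size l <= d)%N).

Definition prime_chain_to (M : idealr A) (d : nat) : Prop :=
  exists P : nat -> prime_idealr A,
    (forall i, (i < d)%N ->
       {subset P i <= P i.+1} /\ ~ {subset P i.+1 <= P i})
    /\ P d =i M.

Definition has_codim (M : idealr A) (d : nat) : Prop :=
  prime_chain_to M d /\ (forall e, prime_chain_to M e -> (e <= d)%N).

Definition Cohen_Macaulay : Prop :=
  noetherian /\
  forall M : idealr A, maximal_ideal M ->
    exists d, has_depth M d /\ has_codim M d.

End CohenMacaulay.

Definition has_dim (K : fieldType) (V : lmodType K) (W : {pred V}) (n : nat)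
    : Prop :=
  exists b : 'I_n -> V,
    (forall c : 'I_n -> K, \sum_i c i *: b i = 0 -> forall i, c i = 0) /\
    (forall v, v \in W <-> exists c : 'I_n -> K, v = \sum_i c i *: b i).

Definition fps := nat -> int.

Definition fps_of_poly (p : {poly int}) : fps := fun n => p`_n.

Definition fps_mul (f g : fps) : fps :=
  fun n => \sum_(i < n.+1) f i * g (n - i)%N.

(* 1/p = 1 + (1-p) + (1-p)^2 + ..., for p of constant term 1; the k-th term
   has order at least k. *)
Definition fps_inv (p : {poly int}) : fps :=
  fun n => (\sum_(k < n.+1) (1 - p) ^+ k)`_n.

Lemma fps_mulV (p : {poly int}) : p`_0 = 1 ->
  fps_mul (fps_of_poly p) (fps_inv p) =1 fps_of_poly 1.
Proof.
move=> p0 n.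
have ord k m : (m < k)%N -> ((1 - p) ^+ k)`_m = 0.
  move=> ltmk; have : root (1 - p) 0.
    by rewrite rootE horner_coef0 coefB coef1 p0 subrr.
  case/factor_theorem=> q ->; rewrite subr0 exprMn coefMXn.
  by rewrite ltmk.
have stab m : (m <= n)%N -> fps_inv p m = (\sum_(k < n.+1) (1 - p) ^+ k)`_m.
  move=> lemn; rewrite /fps_inv !coef_sum (big_ord_widen n.+1
    (fun k => ((1 - p) ^+ k)`_m)) // [RHS](bigID (fun k : 'I__ => (k < m.+1)%N)).
  by rewrite /= [X in _ = _ + X]big1 ?addr0 // => k; rewrite -leqNgt => /ord.
rewrite /fps_mul /fps_of_poly.
under eq_bigr => i _ do rewrite stab ?leq_subr //.
have e : p = 1 - (1 - p) by rewrite subKr.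
rewrite -coefM {1}e.
have -> : (1 - (1 - p)) * \sum_(k < n.+1) (1 - p) ^+ k = 1 - (1 - p) ^+ n.+1.
  by rewrite -(opprB ((1 - p) ^+ n.+1)) subrX1 -mulNr (opprB (1 - p) 1).
by rewrite coefB ord // subr0.
Qed.

Definition qpoch (m : nat) : {poly int} := \prod_(1 <= k < m.+1) (1 - 'X^k).

Definition hilb_rs (r s : nat) : fps :=
  fps_mul (fps_inv (qpoch r))
    (fun n => \sum_(i < s.+1)
       fps_mul (fps_of_poly 'X^(i * r.+1)) (fps_inv (qpoch i)) n).

Section PowerSums.
Variables (C : fieldType) (r s : nat) (a : nat -> C).

(* y_1, ..., y_r are the first r variables and z_1, ..., z_s the last s. *)
Definition gpsum (i : nat) : {mpoly C[r + s]} :=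
  a i *: (\sum_(j < r) 'X_(lshift s j) ^+ i) + \sum_(j < s) 'X_(rshift r j) ^+ i.

Definition Lambda : comAlgType C :=
  gen_subalg (fun p : {mpoly C[r + s]} => exists2 i, (0 < i)%N & p = gpsum i).

Definition Lambda_homog (d : nat) : {pred Lambda} :=
  fun x => (val x : {mpoly C[r + s]}) \is d.-homog.

Definition has_hilbert_series (h : fps) : Prop :=
  forall d, exists2 n, has_dim (Lambda_homog d) n & n%:Z = h d.

End PowerSums.

Definition not_root_of_unity (C : fieldType) (x : C) : Prop :=
  forall n, (0 < n)%N -> x ^+ n != 1.

(* The entry of index 0 is not used. *)
Definition a_seq (C : fieldType) (c q t : C) : nat -> C :=
  fun i => c ^+ i * ((q ^+ i - 1) / (1 - t ^+ i)).

(* P holds for all (q, t) outside of some countable union of plane curves,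
   each curve being the zero locus of a nonconstant polynomial. *)
Definition Weil_generically (C : fieldType) (P : C -> C -> Prop) : Prop :=
  exists F : nat -> {mpoly C[2]},
    (forall k, (1 < msize (F k))%N) /\
    forall q t : C, (forall k, (F k).@[tnth [tuple q; t]] != 0) -> P q t.

(* Main.v *)
(** (i) If q^m = t^n, then all the Q_i vanish on the line spanned by
    y = (1, q, .., q^(m-1), 0, ..)/c, z = (1, t, .., t^(n-1), 0, ..).  On that
    line the y_1-derivatives of the elements of a finitely generated subalgebra
    have bounded degree, those of the Q_i do not.  Conversely, a common zero of
    Q_1, .., Q_(r+s) gives two multisets with equal power sums, hence equal; a
    cycle of the matching between them is a relation q^m = t^n.  So without such
    relations the polynomial ring is finite over C[Q_1, .., Q_(r+s)], and so is
    its submodule Lambda.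

    (ii) All is compared with the special point (q, t) = (0, 1).  The parts of
    highest degree in z of the limits there of elements of the algebras Lambda
    contain the algebra A of the polynomials symmetric in y and in z whose
    exponents in z are 0 or greater than r, and A has the Hilbert series h_(r,s).
    The elementary symmetric polynomials of y_1, .., y_r and of z_1^(r+1), ..,
    z_s^(r+1) are a regular sequence on A, so A is free over the polynomials in
    them.  A basis lifts to linearly independent elements of Lambda for generic
    (q, t), one condition for each degree.  The lifts span: an element f of Lambda
    satisfies f(y_j = w, z_k = c w) = f(y_j = t w, z_k = c q w), and these
    relations at (0, 1), hence at a generic point, determine f from its
    coefficients on the monomials of A.  Thus Lambda is free over r + s of its
    elements; shifted by constants these are a regular sequence in any maximal
    ideal, which is given by a point p, and setting the variables equal to the
    coordinates of p one by one gives a chain of r + s + 1 primes. *)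

Require Import Defs.
From HB Require Import structures.
From mathcomp Require Import all_boot all_order all_fingroup all_algebra.
From mathcomp Require Import ring zify.
Set Implicit Arguments.
Unset Strict Implicit.
Unset Printing Implicit Defensive.
Import Order.TTheory GRing.Theory Num.Theory.
Local Open Scope ring_scope.

(** * Regular sequences and freeness *)

(** The point (0, 1) is chosen because a_i has a pole at t = 1: multiplied by 1 - t^i, Q_i tends
    there to -c^i (y_1^i + ... + y_r^i), and z is lost. It returns at first order in 1 - t. For i >
    r the i-th power sum of y is a polynomial in those of index at most r; the same polynomial in
    suitably scaled generators differs from the i-th one by a multiple of 1 - t, and the quotient
    has a multiple of z_1^i + ... + z_s^i as its part of highest degree in z. For i <= r the power
    sums of y are algebraically independent and nothing of the kind exists, which is why A has no
    exponents of z from 1 to r. Linear independence at (0, 1) persists at generic points, spanning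
    need not: the lifts bound the dimensions only from below. The bound from above applies the same
    principle to the relations, read as a linear system for the coefficients of f that has only the
    zero solution at (0, 1). Either condition is the nonvanishing of one polynomial in q, t in each
    degree, whence countably many curves. *)

Definition linear_pred (K : fieldType) (V : lmodType K) (P : V -> Prop) :=
  P 0 /\ forall k u v, P u -> P v -> P (k *: u + v).

Section LinearPred.
Variables (K : fieldType) (V : lmodType K) (P : V -> Prop).
Hypothesis linP : linear_pred P.

Lemma linear_pred0 : P 0. Proof. exact: linP.1. Qed.
Lemma linear_pred2 k u v : P u -> P v -> P (k *: u + v). Proof. exact: linP.2. Qed.
Lemma linear_predZ k u : P u -> P (k *: u).
Proof. by move=> Pu; rewrite -[_ *: _]addr0; apply: linP.2 => //; case: linP. Qed.
Lemma linear_predD u v : P u -> P v -> P (u + v).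
Proof. by move=> Pu Pv; rewrite -[u]scale1r; apply: linP.2. Qed.
Lemma linear_predN u : P u -> P (- u).
Proof. by rewrite -scaleN1r; apply: linear_predZ. Qed.
Lemma linear_predB u v : P u -> P v -> P (u - v).
Proof. by move=> Pu Pv; apply: linear_predD => //; apply: linear_predN. Qed.
Lemma linear_pred_sum (I : eqType) (r : seq I) (Q : pred I) (F : I -> V) :
  (forall i, i \in r -> Q i -> P (F i)) -> P (\sum_(i <- r | Q i) F i).
Proof.
elim: r => [|i r IHr] PF; first by rewrite big_nil; apply: linear_pred0.
rewrite big_cons; have PR : P (\sum_(j <- r | Q j) F j).
  by apply: IHr => j jr; apply: PF; rewrite inE jr orbT.
by case: ifP => // Qi; apply: linear_predD => //; apply: PF; rewrite ?mem_head.
Qed.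
End LinearPred.

Lemma mmap1_add (n : nat) (S : comNzRingType) (h : 'I_n -> S) m1 m2 :
  mmap1 h (m1 + m2) = mmap1 h m1 * mmap1 h m2.
Proof. by apply: commr_mmap1_M => i y; apply: mulrC. Qed.

Section FreeOverRegular.
Variables (K : fieldType) (B : comAlgType K) (e : nat) (x : 'I_e -> B).
Variables (U : B -> Prop) (I : nat -> B -> Prop) (J : eqType) (g : J -> B).
Hypotheses (linU : linear_pred U) (linI : forall k, linear_pred (I k)).
Hypothesis xU : forall i a, U a -> U (x i * a).
Hypothesis xI : forall (i : 'I_e) a, U a -> I i.+1 (x i * a).
Hypothesis leI : forall (k : nat) a, (k < e)%N -> I k a -> I k.+1 a.
Hypothesis regI : forall (i : 'I_e) a, U a -> I i (x i * a) -> I i a.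
Hypothesis gU : forall j, U (g j).
Hypothesis g_free : forall (l : seq J) (c : J -> K), uniq l ->
  I e (\sum_(j <- l) c j *: g j) -> forall j, j \in l -> c j = 0.

Let mon (k : 'X_{1..e} * J) : B := mmap1 x k.1 * g k.2.

Lemma mmap1_stable (m : 'X_{1..e}) a : U a -> U (mmap1 x m * a).
Proof.
move=> Ua; rewrite /mmap1.
have: forall l : seq 'I_e, U (\prod_(i <- l) x i ^+ m i * a).
  elim=> [|i l IHl]; first by rewrite big_nil mul1r.
  rewrite big_cons -mulrA; elim: (m i) => [|k IHk]; first by rewrite mul1r.
  by rewrite exprS -mulrA; apply: xU.
by apply.
Qed.

(** The claim is proved for the monomials in x_k, ..., x_(e-1) modulo [I k], by descending k. Modulo
    [I k.+1] only the terms without x_k survive, so their coefficients vanish; what remains is x_k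
    times a combination with smaller exponents, and regularity modulo [I k] cancels x_k. *)
Lemma free_over_regular (l : seq ('X_{1..e} * J)) (c : 'X_{1..e} * J -> K) :
  uniq l -> I 0%N (\sum_(k <- l) c k *: mon k) -> forall k, k \in l -> c k = 0.
Proof.
have monU k : U (mon k) by apply: mmap1_stable.
suff main d : (d <= e)%N -> forall (l : seq ('X_{1..e} * J)) c, uniq l ->
    (forall k, k \in l -> forall i : 'I_e, (i < e - d)%N -> k.1 i = 0%N) ->
    I (e - d)%N (\sum_(k <- l) c k *: mon k) -> forall k, k \in l -> c k = 0.
  by have := main e (leqnn e) l c; rewrite subnn => H ul Is; apply: H.
elim: d => [_ {}l {}c ul l0|d IHd lede].
  rewrite subn0 => Is k kl.
  have l00 h : h \in l -> h = (0%MM, h.2).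
    move=> hl; case: h hl => h1 h2 /= hl; congr (_, _); apply/mnmP => i.
    by rewrite mnm0E; apply: (l0 _ hl); rewrite subn0.
  have {}ul : uniq (map snd l).
    rewrite map_inj_in_uniq // => h1 h2 /l00 e1 /l00 e2 e12.
    by rewrite e1 e2 e12.
  have := @g_free (map snd l) (fun j => c (0%MM, j)) ul.
  rewrite big_map; have -> : \sum_(j <- l) c (0%MM, j.2) *: g j.2 =
      \sum_(k <- l) c k *: mon k.
    by apply: eq_big_seq => h /l00 ->; rewrite /mon /= mmap11 mul1r.
  by move=> /(_ Is k.2 (map_f _ kl)); rewrite -l00.
have ltke : (e - d.+1 < e)%N by rewrite -subn_gt0 subKn.
set k0 := (e - d.+1)%N in ltke *; pose i0 : 'I_e := Ordinal ltke.
have k0S : (k0.+1 = e - d)%N by rewrite /k0 -subSn // subSS.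
have bound (b : nat) : forall (l : seq ('X_{1..e} * J)) c, uniq l ->
    (forall k, k \in l -> forall i : 'I_e, (i < k0)%N -> k.1 i = 0%N) ->
    (forall k, k \in l -> (k.1 i0 < b)%N) ->
    I k0 (\sum_(k <- l) c k *: mon k) -> forall k, k \in l -> c k = 0.
  elim: b => [|b IHb] {}l {}c ul l0 lb Is.
    by move=> k /lb.
  pose p0 := fun k : 'X_{1..e} * J => k.1 i0 == 0%N.
  pose sh := fun k : 'X_{1..e} * J => ((k.1 - U_(i0))%MM, k.2).
  pose us := fun k : 'X_{1..e} * J => ((k.1 + U_(i0))%MM, k.2).
  have shK k : ~~ p0 k -> us (sh k) = k.
    by case: k => m j; rewrite /p0 /us /sh /= => mi; rewrite submK // lep1mP.
  pose S0 := \sum_(k <- l | p0 k) c k *: mon k.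
  pose S1 := \sum_(k <- l | ~~ p0 k) c k *: mon (sh k).
  have US1 : U S1 by apply: linear_pred_sum => // k _ _; apply: linear_predZ.
  have Is2 : \sum_(k <- l) c k *: mon k = S0 + x i0 * S1.
    rewrite (bigID p0) /=; congr (_ + _); rewrite mulr_sumr.
    apply: eq_bigr => k nk; rewrite -scalerAr; congr (_ *: _).
    rewrite -{1}(shK _ nk) /us /mon /= mulrA; congr (_ * _).
    by rewrite mulrC mmap1_add mmap1U.
  have c0 k : k \in l -> p0 k -> c k = 0.
    move=> kl pk; apply: (IHd (ltnW lede) (filter p0 l)).
    - exact: filter_uniq.
    - move=> h; rewrite mem_filter => /andP[/eqP ph hl] i; rewrite -k0S ltnS.
      rewrite leq_eqVlt => /orP[/eqP ei|]; last exact: l0.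
      by rewrite -ph; congr (h.1 _); apply: val_inj.
    - rewrite -k0S big_filter -/S0.
      have -> : S0 = \sum_(k <- l) c k *: mon k - x i0 * S1.
        by rewrite Is2 addrK.
      by apply: linear_predB => //; [exact: leI ltke Is | exact: (@xI i0 S1 US1)].
    - by rewrite mem_filter pk.
  have S00 : S0 = 0.
    by rewrite /S0 big_seq_cond big1 // => k /andP[kl pk]; rewrite c0 ?scale0r.
  have Is3 : I k0 S1 by apply: (@regI i0 S1 US1); rewrite -[_ * _]add0r -S00 -Is2.
  move=> k kl; case: (boolP (p0 k)) => pk; first exact: c0.
  have eus : c k = c (us (sh k)) by rewrite shK.
  rewrite eus; apply: (IHb (map sh (filter (fun k => ~~ p0 k) l)) (fun k => c (us k))).
  - rewrite map_inj_in_uniq ?filter_uniq // => h1 h2.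
    rewrite !mem_filter => /andP[n1 _] /andP[n2 _] e12.
    by rewrite -(shK _ n1) -(shK _ n2) e12.
  - move=> h /mapP[h']; rewrite mem_filter => /andP[_ /l0 h0] -> i /h0 /= hi.
    by rewrite mnmBE hi.
  - move=> h /mapP[h']; rewrite mem_filter => /andP[ph /lb hb] -> /=.
    by move: ph; rewrite /p0 mnmBE mnm1E eqxx; case: (h'.1 i0) hb => // a; rewrite subn1.
  - rewrite big_map big_filter; move: Is3; congr (I _ _).
    by apply: eq_bigr => h nh; rewrite shK.
  - by apply: map_f; rewrite mem_filter pk.
move=> {}l {}c ul l0 Is k kl.
apply: (bound (\max_(h <- l) (h.1 i0).+1) l c) => // h hl.
exact: (@leq_bigmax_seq _ l xpredT (fun h => (h.1 i0).+1) h hl isT).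
Qed.

End FreeOverRegular.

Section Regular.
Variables (B : comNzRingType) (M : B -> Prop).
Implicit Types (N : B -> Prop) (cs : seq B).

(** The scalars that act on M. In the application M is a subring of B and not an ideal, so only some
    elements of B act. *)
Definition stabilizes (s : B) := forall a, M a -> M (s * a).

Definition submodule N :=
  [/\ N 0, forall a b, N a -> N b -> N (a - b)
    & forall s a, stabilizes s -> N a -> N (s * a)].

Definition add_mult N c : B -> Prop := fun f => exists2 h, M h & N (f - c * h).

(** As [add_mult N c] is N + cM, this is a regular sequence on M/N, with no condition on the last
    quotient. *)
Fixpoint regular N cs : Prop :=
  if cs is c :: cs' then
    (forall f, M f -> N (c * f) -> N f) /\ regular (add_mult N c) cs'
  else True.

Hypothesis subM : submodule M.

Lemma submodule0 N : submodule N -> N 0. Proof. by case. Qed.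
Lemma submoduleB N a b : submodule N -> N a -> N b -> N (a - b).
Proof. by case=> _ + _; apply. Qed.
Lemma submoduleN N a : submodule N -> N a -> N (- a).
Proof. by move=> sN Na; rewrite -sub0r; apply: submoduleB => //; apply: submodule0. Qed.
Lemma submoduleD N a b : submodule N -> N a -> N b -> N (a + b).
Proof.
by move=> sN Na Nb; rewrite -[b]opprK; apply: submoduleB => //; apply: submoduleN.
Qed.
Lemma submoduleM N s a : submodule N -> stabilizes s -> N a -> N (s * a).
Proof. by case=> _ _; apply. Qed.

Lemma stabilizesM s t : stabilizes s -> stabilizes t -> stabilizes (s * t).
Proof. by move=> ss st a Ma; rewrite -mulrA; apply/ss/st. Qed.
Lemma stabilizesD s t : stabilizes s -> stabilizes t -> stabilizes (s + t).
Proof. by move=> ss st a Ma; rewrite mulrDl; apply: (submoduleD subM); [apply: ss|apply: st]. Qed.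
Lemma stabilizes0 : stabilizes 0.
Proof. by move=> a _; rewrite mul0r; apply: (submodule0 subM). Qed.
Lemma stabilizes1 : stabilizes 1. Proof. by move=> a; rewrite mul1r. Qed.

Lemma submodule_add_mult N c : submodule N -> submodule (add_mult N c).
Proof.
move=> sN; split.
- exists 0; [exact: (submodule0 subM) | by rewrite mulr0 subr0; apply: (submodule0 sN)].
- move=> a b [h Mh Nh] [k Mk Nk]; exists (h - k); first exact: (submoduleB subM).
  have -> : a - b - c * (h - k) = (a - c * h) - (b - c * k).
    by ring.
  exact: submoduleB.
- move=> s a ss [h Mh Nh]; exists (s * h); first exact: ss.
  by rewrite mulrCA -mulrBr; apply: submoduleM.
Qed.

Lemma sub_add_mult N c f : N f -> add_mult N c f.
Proof. by move=> Nf; exists 0; rewrite ?mulr0 ?subr0 //; apply: submodule0. Qed.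

Lemma mult_add_mult N c h : submodule N -> M h -> add_mult N c (c * h).
Proof. by move=> sN Mh; exists h; rewrite ?subrr //; apply: submodule0. Qed.

Lemma regular_ext N N' cs : (forall f, N f <-> N' f) -> regular N cs -> regular N' cs.
Proof.
elim: cs N N' => //= c cs IHcs N N' NN' [regc regcs]; split.
  by move=> f Mf /NN' /regc -/(_ Mf) /NN'.
by apply: IHcs regcs => f; split=> -[h Mh /NN' Nh]; exists h.
Qed.

(* Exactness of M/aM -> M/abM -> M/bM survives dividing by cs, because b stays
   regular modulo any initial part of cs. *)
Lemma regular_mul N a b cs : submodule N -> stabilizes a -> stabilizes b ->
  (forall c, c \in cs -> stabilizes c) ->
  regular N (a :: cs) -> regular N (b :: cs) -> regular N (a * b :: cs).
Proof.
move=> sN sa sb scs [rega regas] [regb regbs]; split.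
  by move=> f Mf; rewrite -mulrA => /(rega _ (sb _ Mf)); apply: regb.
elim: cs N sN scs {rega} regas regb regbs => //= c cs IHcs N sN scs.
move=> [regca regas] regb [regcb regbs].
have sc : stabilizes c by apply: scs; rewrite mem_head.
have comm N' d d' f : add_mult (add_mult N' d) d' f <-> add_mult (add_mult N' d') d f.
  by split=> -[h Mh [k Mk Nk]]; exists k => //; exists h => //; rewrite addrAC.
have regbc f : M f -> add_mult N c (b * f) -> add_mult N c f.
  move=> Mf [h Mh Nh].
  have [k Mk Nk] : add_mult N b h.
    apply: regcb => //; exists f => //.
    by rewrite -opprB; apply: submoduleN.
  exists k => //; apply: regb; first by apply: submoduleB => //; apply: sc.
  have -> : b * (f - c * k) = (b * f - c * h) + c * (h - b * k).
    by ring.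
  by apply: submoduleD => //; apply: submoduleM.
split.
  move=> f Mf [h Mh Nh].
  have [k Mk Nk] : add_mult N b f.
    apply: regcb => //; exists (a * h); first exact: sa.
    by rewrite mulrCA mulrA.
  have [p Mp Np] : add_mult N a k.
    apply: regca => //; exists h => //; apply: regb.
      by apply: submoduleB => //; [apply: sc | apply: sa].
    have -> : b * (c * k - a * h) = (c * f - a * b * h) - c * (f - b * k).
      by ring.
    by apply: submoduleB => //; apply: submoduleM.
  exists p => //.
  have -> : f - a * b * p = (f - b * k) + b * (k - a * p).
    by ring.
  by apply: submoduleD => //; apply: submoduleM.
apply: (@regular_ext (add_mult (add_mult N c) (a * b))); first by move=> f; apply: comm.
apply: IHcs => //.
- exact: submodule_add_mult.
- by move=> d dcs; apply: scs; rewrite inE dcs orbT.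
- by apply: regular_ext regas => f; apply: comm.
- by apply: regular_ext regbs => f; apply: comm.
Qed.

(** Only the action of the sequence on M/N matters. This serves to replace e_k of a set of variables
    by e_k of the set without x_i, once x_i has been divided out. *)
Lemma regular_cong N (T : Type) (F G : T -> B) (l : seq T) cs : submodule N ->
  (forall k f, M f -> N ((F k - G k) * f)) ->
  regular N (map F l ++ cs) -> regular N (map G l ++ cs).
Proof.
elim: l N => //= k l IHl N sN FG [regk regl]; split.
  move=> f Mf Nf; apply: regk => //.
  by rewrite -[F k](subrK (G k)) mulrDl; apply: submoduleD => //; apply: FG.
apply: (@regular_ext (add_mult N (F k))).
  move=> f; split=> -[h Mh Nh]; exists h => //.
    have -> : f - G k * h = (f - F k * h) + (F k - G k) * h.
      by ring.
    by apply: submoduleD => //; apply: FG.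
  have -> : f - F k * h = (f - G k * h) - (F k - G k) * h.
    by ring.
  by apply: submoduleB => //; apply: FG.
apply: IHl regl; first exact: submodule_add_mult.
by move=> j f Mf; apply: sub_add_mult; apply: FG.
Qed.

End Regular.

(** * Elementary symmetric polynomials of a regular sequence *)

Section ElementarySymmetric.
Variables (B : comNzRingType) (n : nat) (x : 'I_n -> B).

Definition elsym (S : {set 'I_n}) (k : nat) : B :=
  \sum_(A : {set 'I_n} | (A \subset S) && (#|A| == k)) \prod_(i in A) x i.

Lemma elsymD1 (S : {set 'I_n}) i k : i \in S ->
  elsym S k.+1 = elsym (S :\ i) k.+1 + x i * elsym (S :\ i) k.
Proof.
move=> iS; rewrite /elsym (bigID (fun A : {set 'I_n} => i \in A)) /= addrC.
congr (_ + _).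
  apply: eq_bigl => A; rewrite subsetD1 -!andbA; case: (A \subset S) => //=.
  by rewrite andbC.
rewrite (reindex_onto (fun A => i |: A) (fun A => A :\ i)) /=; last first.
  by move=> A /andP[_ iA]; rewrite setD1K.
rewrite mulr_sumr; apply: eq_big => [A|A].
  rewrite subUset sub1set iS setU11 andbT /= subsetD1.
  case: (boolP (i \in A)) => iA /=; last first.
    rewrite andbT setU1K // eqxx andbT cardsU1 iA add1n eqSS.
    by [].
  rewrite andbF /=; apply/negbTE/negP => /andP[_ /eqP eA].
  by move: iA; rewrite -eA setD11.
move=> /andP[/andP[_ _] /eqP eA]; rewrite (bigD1 i) ?setU11 //=; congr (_ * _).
by apply: eq_bigl => j; rewrite -[in RHS]eA !inE andbC.
Qed.

Lemma elsym_card (S : {set 'I_n}) : elsym S #|S| = \prod_(i in S) x i.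
Proof.
rewrite /elsym (big_pred1 S) // => A; apply/andP/eqP => [[AS /eqP cA]|->]; last by [].
by apply/eqP; rewrite eqEcard AS cA leqnn.
Qed.

(** Highest degree first: the sequence starts with the product of all variables, to which
    [regular_mul] applies. *)
Definition elsyms (S : {set 'I_n}) := [seq elsym S k.+1 | k <- rev (iota 0 #|S|)].

Variables (M : B -> Prop) (NN : {set 'I_n} -> B -> Prop).
Hypothesis subM : submodule M M.
Hypothesis xM : forall i, stabilizes M (x i).
Hypothesis subN : forall J, submodule M (NN J).
Hypothesis NN_U1 : forall (i : 'I_n) J f, NN (i |: J) f <-> add_mult M (NN J) (x i) f.
Hypothesis NN_reg : forall (i : 'I_n) (J : {set 'I_n}) f,
  i \notin J -> M f -> NN J (x i * f) -> NN J f.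

Lemma elsym_stabilizes S k : stabilizes M (elsym S k).
Proof.
rewrite /elsym; apply: big_ind.
- exact: stabilizes0.
- by move=> s t; apply: stabilizesD.
move=> A _; apply: big_ind => [||i _]; [exact: stabilizes1 | | exact: xM].
by move=> s t; apply: stabilizesM.
Qed.

(** Induction on the size of S. The first term is the product of the x_i, and by [regular_mul] a
    single factor x_i may stand in its place. Modulo x_i the polynomial e_k of S becomes e_k of S
    without i, and i joins J, so that the induction hypothesis applies. *)
Lemma regular_elsyms (S J : {set 'I_n}) cs : [disjoint S & J] ->
  (forall c, c \in cs -> stabilizes M c) ->
  regular M (NN (J :|: S)) cs -> regular M (NN J) (elsyms S ++ cs).
Proof.
move: {2}#|S| (leqnn #|S|) => m; elim: m S J => [|m IHm] S J.
  rewrite leqn0 cards_eq0 => /eqP -> _ _.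
  by rewrite /elsyms cards0 setU0.
rewrite leq_eqVlt => /orP[/eqP cS|]; last by rewrite ltnS; apply: IHm.
move=> dSJ scs regcs; rewrite /elsyms cS -addn1 iotaD rev_cat /= -cS elsym_card.
have stab c : c \in [seq elsym S k.+1 | k <- rev (iota 0 m)] ++ cs -> stabilizes M c.
  by rewrite mem_cat => /orP[/mapP[k _ ->]|/scs //]; apply: elsym_stabilizes.
have one i : i \in S ->
    regular M (NN J) (x i :: [seq elsym S k.+1 | k <- rev (iota 0 m)] ++ cs).
  move=> iS; have iJ : i \notin J by rewrite (disjointFr dSJ).
  split; first by move=> f; apply: NN_reg.
  apply: (@regular_ext _ _ (NN (i |: J))); first exact: NN_U1.
  apply: (@regular_cong _ _ _ _ _ (fun k => elsym (S :\ i) k.+1)) => //.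
    move=> k f Mf; rewrite (elsymD1 k iS) opprD addrA subrr sub0r mulNr -mulrA.
    apply: (submoduleN (M := M)) => //; apply/NN_U1; apply: mult_add_mult => //.
    exact: elsym_stabilizes.
  have cSi : #|S :\ i| = m by move: cS; rewrite (cardsD1 i) iS => -[].
  rewrite -{1}cSi; apply: (IHm (S :\ i)) => //.
  - by rewrite cSi.
  - rewrite -setI_eq0; apply/eqP/setP => j; rewrite !inE.
    case: (altP (j =P i)) => //= _; apply/negP => /andP[jS].
    by rewrite (disjointFr dSJ jS).
  - have -> : i |: J :|: S :\ i = J :|: S; last by [].
    apply/setP => j; rewrite !inE; case: eqP => [->|_] //=.
    by rewrite iS orbT.
have [i0 i0S] : exists i, i \in S by apply/set0Pn; rewrite -cards_eq0 cS.
change (regular M (NN J) (\prod_(i in S) x i ::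
  [seq elsym S k.+1 | k <- rev (iota 0 m)] ++ cs)).
(* The product is assembled factor by factor from the sequences that start with a single x_i. *)
rewrite -big_enum /=; have: {subset enum S <= S} by move=> i; rewrite mem_enum.
have: enum S != [::] by rewrite -size_eq0 -cardE cS.
elim: (enum S) => // i l IHl _ sub; rewrite big_cons.
have iS : i \in S by apply: sub; rewrite mem_head.
case: l IHl sub => [|i' l] IHl sub; first by rewrite big_nil mulr1; apply: one.
apply: regular_mul => //.
- elim: (i' :: l) => [|j l' IHl']; first by rewrite big_nil; apply: stabilizes1.
  by rewrite big_cons; apply: stabilizesM.
- exact: one.
- by apply: IHl => // j jl; apply: sub; rewrite inE jl orbT.
Qed.

End ElementarySymmetric.

(** * Generic injectivity and Newton's identities *)

Section LinearAlgebra.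
Variables (K : fieldType) (V : lmodType K).

Definition free_on (J : eqType) (l : seq J) (v : J -> V) :=
  forall c : J -> K, \sum_(j <- l) c j *: v j = 0 -> forall j, j \in l -> c j = 0.

Definition span_on (J : eqType) (l : seq J) (v : J -> V) (u : V) :=
  exists c : J -> K, u = \sum_(j <- l) c j *: v j.

Lemma linear_span_on (J : eqType) (l : seq J) (v : J -> V) : linear_pred (span_on l v).
Proof.
split; first by exists (fun _ => 0); rewrite big1 // => j _; rewrite scale0r.
move=> k _ _ [c ->] [d ->]; exists (fun j => k * c j + d j).
rewrite scaler_sumr -big_split /=; apply: eq_bigr => j _.
by rewrite scalerA scalerDl.
Qed.

Lemma mem_span_on (J : eqType) (l : seq J) (v : J -> V) j :
  uniq l -> j \in l -> span_on l v (v j).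
Proof.
move=> ul jl; exists (fun i => (i == j)%:R).
rewrite (bigD1_seq j) //= eqxx scale1r big1 ?addr0 // => i /negbTE ->.
by rewrite scale0r.
Qed.

Definition ord_fun (J : eqType) (l : seq J) (c : 'I_(size l) -> K) (j : J) : K :=
  oapp c 0 (insub (index j l)).

Lemma ord_funE (J : eqType) (l : seq J) (c : 'I_(size l) -> K) i :
  uniq l -> ord_fun c (tnth (in_tuple l) i) = c i.
Proof.
move=> ul; rewrite /ord_fun (tnth_nth (tnth (in_tuple l) i)) /= index_uniq ?ltn_ord //.
by rewrite valK.
Qed.

Lemma free_onP (J : eqType) (l : seq J) (v : J -> V) : uniq l ->
  free_on l v <-> forall c : 'I_(size l) -> K,
    \sum_i c i *: v (tnth (in_tuple l) i) = 0 -> forall i, c i = 0.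
Proof.
move=> ul; split=> [fl c s0 i|fl c]; last first.
  rewrite big_tnth => s0 j /seq_tnthP[i ->].
  exact: (fl (fun i => c (tnth (in_tuple l) i))).
rewrite -(ord_funE c i ul); apply: fl; last exact: mem_tnth.
by rewrite big_tnth -[RHS]s0; apply: eq_bigr => k _; rewrite ord_funE.
Qed.

Lemma steinitz_ord N M (v : 'I_N -> V) (u : 'I_M -> V) :
  (forall c : 'I_N -> K, \sum_i c i *: v i = 0 -> forall i, c i = 0) ->
  (forall i, exists c : 'I_M -> K, v i = \sum_j c j *: u j) -> (N <= M)%N.
Proof.
move=> fv /choice[A vA]; rewrite leqNgt; apply/negP => ltMN.
pose Am : 'M[K]_(N, M) := \matrix_(i, j) A i j.
have : kermx Am != 0.
  rewrite -mxrank_eq0 mxrank_ker -lt0n subn_gt0.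
  by apply: leq_ltn_trans ltMN; apply: rank_leq_col.
case/rowV0Pn => w /sub_kermxP wA /negP[]; apply/eqP/rowP => i; rewrite mxE.
apply: (fv (fun i => w ord0 i)).
under eq_bigr => k _ do rewrite vA scaler_sumr.
rewrite exchange_big big1 //= => j _.
under eq_bigr => k _ do rewrite scalerA.
rewrite -scaler_suml; move/matrixP: wA => /(_ ord0 j); rewrite !mxE.
by under eq_bigr do rewrite mxE; move=> ->; rewrite scale0r.
Qed.

Lemma steinitz (J J' : eqType) (l : seq J) (l' : seq J') (v : J -> V) (u : J' -> V) :
  uniq l -> free_on l v -> (forall j, j \in l -> span_on l' u (v j)) ->
  (size l <= size l')%N.
Proof.
move=> ul /(free_onP _ ul) fl sl.
apply: (@steinitz_ord _ _ (fun i => v (tnth (in_tuple l) i))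
                          (fun i => u (tnth (in_tuple l') i))) => // i.
case: (sl (tnth (in_tuple l) i)) => [|c ->]; first exact: mem_tnth.
by exists (fun i => c (tnth (in_tuple l') i)); rewrite big_tnth.
Qed.

End LinearAlgebra.

(** Injectivity at v0 gives a right inverse of the matrix there. F is the determinant of the
    polynomial matrix times this fixed inverse: it is 1 at v0, and where it is nonzero the matrix
    still has a right inverse. No maximal minor has to be selected. *)
Lemma generic_injective (K : fieldType) (k : nat) (T1 T2 : finType)
    (rho : T1 -> T2 -> {mpoly K[k]}) (v0 : 'I_k -> K) :
  let inj_at v := forall x : T1 -> K,
    (forall t, \sum_m x m * (rho m t).@[v] = 0) -> forall m, x m = 0 in
  inj_at v0 ->
  exists2 F : {mpoly K[k]}, F.@[v0] != 0 & forall v, F.@[v] != 0 -> inj_at v.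
Proof.
move=> inj_at inj0.
pose A : 'M[{mpoly K[k]}]_(#|T1|, #|T2|) := \matrix_(i, j) rho (enum_val i) (enum_val j).
have injE v : inj_at v <-> row_free (map_mx (meval v) A).
  have sumE (x : T1 -> K) (w : 'rV[K]_#|T1|) t : (forall i, w ord0 i = x (enum_val i)) ->
      (w *m map_mx (meval v) A) ord0 (enum_rank t) = \sum_m x m * (rho m t).@[v].
    move=> wx; rewrite mxE (reindex (@enum_val _ T1)) /=; last first.
      by apply: onW_bij; apply: enum_val_bij.
    by apply: eq_bigr => i _; rewrite wx !mxE enum_rankK.
  split=> [inj|/row_free_inj rf x x0 m].
    rewrite -kermx_eq0; apply/eqP/row_matrixP => j; rewrite row0.
    apply/rowP => i; rewrite [RHS]mxE.
    pose x m := row j (kermx (map_mx (meval v) A)) ord0 (enum_rank m).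
    rewrite -(enum_valK i); apply: (inj x) => t.
    rewrite -(sumE x (row j (kermx (map_mx (meval v) A)))); last first.
      by move=> i'; rewrite /x enum_valK.
    by rewrite -row_mul mulmx_ker row0 mxE.
  pose w : 'rV[K]_#|T1| := \row_i x (enum_val i).
  have w0 : w *m map_mx (meval v) A = 0 *m map_mx (meval v) A.
    rewrite mul0mx; apply/rowP => j; rewrite -(enum_valK j) (sumE x) ?x0 ?mxE // => i.
    by rewrite mxE.
  by move/rowP: (rf _ _ _ w0) => /(_ (enum_rank m)); rewrite !mxE enum_rankK.
have /row_freeP[B AB] := (injE v0).1 inj0.
pose F := \det (A *m map_mx (mpolyC k (R := K)) B).
have FE v : F.@[v] = \det (map_mx (meval v) A *m B).
  rewrite -det_map_mx map_mxM; congr (\det (_ *m _)).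
  by apply/matrixP => i j; rewrite [LHS]mxE [in LHS]mxE; apply: mevalC.
exists F; first by rewrite FE AB det1 oner_neq0.
move=> v; rewrite FE => dn0; apply/injE; apply/row_freeP.
exists (B *m invmx (map_mx (meval v) A *m B)).
by rewrite mulmxA mulmxV // unitmxE unitfE.
Qed.

Section NewtonIdentities.
Variables A : comNzRingType.

(* E = exp (- int P), up to degree d. *)
Definition newton (d : nat) (P E : {poly A}) :=
  forall m, (m < d)%N -> (E^`() + P * E)`_m = 0.

Lemma coefM_low (p q : {poly A}) m :
  (forall i, (i <= m)%N -> p`_i = 0) -> (p * q)`_m = 0.
Proof. by move=> p0; rewrite coefM big1 // => i _; rewrite p0 ?mul0r // -ltnS. Qed.

(** P is minus the logarithmic derivative of E, up to degree d, so products of the E become sums of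
    the P. *)
Lemma newtonM d P Q E F : newton d P E -> newton d Q F -> newton d (P + Q) (E * F).
Proof.
move=> nE nF m md.
have -> : (E * F)^`() + (P + Q) * (E * F) =
    (E^`() + P * E) * F + (F^`() + Q * F) * E.
    rewrite derivM !mulrDl addrACA; congr (_ + _); first by rewrite mulrA.
    by rewrite [E * _^`()]mulrC [E * F]mulrC mulrA.
by rewrite coefD !coefM_low ?addr0 // => i im; [apply: nF|apply: nE]; apply: leq_ltn_trans md.
Qed.

Lemma newton_linear d (x : A) :
  newton d (\poly_(i < d) x ^+ i.+1) (1 - x *: 'X).
Proof.
move=> m md; rewrite derivB derivZ derivX derivC sub0r mulrBr mulr1 -scalerAr.
rewrite coefD coefB coefN coefZ coefZ coef1 coefMX !coef_poly md.
case: m md => [|m] md /=; first by rewrite mulr1 mulr0 subr0 addNr.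
by rewrite (ltnW md) mulr0 oppr0 add0r -exprS subrr.
Qed.

Lemma newton0 d : newton d 0 1.
Proof. by move=> m md; rewrite derivC mul0r addr0 coef0. Qed.

Lemma newton_prod d (I : Type) (r : seq I) (x : I -> A) :
  newton d (\poly_(i < d) \sum_(j <- r) x j ^+ i.+1) (\prod_(j <- r) (1 - x j *: 'X)).
Proof.
elim: r => [|j r IHr].
  have -> : \poly_(i < d) \sum_(j <- [::]) x j ^+ i.+1 = 0 :> {poly A}.
    by apply/polyP => i; rewrite coef_poly big_nil coef0 if_same.
  by rewrite big_nil; apply: newton0.
rewrite big_cons; have -> : \poly_(i < d) \sum_(j <- j :: r) x j ^+ i.+1 =
    \poly_(i < d) x j ^+ i.+1 + \poly_(i < d) \sum_(j <- r) x j ^+ i.+1.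
  by apply/polyP => i; rewrite coefD !coef_poly big_cons; case: ifP; rewrite ?addr0.
by apply: newtonM IHr; apply: newton_linear.
Qed.

End NewtonIdentities.

Section NewtonExp.
Variables (K : fieldType) (A : comAlgType K).
Hypothesis char0 : forall m, (m.+1%:R : K) != 0.

(** In degree m the equation gives (m + 1) E_(m+1) in terms of lower coefficients, and m + 1 is
    invertible. *)
Lemma newton_unique d (P Q E F : {poly A}) : newton d P E -> newton d Q F ->
  (forall i, (i < d)%N -> P`_i = Q`_i) -> E`_0 = F`_0 ->
  forall m, (m <= d)%N -> E`_m = F`_m.
Proof.
move=> nE nF PQ E0; elim/ltn_ind => -[|m] IHm // md.
have := nE m md; have := nF m md; rewrite !coefD !coef_deriv => hF hE.
have e : E`_m.+1 *+ m.+1 = F`_m.+1 *+ m.+1.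
  apply: (@addIr _ ((P * E)`_m)); rewrite hE -[LHS]hF; congr (_ + _).
  rewrite !coefM; apply: eq_bigr => i _; rewrite PQ; last first.
    by apply: leq_ltn_trans md; rewrite -ltnS.
  by rewrite IHm ?ltnS ?leq_subr // (leq_trans (leq_subr _ _)) // ltnW.
apply: (can_inj (scalerK (char0 m))).
by rewrite !scaler_nat.
Qed.

End NewtonExp.

(** * Noetherian modules *)

Section Noetherian.
Variables (K : fieldType) (B : comAlgType K).
Implicit Types (qs l : seq B) (U N : B -> Prop).

Definition stable_under qs U := forall q u, q \in qs -> U u -> U (q * u).

(** The module generated by l over the algebra K[qs]. The algebra is not formed: its submodules are
    the subspaces stable under qs. *)
Definition gen_module qs l (u : B) := forall U, linear_pred U -> stable_under qs U ->
  (forall v, v \in l -> U v) -> U u.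

Definition noeth_module qs N := forall U, linear_pred U -> stable_under qs U ->
  (forall u, U u -> N u) ->
  exists l, (forall v, v \in l -> U v) /\ forall u, U u -> gen_module qs l u.

Lemma linear_gen_module qs l : linear_pred (gen_module qs l).
Proof.
split=> [U linU _ _|k u v gu gv U linU sU lU]; first exact: linear_pred0 linU.
by apply: (linear_pred2 linU); [apply: gu | apply: gv].
Qed.

Lemma stable_gen_module qs l : stable_under qs (gen_module qs l).
Proof. by move=> q u qq gu U linU sU lU; exact: sU _ _ qq (gu U linU sU lU). Qed.

Lemma mem_gen_module qs l v : v \in l -> gen_module qs l v.
Proof. by move=> vl U _ _ lU; apply: lU. Qed.

Lemma noeth_span l : noeth_module [::] (span_on l id).
Proof.
elim: l => [|b l IHl] U linU sU UN.
  by exists [::]; split=> // u /UN[c]; rewrite big_nil => -> V [].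
have linN := @linear_span_on _ _ _ l id.
pose U' u := U u /\ span_on l id u.
have [| |u []//|l' [l'U gl']] := IHl U'; first 1 last.
- by move=> q u; rewrite in_nil.
- case: (pselect (exists2 u, U u & ~ span_on l id u)) => [[u0 U0 nu0]|nex]; last first.
    exists l'; split=> [v /l'U[]//|u Uu]; apply: gl'; split => //.
    by apply: contrapT => nu; apply: nex; exists u.
  have dec u : U u -> exists d, span_on l id (u - d *: b).
    move=> /UN[c ->]; exists (c b); exists c.
    by rewrite big_cons addrAC subrr add0r.
  have [c hc] := dec _ U0.
  have c0 : c != 0 by apply/eqP => c0; apply: nu0; rewrite c0 scale0r subr0 in hc.
  exists (u0 :: l'); split=> [v|u Uu]; first by rewrite inE => /predU1P[->//|/l'U[]].
  have [d hd] := dec _ Uu.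
  have : U' (u - (d / c) *: u0).
    split; first by apply: linear_predB => //; apply: linear_predZ.
    have -> : u - (d / c) *: u0 = (u - d *: b) - (d / c) *: (u0 - c *: b).
      by rewrite scalerBr scalerA divfK // opprB addrA subrK.
    by apply: linear_predB => //; apply: linear_predZ.
  move=> /gl' gu V linV sV lV; rewrite -[u](subrK ((d / c) *: u0)).
  apply: linear_predD => //; last by apply: linear_predZ => //; apply: lV; rewrite mem_head.
  by apply: gu => // v vl'; apply: lV; rewrite inE vl' orbT.
split=> [|k u v [Uu Su] [Uv Sv]]; first by split; [apply: linear_pred0 linU|apply: linear_pred0 linN].
by split; [apply: (linear_pred2 linU) | apply: (linear_pred2 linN)].
Qed.

(** N + q N + ... + q^(k-1) N inside B, where an element may have several such presentations. *)
Definition adjoin_upto q N k (u : B) :=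
  exists2 f : nat -> B, (forall i, N (f i)) & u = \sum_(i < k) q ^+ i * f i.

Definition adjoin q N u := exists k, adjoin_upto q N k u.

Section Adjoin.
Variables (qs : seq B) (N : B -> Prop) (q : B).
Hypotheses (linN : linear_pred N) (stN : stable_under qs N).
Local Notation adj := (adjoin_upto q N).

Lemma linear_adjoin_upto k : linear_pred (adj k).
Proof.
split=> [|a _ _ [f Nf ->] [g Ng ->]].
  exists (fun=> 0) => [_|]; first exact: linear_pred0 linN.
  by rewrite big1 // => i _; rewrite mulr0.
exists (fun i => a *: f i + g i) => [i|]; first by apply: (linear_pred2 linN).
rewrite scaler_sumr -big_split /=; apply: eq_bigr => i _.
by rewrite mulrDr scalerAr.
Qed.

Lemma stable_adjoin_upto k : stable_under qs (adj k).
Proof.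
move=> p _ pq [f Nf ->]; exists (fun i => p * f i) => [i|]; first exact: stN.
by rewrite mulr_sumr; apply: eq_bigr => i _; rewrite mulrCA.
Qed.

Lemma adjoin_uptoM j k u : adj k u -> adj (j + k) (q ^+ j * u).
Proof.
case=> f Nf ->; exists (fun i => if (i < j)%N then 0 else f (i - j)%N) => [i|].
  by case: ifP => _ //; apply: linear_pred0 linN.
rewrite big_split_ord /= [X in X + _]big1 ?add0r; last first.
  by move=> i _; rewrite ltn_ord mulr0.
rewrite mulr_sumr; apply: eq_bigr => i _.
by rewrite ltnNge leq_addr /= addKn mulrA exprD.
Qed.

Lemma adjoin_uptoW j k u : (k <= j)%N -> adj k u -> adj j u.
Proof.
move=> kj [f Nf ->]; exists (fun i => if (i < k)%N then f i else 0) => [i|].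
  by case: ifP => _ //; apply: linear_pred0 linN.
rewrite (big_ord_widen j (fun i => q ^+ i * f i)) // [RHS](bigID (fun i : 'I_j => (i < k)%N)) /=.
rewrite [X in _ = _ + X]big1 ?addr0 => [|i /negbTE ->]; last by rewrite mulr0.
by apply: eq_bigr => i ->.
Qed.

Lemma adjoin_uptoS k u :
  adj k.+1 u <-> exists2 v, N v & adj k (u - q ^+ k * v).
Proof.
split=> [[f Nf ->]|[v Nv [f Nf e]]].
  by exists (f k) => //; rewrite big_ord_recr /= addrK; exists f.
exists (fun i => if i == k then v else f i) => [i|]; first by case: ifP.
rewrite big_ord_recr /= eqxx -[u](subrK (q ^+ k * v)) e; congr (_ + _).
by apply: eq_bigr => i _; rewrite ltn_eqF.
Qed.

Lemma linear_adjoin : linear_pred (adjoin q N).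
Proof.
split=> [|a u v [j ju] [k kv]]; first by exists 0%N; apply: linear_pred0 (linear_adjoin_upto 0).
exists (maxn j k); apply: (linear_pred2 (linear_adjoin_upto _)).
  by apply: adjoin_uptoW ju; rewrite leq_maxl.
by apply: adjoin_uptoW kv; rewrite leq_maxr.
Qed.

Lemma stable_adjoin : stable_under (q :: qs) (adjoin q N).
Proof.
move=> p u; rewrite inE => /predU1P[->|pq] [k ku].
  by exists (1 + k)%N; rewrite -[q]expr1; apply: adjoin_uptoM.
by exists k; apply: stable_adjoin_upto.
Qed.

(** Hilbert's basis theorem. Presentations are not unique, so a leading coefficient of u in degree k
    is any v in N for which u - q^k v needs only powers below k; [L k] collects them for u in U. The
    [L k] increase with k, their union is finitely generated, hence equal to some [L k0], and lifts
    of generators of [L k] for k <= k0 generate U. *)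
Lemma noeth_adjoin : noeth_module qs N -> noeth_module (q :: qs) (adjoin q N).
Proof.
move=> noN U linU sU UN.
have sUqs : stable_under qs U by move=> p u pq; apply: sU; rewrite inE pq orbT.
pose L k v := N v /\ exists2 u, U u & adj k (u - q ^+ k * v).
have linL k : linear_pred (L k).
  split=> [|a v w [Nv [u Uu hu]] [Nw [u' Uu' hu']]].
    split; first exact: linear_pred0 linN.
    exists 0; first exact: linear_pred0 linU.
    by rewrite mulr0 subr0; apply: linear_pred0 (linear_adjoin_upto k).
  split; first by apply: (linear_pred2 linN).
  exists (a *: u + u'); first by apply: (linear_pred2 linU).
  have -> : a *: u + u' - q ^+ k * (a *: v + w) =
      a *: (u - q ^+ k * v) + (u' - q ^+ k * w).
    by rewrite mulrDr opprD addrACA scalerBr -scalerAr.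
  by apply: (linear_pred2 (linear_adjoin_upto k)).
have sL k : stable_under qs (L k).
  move=> p v pq [Nv [u Uu hu]]; split; first exact: stN.
  exists (p * u); first exact: sUqs.
  by rewrite mulrCA -mulrBr; apply: stable_adjoin_upto.
have LS j k v : (j <= k)%N -> L j v -> L k v.
  move=> jk [Nv [u Uu hu]]; split=> //; exists (q ^+ (k - j) * u).
    elim: (k - j)%N => [|i IHi]; first by rewrite mul1r.
    by rewrite exprS -mulrA; apply: sU => //; rewrite mem_head.
  have -> : q ^+ k = q ^+ (k - j) * q ^+ j by rewrite -exprD subnK.
  by rewrite -mulrA -mulrBr; have := adjoin_uptoM (k - j) hu; rewrite subnK.
pose LL v := exists k, L k v.
have [||v [k []]//|l [lL gl]] := noN LL.
- split=> [|a v w [j vj] [k wk]]; first by exists 0%N; apply: linear_pred0 (linL 0%N).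
  exists (maxn j k); apply: (linear_pred2 (linL (maxn j k))).
    by apply: LS vj; apply: leq_maxl.
  by apply: LS wk; apply: leq_maxr.
- by move=> p v pq [k vk]; exists k; apply: sL.
have [k0 lk0] : exists k, forall v, v \in l -> L k v.
  elim: l lL {gl} => [|v l IHl] lL; first by exists 0%N.
  have [j jl] := IHl (fun w wl => lL w (mem_behead (s := v :: l) wl)).
  have [k vk] := lL v (mem_head _ _).
  exists (maxn j k) => w; rewrite inE => /predU1P[->|/jl].
    by apply: LS vk; apply: leq_maxr.
  by apply: LS; apply: leq_maxl.
have /choice[ll llP] k : exists lk, (forall v, v \in lk -> L k v) /\
    forall v, L k v -> gen_module qs lk v.
  by apply: noN => // v [].
have /choice[lift liftP] (kv : nat * B) : exists u, L kv.1 kv.2 ->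
    U u /\ adj kv.1 (u - q ^+ kv.1 * kv.2).
  case: (pselect (L kv.1 kv.2)) => [[_ [u Uu hu]]|nL]; first by exists u.
  by exists 0.
pose G := flatten [seq [seq lift (k, v) | v <- ll k] | k <- iota 0 k0.+1].
have GU v : v \in G -> U v.
  move=> /flattenP[_ /mapP[k _ ->] /mapP[w wk ->]].
  by have [_ /(_ _)] := llP k; case: (liftP (k, w)) => //=; apply: (llP k).1.
exists G; split=> // u Uu; have [k] := UN u Uu.
elim: k u Uu => [|k IHk] u Uu.
  by move=> [f _ ->]; rewrite big_ord0; apply: linear_pred0 (linear_gen_module _ _).
move=> /adjoin_uptoS[v Nv hv].
have Lv : L k v by split=> //; exists u.
(* Beyond k0 no new leading coefficients occur, so lifts in degree k0 are multiplied by a power of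
   q. *)
pose k' := minn k k0.
have gv : gen_module qs (ll k') v.
  rewrite /k'; case: (leqP k k0) => kk0; first by apply (llP k).2.
  move=> V linV sV lV; apply: (gl v (ex_intro _ k Lv)) => // w wl.
  by have := (llP k0).2 w (lk0 w wl); apply.
have [g Gg hg] : exists2 g, gen_module (q :: qs) G g & adj k (g - q ^+ k * v).
  apply: (gv (fun v => exists2 g, gen_module (q :: qs) G g & adj k (g - q ^+ k * v))).
  - split=> [|a w w' [g Gg hg] [g' Gg' hg']].
      exists 0; first exact: linear_pred0 (linear_gen_module _ _).
      by rewrite mulr0 subr0; apply: linear_pred0 (linear_adjoin_upto k).
    exists (a *: g + g'); first by apply: (linear_pred2 (linear_gen_module (q :: qs) G)).
    have -> : a *: g + g' - q ^+ k * (a *: w + w') =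
        a *: (g - q ^+ k * w) + (g' - q ^+ k * w').
      by rewrite mulrDr opprD addrACA scalerBr -scalerAr.
    by apply: (linear_pred2 (linear_adjoin_upto k)).
  - move=> p w pq [g Gg hg]; exists (p * g).
      by apply: stable_gen_module => //; rewrite inE pq orbT.
    by rewrite mulrCA -mulrBr; apply: stable_adjoin_upto.
  - move=> w wk; have [] := liftP (k', w); first exact: (llP k').1.
    move=> /= Ulw hlw; exists (q ^+ (k - k') * lift (k', w)).
      have : gen_module (q :: qs) G (lift (k', w)).
        apply: mem_gen_module; apply/flattenP; exists [seq lift (k', v) | v <- ll k'].
          apply: (map_f (fun k => [seq lift (k, v) | v <- ll k])).
          by rewrite mem_iota ltnS geq_minr.
        exact: (map_f (fun v => lift (k', v))).
      elim: (k - k')%N => [|i IHi] Glw; first by rewrite mul1r.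
      by rewrite exprS -mulrA; apply: stable_gen_module; rewrite ?mem_head //; apply: IHi.
    have kk : (k' <= k)%N by apply: geq_minl.
    have -> : q ^+ k = q ^+ (k - k') * q ^+ k' by rewrite -exprD subnK.
    by rewrite -mulrA -mulrBr; have := adjoin_uptoM (k - k') hlw; rewrite subnK.
have Ug : U g by apply: (Gg U).
rewrite -[u](subrK g); apply: (linear_predD (linear_gen_module _ _)) => //.
apply: IHk; first exact: linear_predB.
have -> : u - g = (u - q ^+ k * v) - (g - q ^+ k * v) by rewrite opprB addrA subrK.
exact: (linear_predB (linear_adjoin_upto k)).
Qed.

End Adjoin.

(** The fold is the K[qs]-module generated by l, built by adjoining one operator at a time to a
    space of finite dimension. *)
Lemma noeth_foldr_adjoin qs l :
  let N := foldr adjoin (span_on l id) qs in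
  [/\ linear_pred N, stable_under qs N & noeth_module qs N].
Proof.
elim: qs => [|q qs [linN sN noN]] /=.
  by split=> [|//|]; [apply: linear_span_on | apply: noeth_span].
by split; [apply: linear_adjoin | apply: stable_adjoin | apply: noeth_adjoin].
Qed.

End Noetherian.

(** * Ideals maximal among those disjoint from a multiplicative set *)

Section Zorn.
Variable B : comNzRingType.

Definition ideal_pred (J : B -> Prop) :=
  [/\ J 0, forall a b, J a -> J b -> J (a + b) & forall a b, J b -> J (a * b)].

Lemma ideal_predB J a b : ideal_pred J -> J a -> J b -> J (a - b).
Proof. by case=> _ JD JM Ja Jb; apply: JD => //; rewrite -mulN1r; apply: JM. Qed.

Lemma exists_ideal_disjoint (I S : B -> Prop) : ideal_pred I ->
  (forall a, I a -> ~ S a) ->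
  exists J, [/\ ideal_pred J, forall a, I a -> J a, forall a, J a -> ~ S a
    & forall x, ~ J x -> exists2 b, S b & exists2 j, J j & exists d, b = j + d * x].
Proof.
move=> idI dIS; pose UI (X : classical_sets.set B) b := X b \/ I b.
pose P (X : classical_sets.set B) := ideal_pred (UI X) /\ forall a, UI X a -> ~ S a.
have [F FP Ftot|X [[idX dX] maxX]] := @classical_sets.Zorn_bigcup B P.
  set Z := classical_sets.bigcup _ _.
  have get a : UI Z a -> I a \/ exists2 X, F X & X a.
    by case=> [[X FX Xa]|]; [right; exists X | left].
  have back X : F X -> forall a, UI X a -> UI Z a.
    by move=> FX a [Xa|]; [left; exists X | right].
  split; last first.
    by move=> a /get[/dIS//|[X FX Xa]]; apply: (FP X FX).2; left.
  split.
  - by right; case: idI.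
  - move=> a b /get ha /get hb.
    have [ [X FX [Xa Xb]] | [Ia Ib] ] : (exists2 X, F X & UI X a /\ UI X b) \/ (I a /\ I b).
    - case: ha hb => [Ia [Ib|[X FX Xb]]|[X FX Xa] [Ib|[Y FY Yb]]].
      + by right.
      + by left; exists X => //; split; [right | left].
      + by left; exists X => //; split; [left | right].
      + case: (Ftot X Y FX FY) => sXY; left.
          by exists Y => //; split; left => //; apply: sXY.
        by exists X => //; split; left => //; apply: sXY.
    + by apply: (back X FX); have [[_ + _] _] := FP X FX; apply.
    + by right; case: idI => _ + _; apply.
  - move=> a b /get[Ib|[X FX Xb]]; first by right; case: idI => _ _; apply.
    by apply: (back X FX); have [[_ _ +] _] := FP X FX; apply; left.
exists (UI X); split=> // [a Ia|x nJx]; first by right.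
case: (idX) => X0 XD XM.
pose Y b := exists2 j, UI X j & exists d, b = j + d * x.
have YX b : UI X b -> Y b by move=> Xb; exists b => //; exists 0; rewrite mul0r addr0.
have : ~ P Y.
  apply: maxX; split; first by move=> b Xb; apply: YX; left.
  move=> sYX; apply: nJx; left; apply: sYX.
  by exists 0 => //; exists 1; rewrite mul1r add0r.
move=> nPY; apply: contrapT => nex; apply: nPY.
have UIY b : UI Y b -> Y b by case=> [//|Ib]; apply: YX; right.
split.
  split; first by left; apply: YX.
    move=> a b /UIY[j Jj [d ->]] /UIY[j' Jj' [d' ->]]; left; exists (j + j'); first exact: XD.
    by exists (d + d'); rewrite mulrDl addrACA.
  move=> a b /UIY[j Jj [d ->]]; left; exists (a * j); first exact: XM.
  by exists (a * d); rewrite mulrDr mulrA.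
by move=> b /UIY Yb Sb; apply: nex; exists b.
Qed.

Lemma prime_of_maximal_disjoint (J S : B -> Prop) : ideal_pred J ->
  (forall a b, S a -> S b -> S (a * b)) -> (forall a, J a -> ~ S a) ->
  (forall x, ~ J x -> exists2 b, S b & exists2 j, J j & exists d, b = j + d * x) ->
  forall a b, J (a * b) -> J a \/ J b.
Proof.
move=> [_ JD JM] SM dJ exJ a b Jab.
case: (boolp.pselect (J a)) => [|/exJ[s Ss [j Jj [d e]]]]; first by left.
case: (boolp.pselect (J b)) => [|/exJ[s' Ss' [j' Jj' [d' e']]]]; first by right.
exfalso; apply: (dJ (s * s')); last exact: SM.
rewrite e e' mulrDl; apply: (JD); first by rewrite mulrC; apply: (JM).
rewrite mulrDr; apply: (JD); first exact: (JM).
by rewrite mulrACA; apply: (JM).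
Qed.

End Zorn.

(** * Points over an uncountable field *)

Lemma exists_subinterval_avoiding (R : realFieldType) (l : seq R) (a b : R) : a < b ->
  exists I : R * R, [/\ I.1 < I.2, a <= I.1, I.2 <= b
    & forall x, x \in l -> ~~ (I.1 <= x <= I.2)].
Proof.
move=> ab; elim: l => [|y l [I [I12 aI Ib Il]]]; first by exists (a, b).
pose m := (I.1 + I.2) / 2; have [Im mI] := midf_lt I12.
have [ym|my] := ltP y m.
  exists (m, I.2); split=> //=; first exact: le_trans (ltW Im).
  move=> x; rewrite inE => /predU1P[->|/Il]; first by rewrite leNgt ym.
  by apply: contra => /andP[mx ->]; rewrite (le_trans (ltW Im)).
pose m' := (I.1 + m) / 2; have [Im' m'm] := midf_lt Im.
exists (I.1, m'); split=> //=; first by rewrite (le_trans (ltW m'm)) // (le_trans (ltW mI)).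
move=> x; rewrite inE => /predU1P[->|/Il].
  by rewrite negb_and -!ltNge (lt_le_trans m'm) // orbT.
by apply: contra => /andP[-> xm]; rewrite (le_trans xm) // (le_trans (ltW m'm)) // ltW.
Qed.

(** Uncountability of R by nested intervals: if all fibres were finite, the interval chosen at step
    d could avoid the fibre of d, and a point common to all intervals would lie in no fibre. *)
Lemma exists_infinite_fibre (R : realType) (phi : R -> nat) :
  exists d, forall N, exists l : seq R,
    [/\ uniq l, size l = N & forall x, x \in l -> phi x = d].
Proof.
apply: contrapT => nex.
have /choice[ll llP] d : exists l : seq R, forall x, phi x = d -> x \in l.
  have [N nN] : exists N, ~ exists l : seq R,
      [/\ uniq l, size l = N & forall x, x \in l -> phi x = d].
    by apply: contrapT => h; apply: nex; exists d => N; apply: contrapT => h'; apply: h; exists N.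
  elim: N nN => [|N IHN] nN; first by case: nN; exists [::].
  case: (pselect (exists l : seq R, [/\ uniq l, size l = N & forall x, x \in l -> phi x = d])).
    move=> [l [ul sl ld]]; exists l => x xd; case: (boolP (x \in l)) => // xl.
    case: nN; exists (x :: l); rewrite /= xl ul sl; split=> // y.
    by rewrite inE => /predU1P[->|/ld].
  exact: IHN.
have /choice[nxt nxtP] (v : nat * (R * R)) : exists I : R * R, v.2.1 < v.2.2 ->
    [/\ I.1 < I.2, v.2.1 <= I.1, I.2 <= v.2.2 & forall x, x \in ll v.1 -> ~~ (I.1 <= x <= I.2)].
  case: (ltP v.2.1 v.2.2) => h; last by exists (0, 0).
  by have [I hI] := exists_subinterval_avoiding (ll v.1) h; exists I.
pose I := fix I k : R * R := if k is k'.+1 then nxt (k', I k') else (0, 1).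
have I12 k : (I k).1 < (I k).2.
  by elim: k => [|k /(nxtP (k, I k))[]] //=; apply: ltr01.
have step k := nxtP (k, I k) (I12 k).
have mono j k : (j <= k)%N -> (I j).1 <= (I k).1 /\ (I k).2 <= (I j).2.
  move=> /subnK <-; elim: (k - j)%N => [|i [h1 h2]] //=; rewrite ?addSn /=.
  by have [_ /= h3 h4 _] := step (i + j)%N; split; [apply: le_trans h3 | apply: le_trans h2].
pose S : classical_sets.set R := fun x => exists k, x = (I k).1.
have ubS k x : S x -> x <= (I k).2.
  move=> [j ->]; have [h _] := mono j (maxn j k) (leq_maxl _ _).
  have [_ h'] := mono k (maxn j k) (leq_maxr _ _).
  by apply: le_trans h' ; apply: le_trans h _; apply: ltW.
have S0 : classical_sets.nonempty S by exists (I 0%N).1; exists 0%N.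
have supS : classical_sets.has_sup S by split=> //; exists (I 0%N).2 => x; apply: ubS.
pose x := sup S.
have xI k : (I k).1 <= x <= (I k).2.
  apply/andP; split; first by apply: ub_le_sup; [case: supS | exists k].
  by apply: ge_sup => // y; apply: ubS.
have [_ _ _ /(_ x (llP _ _ erefl))] := step (phi x).
by rewrite /= (xI (phi x).+1).
Qed.

Section Points.
Variables (R : realType) (n : nat).
Local Notation C := (R[i]).
Local Notation B := {mpoly C[n]}.

Lemma prime_poly_root (J : B -> Prop) (x : B) (p : {poly C}) : ideal_pred J -> ~ J 1 ->
  (forall a b, J (a * b) -> J a \/ J b) -> p != 0 ->
  J (map_poly (@mpolyC n C) p).[x] -> exists z : C, J (x - z%:MP).
Proof.
move=> idJ nJ1 prJ p0; have [l ->] := closed_field_poly_normal p.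
have c0 : lead_coef p != 0 by rewrite lead_coef_eq0.
rewrite map_polyZ rmorph_prod /= hornerZ horner_prod => Jp.
have : J (\prod_(z <- l) (map_poly (@mpolyC n C) ('X - z%:P)).[x]).
  case: (idJ) => _ _ JM; have := JM ((lead_coef p)^-1)%:MP _ Jp.
  by rewrite mulrA -mpolyCM mulVf // mul1r.
elim: l {Jp} => [|z l IHl]; first by rewrite big_nil.
rewrite big_cons => /prJ[|//]; rewrite map_polyXsubC hornerXsubC => Jz.
by exists z.
Qed.

Lemma prime_ideal_pow (J : B -> Prop) (y : B) k : ~ J 1 ->
  (forall a b, J (a * b) -> J a \/ J b) -> J (y ^+ k) -> J y.
Proof. by move=> nJ1 prJ; elim: k => [//|k IHk]; rewrite exprS => /prJ[|/IHk]. Qed.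

(* If no x - a lies in J, the inverses of the x - a in B/J[1/y] are linearly
   dependent, C being uncountable; clearing denominators, x is a root of a
   polynomial modulo J. *)
Lemma prime_ideal_root (J : B -> Prop) (x y : B) : ideal_pred J -> ~ J 1 -> ~ J y ->
  (forall a b, J (a * b) -> J a \/ J b) ->
  (forall a : C, exists kg : nat * B, J ((x - a%:MP) * kg.2 - y ^+ kg.1)) -> False.
Proof.
move=> idJ nJ1 nJy prJ /choice[kg gP].
have [J0 JD JM] := idJ.
(* The fibre fixes both the degree of the inverse of x - a and the exponent of y, so that infinitely
   many inverses lie in one space of finite dimension and have a common denominator. Real a suffice
   for this. *)
have [d dP] := exists_infinite_fibre
  (fun a : R => pickle (msize (kg a%:C%C).2, (kg a%:C%C).1)).
have [l1 [_ sl1 ld1]] := dP 1%N.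
have [a1 a1l] : exists a1, a1 \in l1 by case: l1 sl1 {ld1} => // a ? _; exists a; apply: mem_head.
have {ld1 a1l sl1 l1} := ld1 a1 a1l.
set d0 := msize (kg a1%:C%C).2; set k0 := (kg a1%:C%C).1 => dE.
have [l [ul sl ld]] := dP (#|{: 'X_{1..n < d0}}|.+1).
pose v (a : R) := (kg a%:C%C).2.
have vP a : a \in l -> msize (v a) = d0 /\ (kg a%:C%C).1 = k0.
  by move=> /ld; rewrite -dE => /(pcan_inj pickleK)[].
have /existsNP[c] : ~ free_on l v.
  move=> fl; have := @steinitz _ _ _ _ l (enum {: 'X_{1..n < d0}}) v
    (fun m => 'X_[bmnm m] : B) ul fl.
  rewrite -cardE sl ltnn => /(_ _)/negP; apply; rewrite // => a al.
  exists (fun m => (v a)@_(bmnm m)).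
  by rewrite big_enum /= -(mpolywE (k := d0)) // (vP a al).1.
case/not_implyP => s0 /existsNP[a0] /not_implyP[a0l /eqP ca0].
pose Q (a : R) : {poly C} := \prod_(b <- l | b != a) ('X - (b%:C%C)%:P).
pose p : {poly C} := \sum_(a <- l) c a *: Q a.
have p0 : p != 0.
  apply/eqP => /(congr1 (fun p : {poly C} => p.[a0%:C%C])).
  rewrite horner0 /p horner_sum (bigD1_seq a0) //= big1 => [|a aa0]; last first.
    apply/eqP; rewrite hornerZ mulf_eq0 horner_prod prodf_seq_eq0; apply/orP; right.
    by apply/hasP; exists a0; rewrite // eq_sym aa0 hornerXsubC subrr eqxx.
  rewrite addr0 hornerZ => /eqP; rewrite mulf_eq0 (negbTE ca0) /= horner_prod.
  rewrite prodf_seq_eq0 => /hasP[b bl] /andP[bn]; rewrite hornerXsubC subr_eq0.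
  by move=> /eqP/complexI e; rewrite e eqxx in bn.
pose PX := \prod_(b <- l) (x - (b%:C%C)%:MP).
have QE a : a \in l -> J (PX * v a - y ^+ k0 * (map_poly (@mpolyC n C) (Q a)).[x]).
  move=> al; rewrite /PX (bigD1_seq a) //= mulrAC rmorph_prod horner_prod /=.
  under [X in _ - _ * X]eq_bigr => b _ do rewrite map_polyXsubC hornerXsubC.
  set P := \prod_(_ <- _ | _) _.
  have -> : (x - (a%:C%C)%:MP) * v a * P - y ^+ k0 * P =
      P * ((x - (a%:C%C)%:MP) * v a - y ^+ (kg a%:C%C).1).
    by rewrite (vP a al).2 mulrBr [P * _]mulrC [P * y ^+ _]mulrC.
  exact: (JM).
have Jp : J (y ^+ k0 * (map_poly (@mpolyC n C) p).[x]).
  have : J (- (\sum_(a <- l) (c a)%:MP *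
      (PX * v a - y ^+ k0 * (map_poly (@mpolyC n C) (Q a)).[x]))).
    rewrite -sumrN big_seq; apply: big_ind => // a al; rewrite -mulrN.
    by apply: (JM); rewrite -[- _]mulN1r; apply: (JM); apply: QE.
  have S0 : \sum_(a <- l) (c a)%:MP * (PX * v a) = 0.
    rewrite -[RHS](mulr0 PX) -[in RHS]s0 mulr_sumr.
    by apply: eq_bigr => a _; rewrite mul_mpolyC scalerAr.
  congr J; rewrite /p rmorph_sum horner_sum mulr_sumr -sumrN -[RHS]subr0 -[X in _ = _ - X]S0.
  rewrite -sumrB; apply: eq_bigr => a _.
  by rewrite mulrBr opprB /= map_polyZ hornerZ [y ^+ _ * (_ * _)]mulrCA.
have {}Jp : J (map_poly (@mpolyC n C) p).[x].
  by have [/(prime_ideal_pow nJ1 prJ)|] := prJ _ _ Jp.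
have [z Jz] := prime_poly_root idJ nJ1 prJ p0 Jp.
apply: nJy; apply: (prime_ideal_pow (k := (kg z).1)) => //.
have := JD _ _ (JM (kg z).2 _ Jz) (JM (-1) _ (gP z)).
by rewrite mulN1r mulrC opprB addrC subrK.
Qed.

End Points.

(** * Common zeros of ideals *)

Section PointsOfIdeals.
Variables (C : fieldType) (n : nat).
Local Notation B := {mpoly C[n]}.
Hypothesis prime_root : forall (J : B -> Prop) (x y : B), ideal_pred J -> ~ J 1 -> ~ J y ->
  (forall a b, J (a * b) -> J a \/ J b) ->
  (forall a : C, exists kg : nat * B, J ((x - a%:MP) * kg.2 - y ^+ kg.1)) -> False.

Lemma ideal_eval_point (J : B -> Prop) (p : 'I_n -> C) : ideal_pred J ->
  (forall i, J ('X_i - (p i)%:MP)) -> forall f, J (f - (f.@[p])%:MP).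
Proof.
move=> idJ Jp; have [J0 JD JM] := idJ.
have JX m : J ('X_[m] - ('X_[m].@[p])%:MP).
  rewrite mpolyXE_id rmorph_prod rmorph_prod /=.
  elim: (index_enum _) => [|i l IHl]; first by rewrite !big_nil subrr.
  rewrite !big_cons !rmorphXn /= mevalXU.
  have Ji : J ('X_i ^+ m i - (p i)%:MP ^+ m i).
    by rewrite subrXX mulrC; apply: (JM).
  set a := 'X_i ^+ _ in Ji *; set b := _%:MP ^+ _ in Ji *.
  set u := \prod_(_ <- _) _ in IHl *; set w := \prod_(_ <- _) _ in IHl *.
  have -> : a * u - b * w = u * (a - b) + b * (u - w) by ring.
  by apply: (JD); apply: (JM).
elim/mpolyind => [|c m f _ _ Jf]; first by rewrite meval0 mpolyC0 subrr.
rewrite mevalD mevalZ mpolyCD mpolyCM opprD addrACA; apply: (JD) => //.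
by rewrite -mul_mpolyC -mulrBr; apply: (JM).
Qed.

(** Lying over for the integral extension of L by B: an ideal J of B maximal among those disjoint
    from L minus M is prime and contains M. If no 'X_i - a were in J, all of them would be
    invertible modulo J, because elements of L outside M are invertible modulo M; [prime_root] with
    y = 1 excludes this. So J is the ideal of a point. *)
Lemma maximal_point (L M : B -> Prop) :
  (forall a b, L a -> L b -> L (a - b)) ->
  (forall a b, L a -> L b -> L (a * b)) ->
  (forall b, exists N, exists2 lam : nat -> B, (forall i, L (lam i)) &
     b ^+ N = \sum_(i < N) lam i * b ^+ i) ->
  (forall a, M a -> L a) -> M 0 -> (forall a b, M a -> M b -> M (a - b)) ->
  (forall a b, L a -> M b -> M (a * b)) -> L 1 -> ~ M 1 ->
  (forall s, L s -> ~ M s -> exists s', exists2 m, M m & L s' /\ s * s' = 1 + m) ->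
  exists p : 'I_n -> C, forall f, M f -> f.@[p] = 0.
Proof.
move=> LB LM int ML M0 MB MM L1 nM1 maxM.
pose S a := L a /\ ~ M a.
have S_mul a b : S a -> S b -> S (a * b).
  move=> [La nMa] [Lb nMb]; split; first exact: LM.
  move=> Mab; apply: nMb; have [a' [m Mm [La' e]]] := maxM a La nMa.
  have -> : b = a' * (a * b) - b * m.
    by rewrite mulrA [a' * a]mulrC e mulrDl mul1r [m * b]mulrC addrK.
  by apply: MB; apply: MM.
have id0 : ideal_pred (fun a : B => a = 0).
  by split=> // [a b -> ->|a b ->]; rewrite ?addr0 ?mulr0.
have [|J [idJ _ dJ exJ]] := exists_ideal_disjoint id0 (S := S).
  by move=> _ -> [_ []].
have [J0 JD JM] := idJ.
have nJ1 : ~ J 1 by move=> J1; apply: (dJ 1).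
have prJ := prime_of_maximal_disjoint idJ S_mul dJ exJ.
have MJ m : M m -> J m.
  move=> Mm; apply: contrapT => /exJ[s Ss [j Jj [d e]]].
  (* The integral equation of d, multiplied by m^N, becomes modulo J an equation for s, as s and d m
     are congruent. Its lower terms lie in M, since each has a factor m, so it would put s^N into M
     or an element of S into J. *)
  have [N [lam Llam eN]] := int d.
  have hM : M (\sum_(i < N) lam i * m ^+ (N - i) * s ^+ i).
    elim/big_ind: _ => // [a b Ma Mb|i _].
      by rewrite -[b]opprK; apply: (MB) => //; rewrite -sub0r; apply: (MB).
    have -> : (N - i = (N - i).-1.+1)%N by rewrite prednK // subn_gt0.
    have -> (k : nat) : lam i * m ^+ k.+1 * s ^+ i = lam i * m ^+ k * s ^+ i * m.
      by rewrite exprSr; ring.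
    apply: MM => //.
    have Ls k : L (s ^+ k) by elim: k => // k IHk; rewrite exprS; apply: LM => //; case: Ss.
    have Lm k : L (m ^+ k) by elim: k => // k IHk; rewrite exprS; apply: LM => //; apply: ML.
    by apply: (LM); [apply: (LM)|].
  have Jd : J (s ^+ N - \sum_(i < N) lam i * m ^+ (N - i) * s ^+ i).
    have Je k : J (s ^+ k - (d * m) ^+ k).
      by rewrite subrXX {1}e addrK mulrC; apply: (JM).
    have -> : s ^+ N - \sum_(i < N) lam i * m ^+ (N - i) * s ^+ i =
      (s ^+ N - (d * m) ^+ N) - \sum_(i < N) lam i * m ^+ (N - i) * (s ^+ i - (d * m) ^+ i).
      have -> : (d * m) ^+ N = \sum_(i < N) lam i * m ^+ (N - i) * (d * m) ^+ i.
        rewrite exprMn eN mulr_suml; apply: eq_bigr => i _.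
        have -> : m ^+ N = m ^+ (N - i) * m ^+ i by rewrite -exprD subnK // ltnW.
        by rewrite exprMn; ring.
      under [X in _ = _ - X]eq_bigr => i _ do rewrite mulrBr.
      by rewrite sumrB opprB addrA subrK.
    apply: ideal_predB => //; elim/big_ind: _ => // i _.
    by apply: (JM).
  have SN : S (s ^+ N).
    elim: N {eN hM Jd} => [|N IHN]; first by split.
    by rewrite exprS; apply: S_mul.
  case: (pselect (M (s ^+ N - \sum_(i < N) lam i * m ^+ (N - i) * s ^+ i))) => [Mu|nMu].
    case: SN => _; apply; rewrite -[s ^+ N](subrK (\sum_(i < N) lam i * m ^+ (N - i) * s ^+ i)).
    by rewrite -[X in _ + X]opprK; apply: (MB) => //; rewrite -sub0r; apply: (MB).
  by apply: (dJ _ Jd); split=> //; apply: LB; [case: SN | apply: ML].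
have Jx i : exists z, J ('X_i - z%:MP).
  apply: contrapT => nex; apply: (@prime_root J 'X_i 1) => // a.
  have /exJ[s [Ls nMs] [j Jj [d e]]] : ~ J ('X_i - a%:MP) by move=> Ja; apply: nex; exists a.
  have [s' [m Mm [Ls' es]]] := maxM s Ls nMs.
  exists (0%N, d * s'); have -> : ('X_i - a%:MP) * (d * s') - 1 = m - s' * j.
    have -> : m = s * s' - 1 by rewrite es addrC addKr.
    by rewrite e; ring.
  by apply: ideal_predB => //; [apply: MJ | apply: (JM)].
have /choice[p pP] := Jx; exists p => f Mf.
apply/eqP/contraT => fp0; exfalso; apply: nJ1.
have := JM ((f.@[p])^-1)%:MP _ (ideal_predB idJ (MJ f Mf) (ideal_eval_point idJ pP f)).
by rewrite subKr -mpolyCM mulVf.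
Qed.

(** J is maximal among the ideals that contain I and no power of x. Every 'X_i - a outside J becomes
    invertible modulo J once x is inverted, so [prime_root] with y = x yields some 'X_i - z in J for
    each i. *)
Lemma weak_nullstellensatz (I : B -> Prop) (x : B) : ideal_pred I ->
  (forall k, ~ I (x ^+ k)) ->
  exists p : 'I_n -> C, (forall f, I f -> f.@[p] = 0) /\ x.@[p] != 0.
Proof.
move=> idI nI; pose S b := exists k, b = x ^+ k.
have [|J [idJ IJ nJ exJ]] := exists_ideal_disjoint idI (S := S).
  by move=> a Ia [k e]; apply: (nI k); rewrite -e.
have [J0 JD JM] := idJ.
have nJx : ~ J x by move=> Jx; apply: (nJ x) => //; exists 1%N; rewrite expr1.
have nJ1 : ~ J 1 by move=> J1; apply: (nJ 1) => //; exists 0%N; rewrite expr0.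
have S_mul a b : S a -> S b -> S (a * b).
  by move=> [k ->] [k' ->]; exists (k + k')%N; rewrite exprD.
have prJ := prime_of_maximal_disjoint idJ S_mul nJ exJ.
have Jx i : exists z, J ('X_i - z%:MP).
  apply: contrapT => nex; apply: (@prime_root J 'X_i x) => // a.
  have /exJ[_ [k ->] [j Jj [d e]]] : ~ J ('X_i - a%:MP) by move=> Ja; apply: nex; exists a.
  exists (k, d) => /=; rewrite e opprD addrA addrAC [d * _]mulrC subrr sub0r -mulN1r.
  exact: (JM).
have /choice[p pP] := Jx.
have Jev f : J (f.@[p])%:MP -> f.@[p] = 0.
  move=> Jf; apply/eqP/contraT => fp0; exfalso; apply: nJ1.
  by have := JM ((f.@[p])^-1)%:MP _ Jf; rewrite -mpolyCM mulVf.
exists p; split=> [f If|].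
  by apply: Jev; have := ideal_predB idJ (IJ f If) (ideal_eval_point idJ pP f); rewrite subKr.
apply/eqP => xp0; apply: nJx.
by have := ideal_eval_point idJ pP x; rewrite xp0 mpolyC0 subr0.
Qed.

End PointsOfIdeals.

(** * Equal power sums *)

Section EqualPowerSums.
Variable (K : fieldType).
Hypothesis char0 : forall m, (m.+1%:R : K) != 0.

(** X^n p(1/X), which turns the product of the 1 - x X into the polynomial with the roots x. *)
Definition recip (n : nat) (p : {poly K}) : {poly K} := \poly_(i < n.+1) p`_(n - i).

Lemma recip_prod (l : seq K) :
  recip (size l) (\prod_(x <- l) (1 - x *: 'X)) = \prod_(x <- l) ('X - x%:P).
Proof.
elim: l => [|x l IHl] /=.
  rewrite !big_nil; apply/polyP => i; rewrite coef_poly coef1.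
  by case: i => [|i] //=; rewrite coef1.
rewrite !big_cons -IHl; set p := \prod_(_ <- _) _.
have sp : (size p <= (size l).+1)%N.
  rewrite /p {IHl p}; elim: l => [|y l IHl]; first by rewrite big_nil size_poly1.
  rewrite big_cons /=; apply: leq_trans (size_polyMleq _ _) _.
  have : (size (1 - y *: 'X : {poly K})%R <= 2)%N.
    apply: leq_trans (size_polyD _ _) _; rewrite geq_max size_poly1 size_polyN /=.
    by apply: leq_trans (size_scale_leq _ _) _; rewrite size_polyX.
  by move=> h; rewrite -subn1 leq_subLR add1n; apply: leq_trans (leq_add h IHl) _.
apply/polyP => i; rewrite mulrBl mulrBl mul1r coefB coefXM coefCM !coef_poly.
rewrite coefB -scalerAl coefZ coefXM.
have p0 : p`_(size l).+1 = 0 by apply: nth_default.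
case: i => [|i] /=; first by rewrite !subn0 /= p0.
rewrite !ltnS subSS; case: (leqP i (size l)) => il; last first.
  by rewrite ltnNge (ltnW il) /= mulr0 subr0.
by rewrite subn_eq0 leqNgt; case: (ltnP i (size l)) => il' //=; rewrite subnS.
Qed.

(** By Newton's identities the first n power sums determine the product of the 1 - a_j X, whose
    reciprocal polynomial has the a_j as its roots with multiplicity. *)
Lemma equal_power_sums_perm n (a b : 'I_n -> K) :
  (forall i, (0 < i <= n)%N -> \sum_j a j ^+ i = \sum_j b j ^+ i) ->
  exists s : 'S_n, forall j, a (s j) = b j.
Proof.
move=> ab.
have sz (c : 'I_n -> K) : size [seq c j | j <- enum 'I_n] = n.
  by rewrite size_map size_enum_ord.
pose p (c : 'I_n -> K) := \prod_(x <- [seq c j | j <- enum 'I_n]) (1 - x *: 'X) : {poly K}.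
have pE (c : 'I_n -> K) : p c = \prod_(j <- enum 'I_n) (1 - c j *: 'X) by rewrite /p big_map.
have coefab m : (m <= n)%N -> (p a)`_m = (p b)`_m.
  move=> mn; rewrite !pE.
  apply: (newton_unique char0 (newton_prod (A := K^o) (d := n) (enum 'I_n) a)
    (newton_prod (A := K^o) (d := n) (enum 'I_n) b)) => //.
    move=> i lin; rewrite !coef_poly lin !big_enum; exact: ab.
  by rewrite -!horner_coef0 !horner_prod; apply: eq_bigr => j _; rewrite !hornerE.
have : recip n (p a) = recip n (p b).
  by apply/polyP => i; rewrite !coef_poly; case: ifP => // _; apply: coefab; apply: leq_subr.
have recE (c : 'I_n -> K) :
    recip n (p c) = \prod_(x <- [seq c j | j <- enum 'I_n]) ('X - x%:P).
  by rewrite -recip_prod sz.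
rewrite !recE => /prod_XsubC_eq pe.
have /tuple_permP[s es] : perm_eq [tuple b j | j < n] [tuple a j | j < n].
  by rewrite perm_sym; apply: etrans pe; rewrite /= enumT.
exists s => j; have := congr1 (fun l => nth (b j) l j) es.
rewrite /= -[in LHS](tnth_nth _ [tuple b j | j < n] j) tnth_mktuple => ->.
by rewrite (nth_map j) ?size_enum_ord // nth_ord_enum tnth_mktuple.
Qed.

Variables (r s : nat) (q t : K).
Hypotheses (r_gt0 : (0 < r)%N) (s_gt0 : (0 < s)%N).
Hypotheses (hq : not_root_of_unity q) (ht : not_root_of_unity t).
Hypothesis hqt : forall m n, (1 <= m <= r)%N -> (1 <= n <= s)%N -> q ^+ m <> t ^+ n.

Lemma card_ord_lt : (#|[set i : 'I_(r + s) | (i < r)%N]| <= r)%N.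
Proof.
rewrite -[X in (_ <= X)%N]card_ord -(card_imset _ (@lshift_inj r s)).
apply: subset_leq_card; apply/subsetP => i; rewrite inE => ir.
by apply/imsetP; exists (Ordinal ir) => //; apply: val_inj.
Qed.

Lemma card_ord_ge : (#|[set i : 'I_(r + s) | ~~ (i < r)%N]| <= s)%N.
Proof.
rewrite -[X in (_ <= X)%N]card_ord -(card_imset _ (@rshift_inj r s)).
apply: subset_leq_card; apply/subsetP => i; rewrite inE -leqNgt => ir.
have lt : (i - r < s)%N by rewrite ltn_subLR.
by apply/imsetP; exists (Ordinal lt) => //; apply: val_inj; rewrite /= subnKC.
Qed.

(* A cycle of the matching between the two multisets, through a indices below r
   and b others, yields q ^ a = t ^ b. *)
Lemma deformed_power_sums_zero (x : 'I_(r + s) -> K) :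
  (forall i, (0 < i <= r + s)%N ->
     \sum_(j < r + s) ((if (j < r)%N then 1 else t) * x j) ^+ i =
     \sum_(j < r + s) ((if (j < r)%N then q else 1) * x j) ^+ i) ->
  forall j, x j = 0.
Proof.
pose la (j : 'I_(r + s)) := if (j < r)%N then 1 else t.
pose mu (j : 'I_(r + s)) := if (j < r)%N then q else 1.
move=> /(equal_power_sums_perm)[sg sgP] i0; apply/eqP/contraT => x0; exfalso.
have {}sgP j : la (sg j) * x (sg j) = mu j * x j by apply: sgP.
pose O := porbit sg i0.
have sgO j : (sg j \in O) = (j \in O).
  by rewrite -!eq_porbit_mem; have := porbit_perm sg 1 j; rewrite expg1 => ->.
have t0 : q = 0 -> t != 0.
  move=> q0; apply/eqP => t0; apply: (hqt (m := 1) (n := 1)) => //.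
  by rewrite q0 t0.
(* One of q and t is nonzero, so x stays nonzero along the cycle: forwards if q is nonzero,
   backwards if q = 0. *)
have xO j : j \in O -> x j != 0.
  case: (eqVneq q 0) => [q0|qn0]; last first.
    move=> /porbitP[k ->]; elim: k => [|k IHk]; first by rewrite expg0 perm1.
    rewrite expgSr permM; apply/eqP => e; have := sgP ((sg ^+ k)%g i0).
    rewrite e mulr0 => /esym/eqP; rewrite mulf_eq0 (negbTE IHk) orbF /mu.
    by case: ifP => _; rewrite ?(negbTE qn0) ?oner_eq0.
  rewrite /O porbit_sym => /porbitP[k e]; move: x0; rewrite e {e}.
  elim: k => [|k IHk]; first by rewrite expg0 perm1.
  rewrite expgSr permM => xk; apply: IHk.
  have : la (sg ((sg ^+ k)%g j)) * x (sg ((sg ^+ k)%g j)) != 0.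
    apply: mulf_neq0 => //; rewrite /la; case: ifP => [_|nl]; first exact: oner_neq0.
    exact: t0.
  by rewrite sgP mulf_eq0 negb_or => /andP[].
pose a := #|[set j in O | (j < r)%N]|; pose b := #|[set j in O | ~~ (j < r)%N]|.
have la_prod : \prod_(j in O) la j = t ^+ b.
  rewrite (bigID (fun j : 'I_(r + s) => (j < r)%N)) /= big1 ?mul1r => [|j /andP[_ jr]].
    rewrite (eq_bigr (fun=> t)) => [|j /andP[_ /negbTE jr]]; last by rewrite /la jr.
    by rewrite prodr_const; congr (_ ^+ _); apply: eq_card => j; rewrite !inE.
  by rewrite /la jr.
have mu_prod : \prod_(j in O) mu j = q ^+ a.
  rewrite (bigID (fun j : 'I_(r + s) => (j < r)%N)) /= mulrC big1 ?mul1r => [|j /andP[_ jr]].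
    rewrite (eq_bigr (fun=> q)) => [|j /andP[_ jr]]; last by rewrite /mu jr.
    by rewrite prodr_const; congr (_ ^+ _); apply: eq_card => j; rewrite !inE.
  by rewrite /mu (negbTE jr).
have eqt : q ^+ a = t ^+ b.
  rewrite -la_prod -mu_prod; apply: (mulIf (x := \prod_(j in O) x j)).
    by apply/prodf_neq0 => j /xO.
  rewrite -!big_split /= [RHS](reindex_inj (@perm_inj _ sg)) /=.
  by apply: eq_big => j; rewrite ?sgO // sgP.
have ar : (a <= r)%N.
  apply: leq_trans card_ord_lt; apply: subset_leq_card; apply/subsetP => j.
  by rewrite !inE => /andP[].
have bs : (b <= s)%N.
  apply: leq_trans card_ord_ge; apply: subset_leq_card; apply/subsetP => j.
  by rewrite !inE => /andP[].
have ab : (0 < a + b)%N.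
  have : (0 < #|O|)%N by rewrite (cardD1 i0) porbit_id.
  rewrite -(cardsID [set j : 'I_(r + s) | (j < r)%N]) => h; apply: leq_trans h _.
  apply: leq_add; apply: subset_leq_card; apply/subsetP => j; rewrite !inE.
    by [].
  by rewrite andbC.
case: (posnP a) => [a0|a0].
  have b0 : (0 < b)%N by rewrite a0 in ab.
  by have := ht b0; rewrite -eqt a0 expr0 eqxx.
case: (posnP b) => [b0|b0]; first by have := hq a0; rewrite eqt b0 expr0 eqxx.
by apply: (hqt (m := a) (n := b)); rewrite ?a0 ?b0.
Qed.

End EqualPowerSums.

(** * Finite generation *)

Lemma complex_char0 (R : realType) m : (m.+1%:R : R[i]) != 0.
Proof. by rewrite pnatr_eq0. Qed.

Lemma pihomogM (C : comNzRingType) (n d e : nat) (h Q : {mpoly C[n]}) : Q \is e.-homog ->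
  pihomog mdeg d (h * Q) = if (e <= d)%N then pihomog mdeg (d - e) h * Q else 0.
Proof.
move=> hQ; elim/mpolyind: h => [|a m p _ _ IHp].
  by rewrite mul0r !linear0 mul0r if_same.
rewrite mulrDl -scalerAl !linearD !linearZ /= IHp.
have hX : 'X_[m] * Q \is (mdeg m + e).-homog by apply: dhomogM => //; rewrite dhomogX.
case: (leqP e d) => ed; last first.
  rewrite addr0 (pihomog_ne0 _ hX) ?scaler0 // gtn_eqF //.
  by apply: leq_trans ed _; apply: leq_addl.
rewrite mulrDl -scalerAl; congr (_ *: _ + _).
rewrite pihomogX; case: eqP => [e1|ne]; first by rewrite e1 subnK // in hX; rewrite pihomog_dE.
by rewrite mul0r (pihomog_ne0 _ hX) //; apply/eqP => e1; apply: ne; rewrite -e1 addnK.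
Qed.

Section Subalgebra.
Variables (C : fieldType) (r s : nat) (a : nat -> C).
Local Notation n := (r + s)%N.
Local Notation B := {mpoly C[r + s]}.

Definition gpsum_gens (p : B) := exists2 i, (0 < i)%N & p = gpsum r s a i.
(** Lambda as a predicate on the polynomial ring, so that it can be compared there with ideals,
    homogeneous parts and other subalgebras. *)
Definition Lam (f : B) : Prop := f \in gen_subalg_pred gpsum_gens.

Lemma linear_Lam : linear_pred Lam.
Proof.
have [L1 LZ LM] := @gen_subalg_closed C B gpsum_gens.
split=> [|k u v]; last by apply: LZ.
by rewrite /Lam -(addNr 1) -scaleN1r; apply: LZ.
Qed.

Lemma Lam1 : Lam 1. Proof. by case: (@gen_subalg_closed C B gpsum_gens). Qed.

Lemma LamM u v : Lam u -> Lam v -> Lam (u * v).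
Proof. by have [_ _] := @gen_subalg_closed C B gpsum_gens; apply. Qed.

Lemma Lam_gpsum i : (0 < i)%N -> Lam (gpsum r s a i).
Proof. by move=> i0; apply/asboolP => D _; apply; exists i. Qed.

Lemma Lam_ind (P : B -> Prop) : linear_pred P -> P 1 ->
  (forall u v, P u -> P v -> P (u * v)) ->
  (forall i, (0 < i)%N -> P (gpsum r s a i)) -> forall f, Lam f -> P f.
Proof.
move=> linP P1 PM PQ f /asboolP/(_ (fun x => `[< P x >])) h; apply/asboolP/h.
  split=> [|k u v|u v]; rewrite ?inE; first exact/asboolP.
    by move=> /asboolP Pu /asboolP Pv; apply/asboolP; apply: linP.2.
  by move=> /asboolP Pu /asboolP Pv; apply/asboolP; apply: PM.
by move=> _ [i i0 ->]; apply/asboolP/PQ.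
Qed.

Lemma dhomog_gpsum i : gpsum r s a i \is i.-homog.
Proof.
have hX j : ('X_j : B) ^+ i \is i.-homog.
  by rewrite -[i in i.-homog]mul1n; apply: dhomogMn; rewrite dhomogX; apply/eqP; exact: mdeg1.
by rewrite /gpsum rpredD ?rpredZ // rpred_sum // => j _.
Qed.

Definition to_Lambda (f : B) (h : Lam f) : Lambda r s a := GenSubalg h.

Lemma Lam_val (x : Lambda r s a) : Lam (val x).
Proof. exact: valP. Qed.

Lemma Lambda_val_lin k (x y : Lambda r s a) :
  val (k *: x + y) = k *: (val x : B) + (val y : B).
Proof. by []. Qed.

Lemma Lambda_valM (x y : Lambda r s a) : val (x * y) = (val x : B) * (val y : B).
Proof. by []. Qed.

End Subalgebra.

Arguments Lam {C} r s a f.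
Arguments linear_Lam {C} r s a.
Arguments Lam1 {C} r s a.
Arguments dhomog_gpsum {C} r s a i.
Arguments to_Lambda {C r s a f} h.

Section Finiteness.
Variables (R : realType) (r s : nat) (c q t : R[i]).
Local Notation C := (R[i]).
Local Notation n := (r + s)%N.
Local Notation B := {mpoly C[r + s]}.
Hypotheses (r_gt0 : (0 < r)%N) (s_gt0 : (0 < s)%N) (c_neq0 : c != 0).
Hypotheses (hq : not_root_of_unity q) (ht : not_root_of_unity t).
Local Notation a := (a_seq c q t).
Local Notation Q := (gpsum r s a).

Definition rescale (p : 'I_n -> C) (j : 'I_n) := if (j < r)%N then c * p j else p j.

(** Clearing the denominator of a_i makes a zero of Q_i a coincidence of i-th power sums of two
    multisets of the same size r + s: (q c y, z) and (c y, t z). *)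
Lemma gpsum_eval (p : 'I_n -> C) i : (0 < i)%N ->
  (1 - t ^+ i) * (Q i).@[p] =
  \sum_(j < n) ((if (j < r)%N then q else 1) * rescale p j) ^+ i -
  \sum_(j < n) ((if (j < r)%N then 1 else t) * rescale p j) ^+ i.
Proof.
move=> i0; have t1 : 1 - t ^+ i != 0 by rewrite subr_eq0 eq_sym ht.
rewrite !big_split_ord /= /rescale.
have El (F : bool -> C -> C) : \sum_(j < r) F (lshift s j < r)%N (p (lshift s j)) =
    \sum_(j < r) F true (p (lshift s j)).
  by apply: eq_bigr => j _; rewrite /= ltn_ord.
have Er (F : bool -> C -> C) : \sum_(j < s) F (rshift r j < r)%N (p (rshift r j)) =
    \sum_(j < s) F false (p (rshift r j)).
  by apply: eq_bigr => j _; rewrite /= ltnNge leq_addr.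
rewrite (El (fun b x => ((if b then q else 1) * (if b then c * x else x)) ^+ i)).
rewrite (El (fun b x => ((if b then 1 else t) * (if b then c * x else x)) ^+ i)).
rewrite (Er (fun b x => ((if b then q else 1) * (if b then c * x else x)) ^+ i)).
rewrite (Er (fun b x => ((if b then 1 else t) * (if b then c * x else x)) ^+ i)).
rewrite opprD addrACA -!sumrB /gpsum mevalD mevalZ !rmorph_sum /= mulrDr; congr (_ + _).
  rewrite mulrA !mulr_sumr; apply: eq_bigr => j _.
  rewrite rmorphXn /= mevalXU /a_seq mul1r !exprMn.
  have -> : (1 - t ^+ i) * (c ^+ i * ((q ^+ i - 1) / (1 - t ^+ i))) = c ^+ i * (q ^+ i - 1).
    by rewrite mulrC -!mulrA mulVf ?mulr1.
  by ring.
rewrite mulr_sumr; apply: eq_bigr => j _.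
by rewrite rmorphXn /= mevalXU mul1r !exprMn; ring.
Qed.

Section QtGeneric.
Hypothesis hqt : forall m n, (1 <= m <= r)%N -> (1 <= n <= s)%N -> q ^+ m <> t ^+ n.

Definition gpsum_ideal (f : B) := exists h : 'I_n -> B, f = \sum_i h i * Q i.+1.

Lemma ideal_gpsum : ideal_pred gpsum_ideal.
Proof.
split=> [|_ _ [h ->] [h' ->]|b _ [h ->]].
- by exists (fun=> 0); rewrite big1 // => i _; rewrite mul0r.
- by exists (fun i => h i + h' i); rewrite -big_split; apply: eq_bigr => i _; rewrite mulrDl.
- by exists (fun i => b * h i); rewrite mulr_sumr; apply: eq_bigr => i _; rewrite mulrA.
Qed.

Lemma variable_nilpotent j : exists k, gpsum_ideal ('X_j ^+ k).
Proof.
apply: contrapT => nk.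
have [|p [Qp]] := weak_nullstellensatz (@prime_ideal_root R n) ideal_gpsum (x := 'X_j).
  by move=> k Ik; apply: nk; exists k.
rewrite mevalXU; apply/negP; rewrite negbK.
suff : rescale p j = 0.
  by rewrite /rescale; case: ifP => _ /eqP //; rewrite mulf_eq0 (negbTE c_neq0).
apply: (deformed_power_sums_zero (complex_char0 R) r_gt0 s_gt0 hq ht hqt) => i /andP[i0 lin].
apply/esym/eqP; rewrite -subr_eq0 -gpsum_eval //.
have lt : (i.-1 < n)%N by rewrite prednK.
rewrite (Qp (Q i)) ?mulr0 //; exists (fun k => (k == Ordinal lt)%:R).
rewrite (bigD1 (Ordinal lt)) //= eqxx mul1r prednK // big1 ?addr0 // => k /negbTE ->.
by rewrite mul0r.
Qed.

Let k0 := (\max_j (projT1 (cid (variable_nilpotent j))))%N.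

Lemma variable_nilpotent_uniform j : gpsum_ideal ('X_j ^+ k0).
Proof.
have [_ _ IM] := ideal_gpsum; have h := projT2 (cid (variable_nilpotent j)).
have le : (projT1 (cid (variable_nilpotent j)) <= k0)%N.
  exact: (leq_bigmax (F := fun j => projT1 (cid (variable_nilpotent j))) j).
by rewrite -(subnK le) exprD; apply: IM.
Qed.

Definition gpsum_seq : seq B := [seq Q i.+1 | i <- iota 0 n].
Definition low_monomials : seq B := [seq 'X_[bmnm m] | m <- enum {: 'X_{1..n < (n * k0).+1}}].

(** Graded Nakayama. A monomial of degree above n k0 contains some X_j^k0, which lies in the ideal
    of the Q_i; rewriting it leaves cofactors of smaller degree. The monomials of degree at most n
    k0 therefore generate. *)
Lemma finite_over_gpsums f : foldr (@adjoin C B) (span_on low_monomials id) gpsum_seq f.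
Proof.
have [linN sN _] := noeth_foldr_adjoin gpsum_seq low_monomials.
set N := foldr _ _ _ in linN sN *.
suff NX d m : mdeg m = d -> N 'X_[m].
  by rewrite [f]mpolyE; apply: linear_pred_sum => // m _ _; apply: linear_predZ => //; apply: NX.
elim/ltn_ind: d m => d IHd m md.
case: (ltnP d (n * k0).+1) => dk.
  have [z hz] : exists z : 'X_{1..n < (n * k0).+1}, bmnm z = m.
    by rewrite -md in dk; exists (BMultinom dk).
  have Xl : 'X_[m] \in low_monomials.
    by rewrite -hz; apply: (map_f (fun z : 'X_{1..n < (n * k0).+1} => 'X_[bmnm z])); rewrite mem_enum.
  have : span_on low_monomials id ('X_[m] : B).
    apply: (@mem_span_on _ _ _ low_monomials id _ _ Xl).
    rewrite map_inj_uniq ?enum_uniq // => z1 z2 /(congr1 (mcoeff z1)).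
    rewrite !mcoeffX eqxx; case: eqP => [/val_inj ->//|_] /eqP.
    by rewrite oner_eq0.
  rewrite /N; elim: gpsum_seq => [//|p ps IHp] /IHp Xf /=; exists 1%N.
  by exists (fun=> 'X_[m]) => //; rewrite big_ord1 mul1r.
have [j mj] : exists j, (k0 <= m j)%N.
  apply: contrapT => nex; move: dk; rewrite leqNgt ltnS -md mdegE => /negP; apply.
  rewrite -[X in (_ <= X * _)%N]card_ord -sum_nat_const; apply: leq_sum => j _.
  by rewrite leqNgt; apply/negP => h; apply: nex; exists j; apply: ltnW.
have [h eh] := variable_nilpotent_uniform j.
have -> : 'X_[m] = 'X_[m - U_(j) *+ k0] * 'X_j ^+ k0 :> B.
  rewrite mpolyXn -mpolyXD submK //; apply/mnm_lepP => i; rewrite mulmnE mnm1E.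
  by case: eqP => [<-|_]; rewrite ?mul1n ?mul0n.
set m' := (m - _)%MM.
have hd : ('X_[m'] * 'X_j ^+ k0 : B) \is d.-homog.
  rewrite mpolyXn -mpolyXD dhomogX; apply/eqP; rewrite -md; congr mdeg.
  rewrite submK //; apply/mnm_lepP => i; rewrite mulmnE mnm1E.
  by case: eqP => [<-|_]; rewrite ?mul1n ?mul0n.
rewrite -(pihomog_dE hd) eh mulr_sumr linear_sum /=.
apply: linear_pred_sum => // i _ _; rewrite mulrA (pihomogM _ _ (dhomog_gpsum r s a i.+1)).
case: ifP => id; last exact: linear_pred0 linN.
rewrite mulrC; apply: sN.
  by apply: (map_f (fun i => Q i.+1)); rewrite mem_iota /=.
set g := pihomog _ _ _; have hg : g \is (d - i.+1).-homog by apply: pihomogP.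
rewrite [g]mpolyE; apply: linear_pred_sum => // m1 /(dhomogP _ _ _ hg) hm1 _.
apply: linear_predZ => //; apply: (IHd (d - i.+1)%N) => //.
by rewrite -subn_gt0 subKn.
Qed.

Lemma gpsum_seq_Lam p : p \in gpsum_seq -> Lam r s a p.
Proof. by move=> /mapP[i _ ->]; apply: Lam_gpsum. Qed.

Lemma noeth_gpsums : noeth_module gpsum_seq (fun=> True).
Proof.
have [_ _ noN] := noeth_foldr_adjoin gpsum_seq low_monomials.
by move=> U linU sU _; apply: noN => // u _; apply: finite_over_gpsums.
Qed.

(** The modules [UK K], spanned over Lambda by the powers of b below K, increase to a submodule of
    the Noetherian module B. Its generators lie in one [UK K], which therefore contains b^K. *)
Lemma Lam_integral (b : B) : exists N, exists2 lam : nat -> B,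
  (forall i, Lam r s a (lam i)) & b ^+ N = \sum_(i < N) lam i * b ^+ i.
Proof.
pose UK K (u : B) := exists2 lam : nat -> B, (forall i, Lam r s a (lam i)) &
  u = \sum_(i < K) lam i * b ^+ i.
have linUK K : linear_pred (UK K).
  split=> [|k _ _ [f Lf ->] [g Lg ->]].
    exists (fun=> 0) => [_|]; first exact: linear_pred0 (linear_Lam r s a).
    by rewrite big1 // => i _; rewrite mul0r.
  exists (fun i => k *: f i + g i) => [i|]; first exact: (linear_pred2 (linear_Lam r s a)).
  by rewrite scaler_sumr -big_split; apply: eq_bigr => i _; rewrite mulrDl scalerAl.
have sUK K : stable_under gpsum_seq (UK K).
  move=> p _ /gpsum_seq_Lam Lp [f Lf ->]; exists (fun i => p * f i) => [i|]; first exact: LamM.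
  by rewrite mulr_sumr; apply: eq_bigr => i _; rewrite mulrA.
have UKS K K' u : (K <= K')%N -> UK K u -> UK K' u.
  move=> KK [f Lf ->]; exists (fun i => if (i < K)%N then f i else 0) => [i|].
    by case: ifP => _ //; apply: linear_pred0 (linear_Lam r s a).
  rewrite (big_ord_widen K' (fun i => f i * b ^+ i)) // big_mkcond /=.
  by apply: eq_bigr => i _; case: ifP; rewrite ?mul0r.
pose U u := exists K, UK K u.
have [||//|l [lU gl]] := noeth_gpsums (U := U).
- split=> [|k u v [K uK] [K' vK']]; first by exists 0%N; apply: linear_pred0 (linUK 0%N).
  exists (maxn K K'); apply: (linear_pred2 (linUK _)).
    by apply: UKS uK; apply: leq_maxl.
  by apply: UKS vK'; apply: leq_maxr.
- by move=> p u pl [K uK]; exists K; apply: sUK.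
have [K lK] : exists K, forall v, v \in l -> UK K v.
  elim: l lU {gl} => [|v l IHl] lU; first by exists 0%N.
  have [K Kl] := IHl (fun w wl => lU w (mem_behead (s := v :: l) wl)).
  have [K' vK'] := lU v (mem_head _ _).
  exists (maxn K K') => w; rewrite inE => /predU1P[->|/Kl].
    by apply: UKS vK'; apply: leq_maxr.
  by apply: UKS; apply: leq_maxl.
have : UK K (b ^+ K).
  apply: (gl (b ^+ K)) => //; exists K.+1; exists (fun i => (i == K)%:R) => [i|].
    by case: eqP => _; [exact: Lam1 | exact: linear_pred0 (linear_Lam r s a)].
  rewrite big_ord_recr /= eqxx mul1r big1 ?add0r // => i _.
  by rewrite ltn_eqF ?mul0r.
by case=> lam Llam e; exists K, lam.
Qed.

(** An ideal of Lambda is in particular a submodule over C[Q_1, ..., Q_(r+s)] of the polynomial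
    ring, so it has finitely many generators already over that algebra. *)
Lemma Lambda_noetherian : noetherian (Lambda r s a).
Proof.
move=> I; pose U (u : B) := exists2 x : Lambda r s a, x \in I & val x = u.
have [||//|l [lU gl]] := noeth_gpsums (U := U).
- split=> [|k _ _ [x Ix <-] [y Iy <-]]; first by exists 0; rewrite ?rpred0 ?raddf0.
  exists (k *: x + y); last by rewrite Lambda_val_lin.
  by rewrite rpredD // -mulr_algl idealMr.
- move=> p _ /gpsum_seq_Lam Lp [x Ix <-]; exists (to_Lambda Lp * x); last by rewrite Lambda_valM.
  exact: idealMr.
have /choice[x xP] (u : B) : exists x : Lambda r s a, U u -> x \in I /\ val x = u.
  case: (pselect (U u)) => [[x Ix xu]|nU]; first by exists x.
  by exists 0.
exists [seq x u | u <- l] => y; split=> [Iy|[f ->]]; last first.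
  rewrite size_map; apply: rpred_sum => i _; apply: idealMr.
  by rewrite (nth_map 0) //; apply: (xP _ _).1; apply: lU; apply: mem_nth.
have : gen_module gpsum_seq l (val y) by apply: gl; exists y.
move=> /(_ (fun v => exists2 z : Lambda r s a, in_ideal [seq x u | u <- l] z & val z = v)).
case.
- split=> [|k _ _ [_ [f ->] <-] [_ [g ->] <-]].
    exists 0; last by rewrite raddf0.
    by exists (fun=> 0); rewrite big1 // => i _; rewrite mul0r.
  exists (k *: (\sum_(i < size [seq x u | u <- l]) f i * [seq x u | u <- l]`_i) +
          \sum_(i < size [seq x u | u <- l]) g i * [seq x u | u <- l]`_i).
    exists (fun i => k *: f i + g i); rewrite scaler_sumr -big_split.
    by apply: eq_bigr => i _; rewrite mulrDl scalerAl.
  by rewrite Lambda_val_lin.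
- move=> p _ /gpsum_seq_Lam Lp [_ [f ->] <-].
  exists (to_Lambda Lp * \sum_(i < size [seq x u | u <- l]) f i * [seq x u | u <- l]`_i).
    by exists (fun i => to_Lambda Lp * f i); rewrite mulr_sumr; apply: eq_bigr => i _; rewrite mulrA.
  by rewrite Lambda_valM.
- move=> v vl; exists (x v); last by apply: (xP _ _).2; apply: lU.
  exists (fun i => (i == index v l)%:R); rewrite size_map.
  have lt : (index v l < size l)%N by rewrite index_mem.
  rewrite (bigD1 (Ordinal lt)) //= eqxx mul1r (nth_map 0) // nth_index // big1 ?addr0 //.
  by move=> i /negbTE ni; rewrite -val_eqE /= in ni; rewrite ni mul0r.
by move=> z [f ->] /val_inj <-; exists f.
Qed.

Lemma Lambda_finitely_generated : finitely_generated (Lambda r s a).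
Proof.
have [||//|l [lU gl]] := noeth_gpsums (U := Lam r s a).
- exact: linear_Lam.
- by move=> p u /gpsum_seq_Lam Lp Lu; apply: LamM.
have /choice[x xP] (u : B) : exists x : Lambda r s a, Lam r s a u -> val x = u.
  case: (pselect (Lam r s a u)) => [Lu|nL]; last by exists 0.
  by exists (to_Lambda Lu).
pose L := [seq x u | u <- gpsum_seq ++ l ++ [:: 1]].
exists L => y.
have [G1 GZ GM] := gen_subalg_closed (fun z => z \in L).
have inG z : z \in L -> z \in gen_subalg_pred (fun z => z \in L).
  by move=> zL; apply/asboolP => D _; apply.
have G0 : (0 : Lambda r s a) \in gen_subalg_pred (fun z => z \in L).
  by rewrite -(addNr 1) -scaleN1r; apply: GZ.
have [] := gl (val y) (Lam_val y) (fun v => exists2 z : Lambda r s a,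
   z \in gen_subalg_pred (fun z => z \in L) & val z = v).
- split=> [|k _ _ [z Gz <-] [z' Gz' <-]]; first by exists 0; rewrite ?raddf0.
  by exists (k *: z + z'); [apply: GZ | rewrite Lambda_val_lin].
- move=> p _ pq [z Gz <-]; exists (x p * z).
    by apply: GM => //; apply: inG; apply: map_f; rewrite mem_cat pq.
  by rewrite Lambda_valM (xP _ (gpsum_seq_Lam pq)).
- move=> v vl; exists (x v); last by apply: xP; apply: lU.
  by apply: inG; apply: map_f; rewrite !mem_cat vl orbT.
by move=> z Gz /val_inj <-.
Qed.



End QtGeneric.
End Finiteness.

(** * Infinite generation, and a bound on algebraic independence *)

Section NotFinitelyGenerated.
Variables (C : fieldType) (r s : nat) (c q t : C).
Local Notation n := (r + s)%N.
Local Notation B := {mpoly C[r + s]}.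
Hypotheses (char0 : forall m, (m.+1%:R : C) != 0) (c_neq0 : c != 0).
Hypotheses (hq : not_root_of_unity q) (ht : not_root_of_unity t).
Local Notation Q := (gpsum r s (a_seq c q t)).
Variables (m k : nat).
Hypotheses (mr : (1 <= m <= r)%N) (ks : (1 <= k <= s)%N) (qt : q ^+ m = t ^+ k).

(* All the Q_i vanish on the line spanned by this point. *)
Definition zero_point (i : 'I_n) : C :=
  match split i with
  | inl j => if (j < m)%N then q ^+ j / c else 0
  | inr j => if (j < k)%N then t ^+ j else 0
  end.

Definition line_eval (f : B) : {poly C} := mmap polyC (fun i => zero_point i *: 'X) f.

HB.instance Definition _ := GRing.RMorphism.copy line_eval
  (mmap (@polyC C) (fun i : 'I_n => zero_point i *: 'X)).

Lemma sum_ord_lt (N M : nat) (F : nat -> C) : (M <= N)%N ->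
  \sum_(j < N) (if (j < M)%N then F j else 0) = \sum_(j < M) F j.
Proof. by move=> MN; rewrite -big_mkcond (big_ord_widen N F MN). Qed.

Lemma line_eval_gpsum i : (0 < i)%N -> line_eval (Q i) = 0.
Proof.
move=> i0; have t1 : 1 - t ^+ i != 0 by rewrite subr_eq0 eq_sym ht.
have [/andP[m0 mr'] /andP[k0 ks']] := (mr, ks).
have EX j : line_eval ('X_j ^+ i) = (zero_point j ^+ i)%:P * 'X^i.
  by rewrite rmorphXn /= /line_eval mmapX mmap1U exprZn mul_polyC.
rewrite /gpsum rmorphD /= -mul_mpolyC rmorphM /= {1}/line_eval mmapC !rmorph_sum /=.
rewrite !(eq_bigr _ (fun j _ => EX _)) -!mulr_suml mulrA -mulrDl -!rmorph_sum -polyCM -polyCD.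
have -> : \sum_(j < r) zero_point (lshift s j) ^+ i = \sum_(j < m) (q ^+ i) ^+ j / c ^+ i.
  rewrite -(sum_ord_lt (fun j => (q ^+ i) ^+ j / c ^+ i) mr'); apply: eq_bigr => j _.
  rewrite /zero_point (unsplitK (inl j)); case: ifP => _; last by rewrite expr0n gtn_eqF.
  by rewrite exprMn exprVn -!exprM mulnC.
have -> : \sum_(j < s) zero_point (rshift r j) ^+ i = \sum_(j < k) (t ^+ i) ^+ j.
  rewrite -(sum_ord_lt (fun j => (t ^+ i) ^+ j) ks'); apply: eq_bigr => j _.
  rewrite /zero_point (unsplitK (inr j)); case: ifP => _; last by rewrite expr0n gtn_eqF.
  by rewrite -!exprM mulnC.
rewrite -mulr_suml /a_seq; set S1 := \sum_(j < m) _; set S2 := \sum_(j < k) _.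
have e1 : (q ^+ i - 1) * S1 = q ^+ (i * m) - 1 by rewrite -subrX1 exprM.
have e2 : (1 - t ^+ i) * S2 = 1 - q ^+ (i * m).
  by rewrite mulnC exprM qt -exprM mulnC exprM -opprB mulNr -subrX1 opprB.
have -> : c ^+ i * ((q ^+ i - 1) / (1 - t ^+ i)) * (S1 / c ^+ i) + S2 =
    ((q ^+ i - 1) * S1 + (1 - t ^+ i) * S2) / (1 - t ^+ i).
  by field; rewrite t1 expf_neq0.
by rewrite e1 e2 addrA subrK subrr mul0r polyC0 mul0r.
Qed.

Lemma r_pos : (0 < r)%N. Proof. by case/andP: mr => h1 h2; apply: leq_trans h2. Qed.
Let y0 : 'I_n := lshift s (Ordinal r_pos).

Lemma mderiv_exp (j l : 'I_n) i :
  ('X_j ^+ i.+1 : B)^`M(l) = ((j == l)%:R * i.+1%:R) *: 'X_j ^+ i.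
Proof.
rewrite mpolyXn mderivX mulmnE mnm1E; case: eqP => [->|_] /=.
  by rewrite mul1n mul1r mpolyXn mulmS addmC addmK.
by rewrite mul0n mul0r !scale0r.
Qed.

Lemma size_line_eval_deriv i : size (line_eval (Q i.+1)^`M(y0)) = i.+1.
Proof.
have t1 : 1 - t ^+ i.+1 != 0 by rewrite subr_eq0 eq_sym ht.
have E1 : (\sum_(j < r) ('X_(lshift s j) : B) ^+ i.+1)^`M(y0) = i.+1%:R *: 'X_y0 ^+ i.
  rewrite linear_sum (eq_bigr _ (fun j _ => mderiv_exp _ _ _)) (bigD1 (Ordinal r_pos)) //=.
  rewrite mul1r big1 ?addr0 // => j /negbTE nj.
  by rewrite /y0 (inj_eq (@lshift_inj _ _)) nj mul0r scale0r.
have E2 : (\sum_(j < s) ('X_(rshift r j) : B) ^+ i.+1)^`M(y0) = 0.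
  rewrite linear_sum (eq_bigr _ (fun j _ => mderiv_exp _ _ _)) big1 // => j _.
  by rewrite /y0 eq_rlshift mul0r scale0r.
rewrite /gpsum mderivD mderivZ E1 E2 addr0 scalerA -mul_mpolyC rmorphM rmorphXn /=.
rewrite {1}/line_eval mmapC {1}/line_eval mmapX mmap1U exprZn mul_polyC scalerA.
rewrite size_scale ?size_polyXn // /zero_point (unsplitK (inl _)) /=.
have [/andP[m0 mr'] _] := (mr, ks); rewrite m0 expr0 mul1r.
rewrite !mulf_neq0 ?expf_neq0 ?invr_eq0 ?char0 // subr_eq0.
exact: hq.
Qed.

(** Elements of Lambda are constant on the line. By the Leibniz rule the derivative of a product is
    there a combination of the two derivatives with constant coefficients, so a degree bound for the
    generators holds on all of the subalgebra. *)
Lemma not_finitely_generated : ~ finitely_generated (Lambda r s (a_seq c q t)).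
Proof.
case=> l gl.
have cst (x : Lambda r s (a_seq c q t)) : exists a, line_eval (val x) = a%:P.
  apply: (Lam_ind (P := fun f => exists a, line_eval f = a%:P) _ _ _ _ (Lam_val x)).
  - split=> [|b u v [a1 e1] [a2 e2]]; first by exists 0; rewrite rmorph0.
    exists (b * a1 + a2); rewrite -mul_mpolyC rmorphD rmorphM /= e1 e2.
    by rewrite {1}/line_eval mmapC polyCD polyCM.
  - by exists 1; rewrite rmorph1.
  - by move=> u v [a1 e1] [a2 e2]; exists (a1 * a2); rewrite rmorphM /= e1 e2 polyCM.
  - by move=> i i0; exists 0; rewrite line_eval_gpsum.
pose N := \max_(x <- l) size (line_eval (val x)^`M(y0)).
pose D : {pred Lambda r s (a_seq c q t)} :=
  fun x => (size (line_eval (val x)^`M(y0)) <= N)%N.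
have scal (b : C) (p : {poly C}) : (size p <= N)%N -> (size (b%:P * p)%R <= N)%N.
  by rewrite mul_polyC; apply: leq_trans; apply: size_scale_leq.
have inD x : (x \in D) = (size (line_eval (val x)^`M(y0)) <= N)%N by [].
have cD : subalg_closed D.
  split=> [|a u v|u v]; rewrite !inD.
  - by rewrite -[val 1]/(1 : B) -mpolyC1 mderivC rmorph0 size_poly0.
  - move=> hu hv; rewrite Lambda_val_lin mderivD mderivZ rmorphD -mul_mpolyC rmorphM /=.
    rewrite {1}/line_eval mmapC; apply: leq_trans (size_polyD _ _) _.
    by rewrite geq_max hv scal.
  - move=> hu hv; rewrite Lambda_valM mderivM rmorphD !rmorphM /=.
    have [[a ->] [b ->]] := (cst u, cst v).
    by apply: leq_trans (size_polyD _ _) _; rewrite geq_max [_ * b%:P]mulrC !scal.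
have LQ : Lam r s (a_seq c q t) (Q N.+1) by apply: Lam_gpsum.
have := gl (to_Lambda LQ) => /asboolP/(_ D cD).
have lD y : y \in l -> y \in D.
  by move=> yl; apply: (@leq_bigmax_seq _ l xpredT (fun x => size (line_eval (val x)^`M(y0)))).
by move=> /(_ lD); rewrite inD size_line_eval_deriv ltnn.
Qed.

End NotFinitelyGenerated.

Lemma msizeM_leq (K : fieldType) n (p q : {mpoly K[n]}) a b :
  (msize p <= a.+1)%N -> (msize q <= b.+1)%N -> (msize (p * q) <= (a + b).+1)%N.
Proof.
move=> pa qb; have [->|p0] := eqVneq p 0; first by rewrite mul0r msize0.
have [->|q0] := eqVneq q 0; first by rewrite mulr0 msize0.
by rewrite msizeM // -subn1 leq_subLR add1n -addSn -addnS; apply: leq_add.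
Qed.

Lemma msizeX_leq (K : fieldType) n (p : {mpoly K[n]}) a k :
  (msize p <= a.+1)%N -> (msize (p ^+ k) <= (k * a).+1)%N.
Proof.
move=> pa; elim: k => [|k IHk]; first by rewrite expr0 msize1.
by rewrite exprS mulSn; apply: msizeM_leq.
Qed.

Lemma card_bmultinom n b : (#|{: 'X_{1..n < b}}| <= b ^ n)%N.
Proof.
case: b => [|b].
  by rewrite [#|_|](_ : _ = 0%N) //; apply: eq_card0 => m; have := bmdeg m.
rewrite -[X in (_ <= X ^ _)%N](card_ord b.+1) -[X in (_ <= _ ^ X)%N](card_ord n) -card_ffun.
pose F (m : 'X_{1..n < b.+1}) : {ffun 'I_n -> 'I_b.+1} := [ffun i => inord (m i)].
have mi (m : 'X_{1..n < b.+1}) i : (m i < b.+1)%N.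
  by apply: leq_ltn_trans (bmdeg m); rewrite mdegE (bigD1 i) //= leq_addr.
apply: (@leq_card _ _ F) => m1 m2 /ffunP e; apply/val_inj/mnmP => i.
by have := e i; rewrite !ffunE => /(congr1 val); rewrite /= !inordK.
Qed.

(** Counting dimensions: the (N + 1)^e monomials in the x_i with exponents at most N are independent
    and have degree at most N e d in n variables, so (N + 1)^e is at most ((N + 1) D)^n. For e > n
    this fails with N = D^n. *)
Lemma algebraic_independence_bound (K : fieldType) (n e : nat) (x : 'I_e -> {mpoly K[n]}) :
  (forall (l : seq 'X_{1..e}), uniq l -> free_on l (mmap1 x)) -> (e <= n)%N.
Proof.
move=> fx; rewrite leqNgt; apply/negP => ne.
pose d := \max_i msize (x i).
have xd i : (msize (x i) <= d.+1)%N by apply: leqW; apply: (leq_bigmax i).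
pose D := (e * d).+1; pose N := (D ^ n)%N.
pose M (f : {ffun 'I_e -> 'I_N.+1}) : 'X_{1..e} := [multinom (f i : nat) | i < e].
have Minj : injective M.
  move=> f g /mnmP fg; apply/ffunP => i; apply: val_inj.
  by have := fg i; rewrite !mnmE.
pose l := [seq M f | f <- enum {: {ffun 'I_e -> 'I_N.+1}}].
have ul : uniq l by rewrite map_inj_uniq ?enum_uniq.
pose b := (N * (e * d)).+1.
have sz f : (msize (mmap1 x (M f)) <= b)%N.
  have : (msize (mmap1 x (M f)) <= (\sum_(i < e) M f i * d).+1)%N.
    rewrite /mmap1; elim: (index_enum _) => [|i js IHjs]; first by rewrite !big_nil msize1.
    by rewrite !big_cons; apply: msizeM_leq => //; apply: msizeX_leq.
  move=> h; apply: leq_trans h _; rewrite ltnS.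
  apply: (@leq_trans (\sum_(i < e) N * d)%N).
    by apply: leq_sum => i _; rewrite leq_mul2r mnmE -ltnS ltn_ord orbT.
  by rewrite sum_nat_const card_ord mulnCA.
have := steinitz (l' := enum {: 'X_{1..n < b}}) (u := fun m => 'X_[bmnm m] : {mpoly K[n]}) ul (fx l ul).
rewrite size_map -!cardE card_ffun !card_ord.
have sp j : j \in l -> span_on (enum {: 'X_{1..n < b}}) (fun m => 'X_[bmnm m] : {mpoly K[n]}) (mmap1 x j).
  move=> /mapP[f _ ->]; exists (fun m => (mmap1 x (M f))@_(bmnm m)).
  by rewrite big_enum /= -(mpolywE (k := b)).
move=> /(_ sp) h.
have bN : (b <= N.+1 * D)%N by rewrite /b /D; nia.
have h2 : (N.+1 ^ n.+1 <= N.+1 ^ n * N)%N.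
  apply: (@leq_trans (N.+1 ^ e)); first exact: leq_pexp2l.
  apply: (leq_trans h); apply: (leq_trans (card_bmultinom n b)).
  by rewrite -expnMn; case: (n) => [|k]; rewrite ?expn0 // leq_exp2r.
by move: h2; rewrite expnSr leq_pmul2l ?expn_gt0 // ltnn.
Qed.

(** * Ideals and regular sequences *)

Section IdealStructures.
Variable A : comNzRingType.

Lemma exists_idealr (P : A -> Prop) : ideal_pred P -> ~ P 1 ->
  exists I : idealr A, forall x, x \in I <-> P x.
Proof.
move=> [P0 PD PM] nP1; pose S : A -> bool := fun x => `[< P x >].
have cS : idealr_closed S.
  split; first exact/asboolP.
    by apply/asboolP.
  move=> a u v /asboolP Pu /asboolP Pv; apply/asboolP.
  by apply: PD => //; apply: PM.
pose I : idealr A := HB.pack S (isIdealr.Build A S cS).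
by exists I => x; split=> /asboolP.
Qed.

Lemma exists_prime_idealr (P : A -> Prop) : ideal_pred P -> ~ P 1 ->
  (forall a b, P (a * b) -> P a \/ P b) ->
  exists I : prime_idealr A, forall x, x \in I <-> P x.
Proof.
move=> [P0 PD PM] nP1 prP; pose S : A -> bool := fun x => `[< P x >].
have cS : idealr_closed S.
  split; first exact/asboolP.
    by apply/asboolP.
  move=> a u v /asboolP Pu /asboolP Pv; apply/asboolP.
  by apply: PD => //; apply: PM.
have pS : prime_idealr_closed S.
  by move=> u v /asboolP/prP[] h; apply/orP; [left|right]; apply/asboolP.
pose I : prime_idealr A := HB.pack S (isIdealr.Build A S cS) (isPrimeIdealrClosed.Build A S pS).
by exists I => x; split=> /asboolP.
Qed.

Lemma in_ideal_pred (l : seq A) : ideal_pred (in_ideal l).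
Proof.
split=> [|_ _ [f ->] [g ->]|b _ [f ->]].
- by exists (fun=> 0); rewrite big1 // => i _; rewrite mul0r.
- by exists (fun i => f i + g i); rewrite -big_split; apply: eq_bigr => i _; rewrite mulrDl.
- by exists (fun i => b * f i); rewrite mulr_sumr; apply: eq_bigr => i _; rewrite mulrA.
Qed.

Lemma mem_in_ideal (l : seq A) i : (i < size l)%N -> in_ideal l l`_i.
Proof.
move=> il; exists (fun j => (j == i)%:R).
rewrite (bigD1 (Ordinal il)) //= eqxx mul1r big1 ?addr0 // => j.
by rewrite -val_eqE /= => /negbTE ->; rewrite mul0r.
Qed.

Lemma in_ideal_sub (l : seq A) (J : A -> Prop) x : ideal_pred J ->
  (forall y, y \in l -> J y) -> in_ideal l x -> J x.
Proof.
move=> [J0 JD JM] lJ [f ->]; apply: big_ind => // i _; apply: JM.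
by apply: lJ; apply: mem_nth.
Qed.

End IdealStructures.

(** * Shifting the parameters of a free module by constants *)

Section ShiftedRegular.
Variables (K : fieldType) (A : comAlgType K) (n : nat) (theta : 'I_n -> A).
Variables (J : eqType) (g : J -> A).
Local Notation mon k := (mmap1 theta k.1 * g k.2).

Hypothesis free_g : forall (l : seq ('X_{1..n} * J)) (c : 'X_{1..n} * J -> K),
  uniq l -> \sum_(k <- l) c k *: mon k = 0 -> forall k, k \in l -> c k = 0.
Hypothesis span_g : forall x : A, exists l : seq ('X_{1..n} * J), exists c : 'X_{1..n} * J -> K,
  x = \sum_(k <- l) c k *: mon k.

Definition subst (h : 'I_n -> A) (p : {mpoly K[n]}) : A := mmap (in_alg A) h p.

HB.instance Definition _ (h : 'I_n -> A) :=
  GRing.RMorphism.copy (subst h) (mmap (in_alg A) h).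

Lemma substX h m : subst h 'X_[m] = mmap1 h m.
Proof. exact: mmapX. Qed.

Lemma substZ h c p : subst h (c *: p) = c *: subst h p.
Proof. by rewrite /subst mmapZ /= mulr_algl. Qed.

(** The coordinates of x with respect to the g j, as polynomials in the h i; L is a finite set that
    carries them. *)
Definition represents (h : 'I_n -> A) (x : A) (P : J -> {mpoly K[n]}) :=
  exists L : seq J, [/\ uniq L, forall j, j \notin L -> P j = 0
    & x = \sum_(j <- L) subst h (P j) * g j].

Lemma represents_in h x P (L : seq J) : uniq L -> (forall j, j \notin L -> P j = 0) ->
  represents h x P -> x = \sum_(j <- L) subst h (P j) * g j.
Proof.
move=> uL PL [L' [uL' PL' ->]].
have E (L1 L2 : seq J) : uniq L1 -> uniq L2 -> (forall j, j \notin L2 -> P j = 0) ->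
    \sum_(j <- L1) subst h (P j) * g j =
    \sum_(j <- [seq j <- L1 | j \in L2]) subst h (P j) * g j.
  move=> u1 u2 P2; rewrite big_filter [LHS](bigID (mem L2)) /= [X in _ + X]big1 ?addr0 //.
  by move=> j /P2 ->; rewrite rmorph0 mul0r.
rewrite (E L' L) // (E L L') //; apply: perm_big; apply: uniq_perm; rewrite ?filter_uniq //.
by move=> j; rewrite !mem_filter andbC.
Qed.

Lemma representsD h x y P Q : represents h x P -> represents h y Q ->
  represents h (x + y) (fun j => P j + Q j).
Proof.
move=> rx ry; have [[L1 [u1 P1 _]] [L2 [u2 Q2 _]]] := (rx, ry).
have u : uniq (undup (L1 ++ L2)) by apply: undup_uniq.
have P0 j : j \notin undup (L1 ++ L2) -> P j = 0.
  by rewrite mem_undup mem_cat negb_or => /andP[/P1].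
have Q0 j : j \notin undup (L1 ++ L2) -> Q j = 0.
  by rewrite mem_undup mem_cat negb_or => /andP[_ /Q2].
exists (undup (L1 ++ L2)); split=> // [j jn|]; first by rewrite P0 // Q0 // addr0.
rewrite (represents_in u P0 rx) (represents_in u Q0 ry) -big_split.
by apply: eq_bigr => j _; rewrite rmorphD mulrDl.
Qed.

Lemma representsM h x P R : represents h x P -> represents h (subst h R * x) (fun j => R * P j).
Proof.
move=> [L [uL PL ->]]; exists L; split=> // [j /PL ->|]; first by rewrite mulr0.
by rewrite mulr_sumr; apply: eq_bigr => j _; rewrite rmorphM mulrA.
Qed.

Lemma represents0 h : represents h 0 (fun=> 0).
Proof. by exists [::]; rewrite big_nil. Qed.

Lemma represents_theta_exists x : exists P, represents theta x P.
Proof.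
have [l [c ->]] := span_g x.
elim: l => [|k l [P rP]]; first by rewrite big_nil; exists (fun=> 0); apply: represents0.
rewrite big_cons; exists (fun j => (if j == k.2 then c k *: 'X_[k.1] else 0) + P j).
apply: representsD => //; exists [:: k.2]; split=> // [j|].
  by rewrite inE => /negbTE ->.
by rewrite big_seq1 eqxx substZ substX -scalerAl.
Qed.

Lemma represents_theta0 P : represents theta 0 P -> forall j, P j = 0.
Proof.
move=> [L [uL PL e]] j; case: (boolP (j \in L)) => [jL|/PL //].
pose l := [seq (m, i) | i <- L, m <- msupp (P i)].
have ul : uniq l.
  apply: allpairs_uniq_dep => [//|i _|[i1 m1] [i2 m2] /= _ _ [-> ->] //].
  exact: msupp_uniq.
have := @free_g l (fun k => (P k.2)@_k.1) ul.
have -> : \sum_(k <- l) (P k.2)@_k.1 *: mon k = 0.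
  rewrite [RHS]e /l big_allpairs_dep /=; apply: eq_bigr => i _.
  by rewrite {3}[P i]mpolyE raddf_sum mulr_suml; apply: eq_bigr => m _ /=; rewrite substZ substX scalerAl.
move=> /(_ erefl) h; apply/mpolyP => m; rewrite mcoeff0.
case: (boolP (m \in msupp (P j))) => [mP|/memN_msupp_eq0 //].
by apply: (h (m, j)); apply: allpairs_f_dep.
Qed.

Variable c : 'I_n -> K.
Let psi i := theta i - (c i)%:A.
(** The automorphism of the polynomial ring that translates coordinates over theta into coordinates
    over theta - c, so that freeness survives the shift. *)
Definition shift_poly (d : 'I_n -> K) (p : {mpoly K[n]}) : {mpoly K[n]} :=
  p \mPo [tuple 'X_i + (d i)%:MP | i < n].

Lemma subst_shift h h' d p : (forall i, h' i = h i + (d i)%:A) ->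
  subst h' p = subst h (shift_poly d p).
Proof.
move=> hh'; elim/mpolyind: p => [|a m p _ _ IHp].
  by rewrite /shift_poly linear0 !rmorph0.
rewrite rmorphD /= substZ IHp /shift_poly comp_mpolyD comp_mpolyZ rmorphD /= substZ; congr (_ *: _ + _).
rewrite substX comp_mpolyX rmorph_prod /=; apply: eq_bigr => i _.
rewrite rmorphXn /= tnth_mktuple rmorphD /= hh'; congr ((_ + _) ^+ _).
  by rewrite substX mmap1U.
by rewrite /subst mmapC.
Qed.

Lemma shift_polyK d p : shift_poly (fun i => - d i) (shift_poly d p) = p.
Proof.
elim/mpolyind: p => [|a m p _ _ IHp]; first by rewrite /shift_poly !linear0.
rewrite /shift_poly in IHp *; rewrite !comp_mpolyD !comp_mpolyZ IHp; congr (_ *: _ + _).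
rewrite comp_mpolyX rmorph_prod /= mpolyXE_id; apply: eq_bigr => i _.
rewrite rmorphXn /= tnth_mktuple comp_mpolyD comp_mpolyC comp_mpolyXU.
by rewrite -tnth_nth tnth_mktuple mpolyCN subrK.
Qed.

Lemma represents_psi_exists x : exists P, represents psi x P.
Proof.
have [P [L [uL PL ->]]] := represents_theta_exists x.
exists (fun j => shift_poly c (P j)); exists L; split=> // [j /PL ->|].
  by rewrite /shift_poly linear0.
by apply: eq_bigr => j _; rewrite (@subst_shift psi theta c) // => i; rewrite subrK.
Qed.

Lemma represents_psi0 P : represents psi 0 P -> forall j, P j = 0.
Proof.
move=> [L [uL PL e]] j; suff h : shift_poly (fun i => - c i) (P j) = 0.
  have := shift_polyK (fun i => - c i) (P j).
  by rewrite h /shift_poly linear0 => <-.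
apply: (represents_theta0 (P := fun j => shift_poly (fun i => - c i) (P j))).
exists L; split=> // [i /PL ->|]; first by rewrite /shift_poly linear0.
rewrite [LHS]e; apply: eq_bigr => i _; rewrite (@subst_shift theta psi (fun i => - c i)) // => k.
by rewrite scaleNr.
Qed.

Lemma represents_psi_unique x P Q : represents psi x P -> represents psi x Q ->
  forall j, P j = Q j.
Proof.
move=> rP rQ j; apply/eqP; rewrite -subr_eq0; apply/eqP.
apply: (represents_psi0 (P := fun j => P j - Q j)).
have := representsD rP (representsM (- 1) rQ).
rewrite rmorphN rmorph1 mulN1r subrr => -[L [uL PQL e]]; exists L; split=> // [i /PQL|].
  by rewrite mulN1r.
by rewrite [LHS]e; apply: eq_bigr => i _; rewrite mulN1r.
Qed.

Definition kill (k : nat) (p : {mpoly K[n]}) : {mpoly K[n]} :=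
  p \mPo [tuple if (i < k)%N then 0 else 'X_i | i < n].

HB.instance Definition _ k := GRing.RMorphism.copy (kill k)
  (comp_mpoly [tuple if (i < k)%N then 0 else 'X_i | i < n]).

Lemma killX k m : kill k 'X_[m] = if [exists i : 'I_n, (i < k)%N && (m i != 0)%N] then 0 else 'X_[m].
Proof.
rewrite /kill comp_mpolyX; case: ifP => [/existsP[i /andP[ik mi]]|/negbT].
  by rewrite (bigD1 i) //= tnth_mktuple ik expr0n (negbTE mi) mul0r.
rewrite negb_exists => /forallP h; rewrite [RHS]mpolyXE_id; apply: eq_bigr => i _.
rewrite tnth_mktuple; case: ifP => // ik; have := h i; rewrite ik negbK => /eqP ->.
by rewrite !expr0.
Qed.

Lemma killP k (p : {mpoly K[n]}) : exists R : 'I_n -> {mpoly K[n]},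
  p - kill k p = \sum_(i < n | (i < k)%N) 'X_i * R i.
Proof.
elim/mpolyind: p => [|a m p _ _ [R e]].
  by exists (fun=> 0); rewrite rmorph0 subrr big1 // => i _; rewrite mulr0.
suff [S eS] : exists S, 'X_[m] - kill k 'X_[m] = \sum_(i < n | (i < k)%N) 'X_i * S i.
  exists (fun i => a *: S i + R i).
  rewrite rmorphD opprD addrACA e /= {1}/kill comp_mpolyZ -/(kill k _) -scalerBr eS scaler_sumr -big_split.
  by apply: eq_bigr => i _; rewrite mulrDr scalerAr.
rewrite killX; case: ifP => [/existsP[i /andP[ik mi]]|_]; last first.
  by exists (fun=> 0); rewrite subrr big1 // => i _; rewrite mulr0.
exists (fun j => if j == i then 'X_[m - U_(i)] else 0); rewrite subr0.
rewrite (bigD1 i) //= eqxx big1 ?addr0 => [|j /andP[_ /negbTE ->]]; last by rewrite mulr0.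
by rewrite -mpolyXD addmC submK // lep1mP.
Qed.

Let psis := [seq psi i | i <- enum 'I_n].

Lemma size_psis : size psis = n. Proof. by rewrite size_map size_enum_ord. Qed.

Lemma nth_psis (i : 'I_n) : psis`_i = psi i.
Proof. by rewrite (nth_map i) ?size_enum_ord // nth_ord_enum. Qed.

(** Freeness makes membership coordinatewise: [kill k] is reduction modulo the first k variables.
    Regularity then comes down to the fact that the next variable is not a zero divisor among
    polynomials in the remaining ones. *)
Lemma in_ideal_takeP k x P : (k <= n)%N -> represents psi x P ->
  in_ideal (take k psis) x <-> forall j, kill k (P j) = 0.
Proof.
move=> kn rP.
have st : size (take k psis) = k by rewrite size_takel // size_psis.
have nt i : (i < k)%N -> (take k psis)`_i = psis`_i by move=> ik; rewrite nth_take.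
split=> [[f e]|h].
  suff [Q [rQ Q0]] : exists Q, represents psi x Q /\ forall j, kill k (Q j) = 0.
    by move=> j; rewrite (represents_psi_unique rP rQ).
  rewrite {rP}e; apply: (big_ind (fun y => exists Q, represents psi y Q /\ forall j, kill k (Q j) = 0)) => [|y z [Q [rQ Q0]] [Q' [rQ' Q0']]|i _].
  - by exists (fun=> 0); split=> [|j]; [apply: represents0 | rewrite rmorph0].
  - exists (fun j => Q j + Q' j); split=> [|j]; first exact: representsD.
    by rewrite rmorphD /= Q0 Q0' addr0.
  have ik : (i < k)%N by rewrite -[X in (_ < X)%N]st.
  have lt : (i < n)%N := leq_trans ik kn.
  have [Q rQ] := represents_psi_exists (f i).
  exists (fun j => 'X_(Ordinal lt) * Q j); split=> [|j].
    have := representsM ('X_(Ordinal lt)) rQ.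
    by rewrite substX mmap1U -nth_psis -nt // mulrC.
  rewrite rmorphM /= killX ifT ?mul0r //; apply/existsP; exists (Ordinal lt).
  by rewrite ik mnm1E eqxx.
have [L [uL PL ->]] := rP.
have [I0 ID IM] := in_ideal_pred (take k psis).
apply: big_ind => // j _; rewrite mulrC; apply: (IM).
have [R e] := killP k (P j); rewrite h subr0 in e; rewrite e rmorph_sum.
apply: big_ind => // i ik; rewrite rmorphM mulrC /=; apply: (IM).
rewrite substX mmap1U -nth_psis -nt //; apply: mem_in_ideal.
by rewrite st.
Qed.

Lemma shifted_regular k x : (k < n)%N ->
  in_ideal (take k psis) (psis`_k * x) -> in_ideal (take k psis) x.
Proof.
move=> kn; have [P rP] := represents_psi_exists x.
have r' := representsM ('X_(Ordinal kn)) rP.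
rewrite substX mmap1U -nth_psis /= in r'.
move=> /(in_ideal_takeP (ltnW kn) r') h; apply/(in_ideal_takeP (ltnW kn) rP) => j.
have := h j; rewrite rmorphM /= killX ifF => [/eqP|].
  rewrite mulf_eq0 => /orP[|/eqP //]; rewrite -msize_poly_eq0 msizeX.
  by [].
apply/negbTE; rewrite negb_exists; apply/forallP => i; rewrite mnm1E.
by case: (Ordinal kn =P i) => [<-|_]; rewrite /= ?ltnn ?andbF.
Qed.

End ShiftedRegular.

(** * Cohen-Macaulayness from a basis *)

Section LambdaVal.
Variables (C : fieldType) (r s : nat) (a : nat -> C).
Local Notation B := {mpoly C[r + s]}.
Local Notation A := (Lambda r s a).

Lemma Lambda_valD (x y : A) : val (x + y) = (val x : B) + (val y : B).
Proof. by []. Qed.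

Lemma Lambda_val_mmap1 (e : nat) (x : 'I_e -> A) m :
  val (mmap1 x m) = mmap1 (fun i => val (x i) : B) m.
Proof.
rewrite /mmap1; elim: (index_enum _) => [|i l IHl]; first by rewrite !big_nil.
rewrite !big_cons Lambda_valM IHl; congr (_ * _).
by elim: (m i) => [//|k IHk]; rewrite !exprS Lambda_valM IHk.
Qed.

Lemma Lambda_val_sum (I : eqType) (l : seq I) (k : I -> C) (x : I -> A) :
  val (\sum_(i <- l) k i *: x i) = \sum_(i <- l) k i *: (val (x i) : B).
Proof.
by elim: l => [|i l IHl]; rewrite ?big_nil // !big_cons Lambda_val_lin IHl.
Qed.

End LambdaVal.

Section FixVariables.
Variables (C : fieldType) (n : nat) (p : 'I_n -> C).
Local Notation B := {mpoly C[n]}.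

Fact fix_upto_key : unit. Proof. exact: tt. Qed.
Definition fix_upto (k : nat) : B -> B := locked_with fix_upto_key
  (comp_mpoly [tuple if (i < k)%N then (p i)%:MP else 'X_i | i < n]).

Lemma fix_uptoE k : fix_upto k =
  comp_mpoly [tuple if (i < k)%N then (p i)%:MP else 'X_i | i < n].
Proof. by rewrite /fix_upto unlock. Qed.

Lemma fix_uptoX k i : fix_upto k 'X_i = if (i < k)%N then (p i)%:MP else 'X_i.
Proof. by rewrite fix_uptoE comp_mpolyXU -tnth_nth tnth_mktuple. Qed.

Lemma fix_uptoZ k (b : C) f : fix_upto k (b *: f) = b *: fix_upto k f.
Proof. by rewrite fix_uptoE comp_mpolyZ. Qed.

Lemma fix_uptoD k (f g : B) : fix_upto k (f + g) = fix_upto k f + fix_upto k g.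
Proof. by rewrite fix_uptoE rmorphD. Qed.

Lemma fix_uptoM k (f g : B) : fix_upto k (f * g) = fix_upto k f * fix_upto k g.
Proof. by rewrite fix_uptoE rmorphM. Qed.

Lemma fix_upto_sum k N (F : 'I_N -> B) :
  fix_upto k (\sum_i F i) = \sum_i fix_upto k (F i).
Proof. by rewrite fix_uptoE rmorph_sum. Qed.

Lemma fix_uptoXn k (f : B) i : fix_upto k (f ^+ i) = fix_upto k f ^+ i.
Proof. by rewrite fix_uptoE rmorphXn. Qed.

Lemma fix_uptoC k (b : C) : fix_upto k b%:MP = b%:MP.
Proof. by rewrite fix_uptoE comp_mpolyC. Qed.

Lemma fix_upto0 k : fix_upto k 0 = 0.
Proof. by rewrite fix_uptoE rmorph0. Qed.

Lemma fix_upto1 k : fix_upto k 1 = 1.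
Proof. by rewrite fix_uptoE rmorph1. Qed.

Lemma fix_upto_fix_upto j k f : (k <= j)%N -> fix_upto j (fix_upto k f) = fix_upto j f.
Proof.
move=> kj; elim/mpolyind: f => [|b m f _ _ IHf]; first by rewrite !fix_upto0.
rewrite (fix_uptoD k) 2!(fix_uptoD j) (fix_uptoZ k) 2!(fix_uptoZ j) IHf; congr (_ *: _ + _).
rewrite mpolyXE_id; elim: (index_enum _) => [|i l IHl]; first by rewrite !big_nil !fix_upto1.
rewrite !big_cons !fix_uptoM IHl; congr (_ * _).
rewrite !fix_uptoXn !fix_uptoX; case: (ltnP i k) => ik; last by rewrite fix_uptoX.
by rewrite (leq_trans ik kj) fix_uptoC.
Qed.

Lemma fix_upto_eval f : fix_upto n f = (f.@[p])%:MP.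
Proof.
elim/mpolyind: f => [|b m f _ _ IHf]; first by rewrite fix_upto0 meval0 mpolyC0.
rewrite mevalD mevalZ mpolyCD mpolyCM -IHf fix_uptoD; congr (_ + _).
rewrite fix_uptoZ -mul_mpolyC; congr (_ * _).
rewrite fix_uptoE comp_mpolyX mevalX rmorph_prod /=; apply: eq_bigr => i _.
by rewrite tnth_mktuple ltn_ord rmorphXn.
Qed.

End FixVariables.

Section CohenMacaulayLambda.
Variables (R : realType) (r s : nat) (c q t : R[i]).
Local Notation C := (R[i]).
Local Notation n := (r + s)%N.
Local Notation B := {mpoly C[r + s]}.
Hypotheses (r_gt0 : (0 < r)%N) (s_gt0 : (0 < s)%N) (c_neq0 : c != 0).
Hypotheses (hq : not_root_of_unity q) (ht : not_root_of_unity t).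
Hypothesis hqt : forall m n, (1 <= m <= r)%N -> (1 <= n <= s)%N -> q ^+ m <> t ^+ n.
Local Notation a := (a_seq c q t).
Local Notation A := (Lambda r s a).

(** A common bound for regular sequences and chains of primes. In both cases there are x_i in
    [I i.+1] regular modulo [I i]; [free_over_regular], with the single generator 1, makes them
    algebraically independent, and the polynomial ring has room for only n of them. *)
Lemma regular_chain_bound (e : nat) (x : 'I_e -> A) (I : nat -> A -> Prop) :
  (forall k, ideal_pred (I k)) -> (forall k y, (k < e)%N -> I k y -> I k.+1 y) ->
  (forall i : 'I_e, I i.+1 (x i)) -> (forall (i : 'I_e) y, I i (x i * y) -> I i y) ->
  ~ I e 1 -> (e <= n)%N.
Proof.
move=> idI leI xI regI nI1.
apply: (algebraic_independence_bound (x := fun i => val (x i) : B)) => l ul k s0 m ml.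
have IZ j b y : I j y -> I j (b *: y).
  by move=> Iy; rewrite -mulr_algl; case: (idI j) => _ _; apply.
refine (@free_over_regular C A e x (fun=> True) I unit (fun=> 1) _ _ _ _ _ _ _ _
  [seq (m0, tt) | m0 <- l] (fun h => k h.1) _ _ (m, tt) _) => //.
- move=> j; split; first by case: (idI j).
  by move=> b u v Iu Iv; case: (idI j) => _ ID _; apply: (ID) => //; apply: IZ.
- by move=> i y _; rewrite mulrC; case: (idI i.+1) => _ _; apply.
- by move=> i y _; apply: regI.
- move=> l' k' ul' Is [] ttl'; have el : l' = [:: tt].
    by case: l' ul' ttl' {Is} => [|[] [|[] l']].
  move: Is; rewrite el big_seq1 => Ik; apply/eqP/contraT => k0; case: nI1.
  by have := IZ _ (k' tt)^-1 _ Ik; rewrite scalerA mulVf // scale1r.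
- by rewrite map_inj_uniq // => m1 m2 [].
- rewrite big_map /=.
  have -> : \sum_(j <- l) k j *: (mmap1 x j * 1) = 0 :> A.
    apply: val_inj; rewrite Lambda_val_sum -[RHS]s0; apply: eq_bigr => j _.
    by rewrite mulr1 Lambda_val_mmap1.
  by case: (idI 0%N).
- exact: (map_f (fun m => (m, tt)) ml).
Qed.

Section AtPoint.
Variable p : 'I_n -> C.
Local Notation fix_upto := (fix_upto p).

(* The constant term of a minimal integral equation of X_k - p_k modulo the
   k-th prime. *)
Lemma fix_upto_strict k : (k < n)%N ->
  exists x : A, fix_upto k.+1 (val x) = 0 /\ fix_upto k (val x) != 0.
Proof.
move=> kn; pose b : B := 'X_(Ordinal kn) - (p (Ordinal kn))%:MP.
pose Int N := exists lam : nat -> A,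
  fix_upto k b ^+ N = \sum_(i < N) fix_upto k (val (lam i)) * fix_upto k b ^+ i.
have b1 : fix_upto k.+1 (fix_upto k b) = 0.
  by rewrite fix_upto_fix_upto // /b -mpolyCN fix_uptoD fix_uptoX /= leqnn fix_uptoC mpolyCN subrr.
have b0 : fix_upto k b != 0.
  rewrite /b -mpolyCN fix_uptoD fix_uptoX /= ltnn fix_uptoC mpolyCN subr_eq0.
  apply/eqP => /(congr1 (mcoeff U_(Ordinal kn))).
  by rewrite mcoeffX eqxx mcoeffC mnm1_eq0 mulr0 => /eqP; rewrite oner_eq0.
have exN : exists N, `[< Int N >].
  have [N [lam Llam e]] := Lam_integral r_gt0 s_gt0 c_neq0 hq ht hqt b.
  exists N; apply/asboolP; exists (fun i => to_Lambda (Llam i)).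
  by rewrite -fix_uptoXn e fix_upto_sum; apply: eq_bigr => i _; rewrite fix_uptoM fix_uptoXn.
case: (ex_minnP exN) => -[|N] /asboolP[lam e] minN.
  by move: e; rewrite expr0 big_ord0 => /eqP; rewrite oner_eq0.
exists (lam 0%N); split.
  have := congr1 (fix_upto k.+1) e; rewrite fix_uptoXn b1 expr0n /= fix_upto_sum big_ord_recl.
  rewrite fix_uptoM expr0 fix_upto1 mulr1 fix_upto_fix_upto // big1 ?addr0 // => i _.
  by rewrite fix_uptoM fix_uptoXn b1 expr0n mulr0.
apply/eqP => l0; have : (N.+1 <= N)%N; last by rewrite ltnn.
apply: minN; apply/asboolP; exists (fun i => lam i.+1).
apply: (mulfI b0); rewrite -exprS e big_ord_recl /= l0 mul0r add0r mulr_sumr.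
by apply: eq_bigr => i _; rewrite mulrCA -exprS.
Qed.

End AtPoint.

(** The polynomial ring is integral over Lambda, which gives a common zero p of M. The elements of
    Lambda vanishing at p form a proper ideal containing M, hence M itself. *)
Lemma maximal_ideal_point (M : idealr A) : maximal_ideal M ->
  exists p : 'I_n -> C, forall x : A, x \in M <-> (val x : B).@[p] = 0.
Proof.
move=> maxM; pose M' (f : B) := exists2 x : A, x \in M & val x = f.
have [||||||||||p pP] :=
    @maximal_point C n (@prime_ideal_root R n) (Lam r s a) M'.
- by move=> u v; apply: linear_predB (linear_Lam r s a) _ _.
- by move=> u v; apply: LamM.
- exact: Lam_integral.
- by move=> _ [x _ <-]; apply: Lam_val.
- by exists 0; rewrite ?rpred0.
- move=> _ _ [x Mx <-] [y My <-]; exists (x - y); first by rewrite rpredB.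
  by rewrite raddfB.
- move=> u _ Lu [x Mx <-]; exists (to_Lambda Lu * x); first exact: idealMr.
  by rewrite Lambda_valM.
- exact: Lam1.
- by move=> [x Mx x1]; have := idealr1 M; rewrite -(_ : x = 1) ?Mx //; apply: val_inj.
- move=> u Lu nMu; have nMx : to_Lambda Lu \notin M.
    by apply/negP => Mx; apply: nMu; exists (to_Lambda Lu).
  pose J (x : A) := exists2 m, m \in M & exists d, x = m + d * to_Lambda Lu.
  have idJ : ideal_pred J.
    split=> [|_ _ [m Mm [d ->]] [m' Mm' [d' ->]]|b _ [m Mm [d ->]]].
    - by exists 0; rewrite ?rpred0 //; exists 0; rewrite mul0r addr0.
    - exists (m + m'); first by rewrite rpredD.
      by exists (d + d'); rewrite mulrDl addrACA.
    - exists (b * m); first exact: idealMr.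
      by exists (b * d); rewrite mulrDr mulrA.
  case: (pselect (J 1)) => [[m Mm [d e]]|/(exists_idealr idJ)[I IP]].
    exists (val d), (val (- m)); first by exists (- m); rewrite ?rpredN.
    split; first exact: Lam_val.
    have : val (d * to_Lambda Lu) = val (1 - m) by rewrite e [m + _]addrC addrK.
    by rewrite Lambda_valM mulrC.
  have sMI : {subset M <= I}.
    by move=> m Mm; apply/IP; exists m => //; exists 0; rewrite mul0r addr0.
  case/negP: nMx; apply: (maxM I sMI); apply/IP; exists 0; first exact: rpred0.
  by exists 1; rewrite mul1r add0r.
exists p; pose J (x : A) := (val x : B).@[p] = 0.
have idJ : ideal_pred J.
  split=> [|x y|x y]; rewrite /J; first exact: meval0.
    by move=> hx hy; rewrite Lambda_valD mevalD hx hy addr0.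
  by move=> hy; rewrite Lambda_valM mevalM hy mulr0.
have [|I IP] := exists_idealr idJ.
  by rewrite /J -[val 1]/(1 : B) meval1 => /eqP; rewrite oner_eq0.
have MJ x : x \in M -> J x by move=> Mx; apply: pP; exists x.
move=> x; split=> [/MJ //|Jx]; apply: (maxM I); last exact/IP.
by move=> y /MJ /IP.
Qed.

Section FreeBasis.
Variables (theta : 'I_n -> A) (J : eqType) (g : J -> A).
Local Notation mon k := (mmap1 theta k.1 * g k.2).
Hypothesis free_g : forall (l : seq ('X_{1..n} * J)) (c : 'X_{1..n} * J -> C),
  uniq l -> \sum_(k <- l) c k *: mon k = 0 -> forall k, k \in l -> c k = 0.
Hypothesis span_g : forall x : A, exists l : seq ('X_{1..n} * J), exists c : 'X_{1..n} * J -> C,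
  x = \sum_(k <- l) c k *: mon k.

Lemma Cohen_Macaulay_of_basis : Cohen_Macaulay A.
Proof.
split; first exact: Lambda_noetherian.
move=> M maxM; exists n; have [p pP] := maximal_ideal_point maxM.
split; split.
- pose cst i := (val (theta i) : B).@[p].
  exists [seq theta i - (cst i)%:A | i <- enum 'I_n].
  have lM : {subset [seq theta i - (cst i)%:A | i <- enum 'I_n] <= M}.
    move=> _ /mapP[i _ ->]; apply/pP.
    have -> : val (theta i - (cst i)%:A) = val (theta i) - (cst i)%:MP :> B.
      rewrite addrC -scaleNr Lambda_val_lin -[val 1]/(1 : B) scaleNr addrC.
      by rewrite -alg_mpolyC.
    by rewrite mevalB mevalC subrr.
  split=> //; last by rewrite size_map size_enum_ord.
  split=> [i|].
    rewrite size_map size_enum_ord => lin x.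
    exact: (shifted_regular free_g span_g).
  move=> h; have : (1 : A) \in M.
    apply: (in_ideal_sub (J := fun x => x \in M) _ _ h) => //.
    split; first exact: rpred0.
      by move=> x y Mx My; rewrite rpredD.
    by move=> x y; apply: idealMr.
  by rewrite idealr1.
- move=> l [regl l1] lM.
  apply: (@regular_chain_bound (size l) (fun i => l`_i) (fun k => in_ideal (take k l))).
  + by move=> k; apply: in_ideal_pred.
  + move=> k y kl; apply: in_ideal_sub; first exact: in_ideal_pred.
    move=> z zk; have := nth_index 0 zk => <-.
    have ik : (index z (take k l) < k)%N.
      by rewrite -[X in (_ < X)%N](size_takel (ltnW kl)) index_mem.
    rewrite nth_take // -(nth_take (n0 := k.+1)) 1?ltnW //.
    by apply: mem_in_ideal; rewrite size_takel // ltnW.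
  + move=> i; rewrite -(nth_take (n0 := i.+1)) //; apply: mem_in_ideal.
    by rewrite size_takel.
  + by move=> i y; apply: regl.
  + by rewrite take_size.
- have /choice[P PP] k : exists P : prime_idealr A, forall x, x \in P <-> fix_upto p k (val x) = 0.
    apply: exists_prime_idealr.
    - split=> [|x y hx hy|x y hy]; first exact: fix_upto0.
        by rewrite Lambda_valD fix_uptoD hx hy addr0.
      by rewrite Lambda_valM fix_uptoM hy mulr0.
    - by rewrite -[val 1]/(1 : B) fix_upto1 => /eqP; rewrite oner_eq0.
    - move=> x y; rewrite Lambda_valM fix_uptoM => /eqP.
      by rewrite mulf_eq0 => /orP[] /eqP; [left|right].
  exists P; split=> [i lin|x]; last first.
    by apply/idP/idP => [/PP|/pP e]; [|apply/PP]; rewrite fix_upto_eval;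
      [move=> /eqP; rewrite mpolyC_eq0 => /eqP/pP | rewrite e mpolyC0].
  split=> [x /PP e|sub].
    by apply/PP; rewrite -(fix_upto_fix_upto p _ (leqnSn i)) e fix_upto0.
  have [x [x1 x0]] := fix_upto_strict p lin.
  by have /PP/eqP := sub x ((PP i.+1 x).2 x1); rewrite (negbTE x0).
(* An element of P i.+1 outside the prime P i is regular modulo P i. *)
- move=> e [P [Pinc PM]].
  have ex i : exists x, (i < e)%N -> x \in P i.+1 /\ x \notin P i.
    case: (ltnP i e) => [ie|]; last by exists 0.
    have [_ nsub] := Pinc i ie; apply: contrapT => nex; apply: nsub => x Px.
    by case: (boolP (x \in P i)) => // nP; case: nex; exists x.
  have /choice[x xP] := ex.
  apply: (@regular_chain_bound e (fun i => x i) (fun k y => y \in P k)).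
  + move=> k; split; first exact: rpred0.
      by move=> u v Pu Pv; rewrite rpredD.
    by move=> u v; apply: idealMr.
  + by move=> k y ke; apply: (Pinc k ke).1.
  + by move=> i; apply: (xP i (ltn_ord i)).1.
  + move=> i y; rewrite prime_idealrM => /orP[xi|//].
    by have := (xP i (ltn_ord i)).2; rewrite xi.
  + by rewrite idealr1.
Qed.

End FreeBasis.

End CohenMacaulayLambda.

(** * The limit algebra *)

Local Notation "m # s" := [multinom m (s i) | i < _]
  (at level 40, left associativity, format "m # s").

Section Blocks.
Variables (r s : nat).
Local Notation n := (r + s)%N.

Definition zdeg (m : 'X_{1..r + s}) : nat := \sum_(i < r + s | ~~ (i < r)%N) m i.

Lemma zdeg0 : zdeg 0%MM = 0%N.
Proof. by rewrite /zdeg big1 // => i _; rewrite mnm0E. Qed.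

Lemma zdegD : {morph zdeg : m1 m2 / (m1 + m2)%MM >-> (m1 + m2)%N}.
Proof. by move=> m1 m2; rewrite /zdeg -big_split; apply: eq_bigr => i _; rewrite mnmDE. Qed.

(* The exponents that occur in the limit of the algebras Lambda at (q, t) = (0, 1). *)
Definition ok_exp (i : 'I_n) (e : nat) : bool := [|| (i < r)%N, e == 0%N | (r < e)%N].
Definition okm (m : 'X_{1..n}) : bool := [forall i, ok_exp i (m i)].

(** The subgroup S_r x S_s, permuting the y and the z separately. *)
Definition blk (w : 'S_n) : bool := [forall i, ((w i < r)%N == (i < r)%N)].

Lemma blkP w i : blk w -> (w i < r)%N = (i < r)%N.
Proof. by move/forallP/(_ i)/eqP. Qed.

Lemma blk1 : blk 1%g. Proof. by apply/forallP => i; rewrite perm1. Qed.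

Lemma blkM w w' : blk w' -> blk (w * w')%g = blk w.
Proof. by move=> bw'; apply: eq_forallb => i; rewrite permM (blkP _ bw'). Qed.

Lemma blkV w : blk w -> blk w^-1%g.
Proof. by move=> bw; apply/forallP => i; rewrite -(blkP _ bw) permKV. Qed.

Lemma blk_tperm (i j : 'I_n) : (i < r)%N = (j < r)%N -> blk (tperm i j).
Proof. by move=> ij; apply/forallP => k; case: tpermP => [->|->|_ _]; rewrite ?ij. Qed.

Lemma ok_exp_blk w i e : blk w -> ok_exp (w i) e = ok_exp i e.
Proof. by move=> bw; rewrite /ok_exp (blkP _ bw). Qed.

Lemma okm_mperm w (m : 'X_{1..n}) : blk w -> okm (m#w) = okm m.
Proof.
move=> bw; apply/forallP/forallP => h i.
  by have := h (w^-1%g i); rewrite mnmE permKV ok_exp_blk // blkV.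
by rewrite mnmE -(ok_exp_blk _ _ bw).
Qed.

Lemma zdeg_mperm w (m : 'X_{1..n}) : blk w -> zdeg (m#w) = zdeg m.
Proof.
move=> bw; rewrite /zdeg [RHS](reindex_inj (@perm_inj _ w)) /=.
by apply: eq_big => i; rewrite ?(blkP _ bw) // mnmE.
Qed.

Lemma ok_expD i e e' : ok_exp i e -> ok_exp i e' -> ok_exp i (e + e').
Proof. by rewrite /ok_exp; lia. Qed.

Lemma okmD m m' : okm m -> okm m' -> okm (m + m')%MM.
Proof.
by move=> /forallP h /forallP h'; apply/forallP => i; rewrite mnmDE; apply: ok_expD.
Qed.

End Blocks.

HB.instance Definition _ (r s : nat) :=
  isMeasure.Build (r + s) (@zdeg r s) (@zdeg0 r s) (@zdegD r s).

Lemma mcoeffMX_neq0 (K : nzRingType) (n : nat) (b : {mpoly K[n]}) u m :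
  (b * 'X_[u])@_m != 0 -> (u <= m)%MM /\ b@_(m - u)%MM != 0.
Proof.
rewrite -mcoeff_msupp (perm_mem (msuppMX _ _)) => /mapP[m' hm' ->].
by rewrite lem_addr addmC addmK -mcoeff_msupp.
Qed.

Section LimitAlgebra.
Variables (K : fieldType) (r s : nat).
Local Notation n := (r + s)%N.
Local Notation B := {mpoly K[r + s]}.
Hypothesis char0 : forall m, (m.+1%:R : K) != 0.

(** The span of the admissible monomials, a subring of B whose invariants are the algebra A.
    Regularity is proved here, where the ideals of the variables are monomial, and passes to the
    invariants by averaging. *)
Definition Mgr (f : B) := forall m, f@_m != 0 -> okm m.
Definition winv (f : B) := forall w, blk w -> msym w f = f.
Definition Agr f := Mgr f /\ winv f.
Definition Wsym (f : B) : B := \sum_(w : 'S_n | blk w) msym w f.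
Definition Worder : nat := #|[pred w : 'S_n | blk w]|.

Lemma Worder_neq0 : (Worder%:R : K) != 0.
Proof.
rewrite /Worder; have : (0 < #|[pred w : 'S_n | blk w]|)%N.
  by apply/card_gt0P; exists 1%g; apply: blk1.
by case: #|_|.
Qed.

Lemma winv_Wsym f : winv (Wsym f).
Proof.
move=> w bw; rewrite /Wsym [LHS]raddf_sum [RHS](reindex_inj (mulIg w)) /=.
by apply: eq_big => v; rewrite ?blkM // => _; rewrite msymMm.
Qed.

Lemma Wsym_winv f : winv f -> Wsym f = Worder%:R *: f.
Proof.
move=> If; rewrite /Wsym (eq_bigr (fun=> f)) => [|w /If //].
by rewrite sumr_const scaler_nat.
Qed.

Lemma linear_winv : linear_pred winv.
Proof.
split=> [w _|k u v Iu Iv w bw]; first exact: msym0.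
by rewrite msymD msymZ Iu // Iv.
Qed.

Lemma winvM u v : winv u -> winv v -> winv (u * v).
Proof. by move=> Iu Iv w bw; rewrite msymM Iu // Iv. Qed.

Lemma winv1 : winv 1. Proof. by move=> w _; apply: msym1. Qed.

Lemma Wsym_linear k u v : Wsym (k *: u + v) = k *: Wsym u + Wsym v.
Proof.
rewrite /Wsym scaler_sumr -big_split; apply: eq_bigr => w _.
by rewrite msymD msymZ.
Qed.

Lemma WsymM u v : winv u -> Wsym (u * v) = u * Wsym v.
Proof.
move=> Iu; rewrite /Wsym mulr_sumr; apply: eq_bigr => w bw.
by rewrite msymM Iu.
Qed.

Lemma linear_Mgr : linear_pred Mgr.
Proof.
split=> [m|k u v Mu Mv m]; first by rewrite mcoeff0 eqxx.
rewrite mcoeffD mcoeffZ; case: (eqVneq u@_m 0) => [->|/Mu //].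
by rewrite mulr0 add0r; apply: Mv.
Qed.

Lemma MgrX m : okm m -> Mgr 'X_[m].
Proof. by move=> om m'; rewrite mcoeffX; case: (m =P m') => [<- //|_]; rewrite eqxx. Qed.

Lemma Mgr_ind f (P : B -> Prop) : linear_pred P -> (forall m, okm m -> P 'X_[m]) ->
  Mgr f -> P f.
Proof.
move=> linP PX Mf; rewrite [f]mpolyE; apply: linear_pred_sum => // m mf _.
by apply: linear_predZ => //; apply/PX/Mf; rewrite -mcoeff_msupp.
Qed.

Lemma MgrM u v : Mgr u -> Mgr v -> Mgr (u * v).
Proof.
move=> Mu Mv; apply: (Mgr_ind (P := fun u => Mgr (u * v)) _ _ Mu) => [|m om].
  split; first by rewrite mul0r; apply: linear_pred0 linear_Mgr.
  by move=> k u1 u2 h1 h2; rewrite mulrDl -scalerAl; apply: (linear_pred2 linear_Mgr).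
apply: (Mgr_ind (P := fun v => Mgr ('X_[m] * v)) _ _ Mv) => [|m' om'].
  split; first by rewrite mulr0; apply: linear_pred0 linear_Mgr.
  by move=> k u1 u2 h1 h2; rewrite mulrDr -scalerAr; apply: (linear_pred2 linear_Mgr).
by rewrite -mpolyXD; apply: MgrX; apply: okmD.
Qed.

Lemma Mgr1 : Mgr 1.
Proof. by rewrite -mpolyX0; apply: MgrX; apply/forallP => i; rewrite mnm0E /ok_exp orbT. Qed.

Lemma Mgr_msym w f : blk w -> Mgr f -> Mgr (msym w f).
Proof. by move=> bw Mf m; rewrite mcoeff_sym => /Mf; rewrite okm_mperm. Qed.

Lemma Mgr_Wsym f : Mgr f -> Mgr (Wsym f).
Proof.
move=> Mf; apply: linear_pred_sum; first exact: linear_Mgr.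
by move=> w _ bw; apply: Mgr_msym.
Qed.

Lemma linear_Agr : linear_pred Agr.
Proof.
split; first by split; [apply: linear_pred0 linear_Mgr | apply: linear_pred0 linear_winv].
move=> k u v [Mu Iu] [Mv Iv].
by split; [apply: (linear_pred2 linear_Mgr) | apply: (linear_pred2 linear_winv)].
Qed.

Lemma AgrM u v : Agr u -> Agr v -> Agr (u * v).
Proof. by move=> [Mu Iu] [Mv Iv]; split; [apply: MgrM | apply: winvM]. Qed.

Lemma Agr_Wsym f : Mgr f -> Agr (Wsym f).
Proof. by move=> Mf; split; [apply: Mgr_Wsym | apply: winv_Wsym]. Qed.

Lemma Agr_pihomog d f : Agr f -> Agr (pihomog mdeg d f).
Proof.
move=> [Mf If]; split=> [m|w bw]; last by rewrite msym_pihomog If.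
rewrite pihomogE raddf_sum /= => h; apply: Mf; apply: contraNneq h => f0.
rewrite big1 // => m' _; rewrite mcoeffZ mcoeffX; case: eqP => [->|_]; last by rewrite mulr0.
by rewrite f0 mul0r.
Qed.

(** The least positive exponent that is admissible at the variable i. *)
Definition xexp (i : 'I_n) : nat := if (i < r)%N then 1 else r.+1.
Definition xm (i : 'I_n) : 'X_{1..n} := (U_(i) *+ xexp i)%MM.
Definition xgr (i : 'I_n) : B := 'X_[xm i].

Lemma xmE i j : xm i j = if i == j then xexp i else 0%N.
Proof. by rewrite mulmnE mnm1E; case: eqP; rewrite ?mul1n ?mul0n. Qed.

Lemma okm_xm i : okm (xm i).
Proof.
apply/forallP => j; rewrite xmE /ok_exp /xexp; case: (i =P j) => [<-|_]; last by rewrite eqxx orbT.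
by case: (i < r)%N => //=; rewrite ltnSn.
Qed.

Lemma Mgr_xgr i : Mgr (xgr i). Proof. by apply: MgrX; apply: okm_xm. Qed.

Definition NN (J : {set 'I_n}) (f : B) : Prop :=
  exists2 b : 'I_n -> B, (forall i, Mgr (b i)) & f = \sum_(i in J) xgr i * b i.

Lemma linear_NN J : linear_pred (NN J).
Proof.
split; first by exists (fun=> 0) => [_|]; [apply: linear_pred0 linear_Mgr | rewrite big1 // => i _; rewrite mulr0].
move=> k _ _ [b Mb ->] [b' Mb' ->]; exists (fun i => k *: b i + b' i).
  by move=> i; apply: (linear_pred2 linear_Mgr).
by rewrite scaler_sumr -big_split; apply: eq_bigr => i _; rewrite mulrDr scalerAr.
Qed.

Lemma submodule_NN J : submodule Mgr (NN J).
Proof.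
split=> [|a b Na Nb|u _ su [b Mb ->]]; first exact: linear_pred0 (linear_NN J).
  exact: linear_predB (linear_NN J) _ _ Na Nb.
exists (fun i => u * b i) => [i|]; first exact: su.
by rewrite mulr_sumr; apply: eq_bigr => i _; rewrite mulrCA.
Qed.

Lemma submodule_Mgr : submodule Mgr Mgr.
Proof.
split=> [|a b Ma Mb|u a su Ma]; first exact: linear_pred0 linear_Mgr.
  exact: linear_predB linear_Mgr _ _ Ma Mb.
exact: su.
Qed.

Lemma NN_X (J : {set 'I_n}) (i : 'I_n) m : i \in J -> (xm i <= m)%MM -> okm (m - xm i)%MM ->
  NN J 'X_[m].
Proof.
move=> iJ le om; exists (fun j => if j == i then 'X_[m - xm i] else 0) => [j|].
  by case: ifP => _; [apply: MgrX | apply: linear_pred0 linear_Mgr].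
rewrite (bigD1 i) //= eqxx big1 ?addr0 => [|j /andP[_ /negbTE ->]]; last by rewrite mulr0.
by rewrite -mpolyXD addmC submK.
Qed.

Lemma NN_supp (J : {set 'I_n}) f m : NN J f -> f@_m != 0 ->
  exists i, [/\ i \in J, (xm i <= m)%MM & okm (m - xm i)%MM].
Proof.
move=> [b Mb ->]; rewrite raddf_sum /= => h.
have [i iJ hi] : exists2 i, i \in J & (xgr i * b i)@_m != 0.
  apply: contrapT => nex; case/eqP: h; apply: big1 => i iJ; apply/eqP/contraT => h.
  by case: nex; exists i.
rewrite /xgr mulrC in hi; have [le h'] := mcoeffMX_neq0 hi.
by exists i; split=> //; apply: Mb h'.
Qed.

(** Membership in [NN J] is decided monomial by monomial, through the exponent at a single j in J.
    Multiplying by x_i with i outside J leaves that exponent unchanged. *)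
Lemma NN_reg (i : 'I_n) (J : {set 'I_n}) f : i \notin J -> Mgr f -> NN J (xgr i * f) -> NN J f.
Proof.
move=> iJ Mf Nxf; rewrite [f]mpolyE; apply: (linear_pred_sum (linear_NN J)) => m mf _.
apply: (linear_predZ (linear_NN J)).
have fm : f@_m != 0 by rewrite -mcoeff_msupp.
have : (xgr i * f)@_(m + xm i) != 0 by rewrite /xgr mulrC addmC mcoeffMX.
move=> /(NN_supp Nxf)[j [jJ le om]].
have ij : i != j by apply: contraNneq iJ => ->.
have le' : (xm j <= m)%MM.
  apply/mnm_lepP => k; move/mnm_lepP: le => /(_ k); rewrite mnmDE !xmE.
  by case: (j =P k) => [<-|//]; rewrite (negbTE ij) addn0.
apply: (NN_X jJ le'); apply/forallP => k.
have := forallP om k; rewrite !mnmBE mnmDE !xmE.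
case: (j =P k) => [<-|_]; first by rewrite (negbTE ij) addn0.
by move=> _; rewrite subn0; have := forallP (Mf m fm) k.
Qed.

Lemma NN_sub (J J' : {set 'I_n}) f : J \subset J' -> NN J f -> NN J' f.
Proof.
move=> JJ' [b Mb ->]; exists (fun i => if i \in J then b i else 0) => [i|].
  by case: ifP => _ //; apply: linear_pred0 linear_Mgr.
rewrite [RHS](bigID (mem J)) /= [X in _ + X]big1 ?addr0 => [|i /andP[_ /negbTE ->]]; last by rewrite mulr0.
apply: eq_big => [i|i ->//]; case: (boolP (i \in J)) => iJ; last by rewrite andbF.
by rewrite (subsetP JJ' i iJ).
Qed.

Lemma NN_U1 (i : 'I_n) (J : {set 'I_n}) f :
  NN (i |: J) f <-> add_mult Mgr (NN J) (xgr i) f.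
Proof.
split=> [Nf|[h Mh Nh]].
  case: (boolP (i \in J)) => iJ.
    have e : i |: J = J by apply/setUidPr; rewrite sub1set.
    by apply: sub_add_mult; [apply: submodule_Mgr | rewrite -e].
  case: Nf => b Mb ->; exists (b i) => //; exists b => //.
  rewrite (bigD1 i) ?setU11 //= addrC addrK; apply: eq_bigl => j.
  rewrite !inE; case: (j =P i) => [->|_] /=; first by rewrite (negbTE iJ).
  by rewrite andbT.
rewrite -[f](subrK (xgr i * h)); apply: (linear_predD (linear_NN _)).
  by apply: NN_sub Nh; apply: subsetUr.
exists (fun j => if j == i then h else 0) => [j|].
  by case: ifP => _ //; apply: linear_pred0 linear_Mgr.
by rewrite (bigD1 i) ?setU11 //= eqxx big1 ?addr0 // => j /andP[_ /negbTE ->]; rewrite mulr0.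
Qed.

Definition Yset : {set 'I_n} := [set i : 'I_n | (i < r)%N].
Definition thetas : seq B := elsyms xgr Yset ++ elsyms xgr (~: Yset) ++ [::].

Lemma size_thetas : size thetas = n.
Proof.
rewrite !size_cat /elsyms !size_map !size_rev !size_iota addn0.
by rewrite cardsC card_ord.
Qed.

Lemma stab_xgr i : stabilizes Mgr (xgr i).
Proof. by move=> f; apply: MgrM; apply: Mgr_xgr. Qed.

(** As [NN set0] is zero, this is regularity on Mgr itself. The y block comes first; the z block is
    then treated modulo the ideal of all the y. *)
Lemma regular_thetas : regular Mgr (NN set0) thetas.
Proof.
apply: (regular_elsyms (NN := NN) submodule_Mgr stab_xgr submodule_NN NN_U1 NN_reg).
- by rewrite disjoint_sym -setI_eq0 set0I.
- rewrite cats0 => _ /mapP[k _ ->]; exact: (elsym_stabilizes submodule_Mgr stab_xgr).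
rewrite set0U.
apply: (regular_elsyms (NN := NN) submodule_Mgr stab_xgr submodule_NN NN_U1 NN_reg) => //.
by rewrite -setI_eq0 setIC setICr.
Qed.

End LimitAlgebra.

Lemma regular_nth (B : comNzRingType) (M N : B -> Prop) cs k f (h : nat -> B) :
  submodule M M -> submodule M N -> (forall c, c \in cs -> stabilizes M c) ->
  regular M N cs -> (k < size cs)%N -> M f -> (forall i, M (h i)) ->
  N (cs`_k * f - \sum_(i < k) cs`_i * h i) ->
  exists2 h' : nat -> B, (forall i, M (h' i)) & N (f - \sum_(i < k) cs`_i * h' i).
Proof.
move=> sM; elim: cs N k f h => [//|c cs IHcs] N [|k] f h sN scs [regc regcs] kc Mf Mh.
  rewrite !big_ord0 subr0 => /(regc _ Mf) Nf; exists (fun=> 0) => [_|]; last by rewrite big_ord0 subr0.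
  exact: (submodule0 sM).
rewrite big_ord_recl /= => Nf.
have [|c' c'cs|//|//|i||h' Mh' [h0 Mh0 Nh]] :=
    IHcs (add_mult M N c) k f (fun i => h i.+1) _ _ regcs.
- exact: submodule_add_mult.
- by apply: scs; rewrite inE c'cs orbT.
- exact: Mh.
- by exists (h 0%N) => //; rewrite -addrA -opprD [X in _ - X]addrC.
exists (fun i => if i is j.+1 then h' j else h0) => [[|i]//|].
by rewrite big_ord_recl /= opprD addrA addrAC.
Qed.

Section GreedyBasis.
Variables (K : fieldType) (V : lmodType K) (T : countType) (P : pred T) (v : T -> V).
Variable N : V -> Prop.

Definition span_mod (Q : pred T) (u : V) :=
  forall L, linear_pred L -> (forall u, N u -> L u) -> (forall m, Q m -> L (v m)) -> L u.

(** Along an enumeration of T those v m are kept that the preceding ones do not span modulo N. What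
    is kept is a basis modulo N, also for an infinite family. *)
Definition greedy (m : T) : bool :=
  P m && ~~ `[< span_mod (fun m' => P m' && (pickle m' < pickle m)%N) (v m) >].

Lemma span_greedy u : span_mod P u -> span_mod greedy u.
Proof.
move=> Pu L linL NL gL; apply: Pu => // m Pm.
have [b] := ubnP (pickle m); elim: b m Pm => [//|b IHb] m Pm mb.
have [gm|] := boolP (greedy m); first exact: gL.
rewrite /greedy Pm /= negbK => /asboolP; apply => // m' /andP[Pm' m'm].
by apply: IHb => //; apply: leq_trans m'm mb.
Qed.

Lemma free_greedy l c : uniq l -> {subset l <= greedy} -> N (\sum_(m <- l) c m *: v m) ->
  forall m, m \in l -> c m = 0.
Proof.
move=> ul gl Ns.
suff main b : (forall m, m \in l -> c m != 0 -> (pickle m < b)%N) ->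
    forall m, m \in l -> c m = 0.
  apply: (main (\max_(m <- l) (pickle m).+1)) => m ml _.
  exact: (@leq_bigmax_seq _ l xpredT (fun m => (pickle m).+1)).
elim: b => [|b IHb] lb; first by move=> m ml; apply/eqP/contraT => /(lb _ ml).
apply: IHb => m ml cm; have := lb m ml cm; rewrite ltnS leq_eqVlt => /orP[/eqP mb|//].
have /andP[_ /asboolP[]] := gl m ml => L linL NL smL.
rewrite -[v m](scalerK cm); apply: linear_predZ => //.
have -> : c m *: v m = \sum_(j <- l) c j *: v j - \sum_(j <- l | j != m) c j *: v j.
  by rewrite (bigD1_seq m) //= addrK.
apply: linear_predB => //; first exact: NL.
apply: linear_pred_sum => // j jl jm.
have [->|cj] := eqVneq (c j) 0; first by rewrite scale0r; apply: linear_pred0.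
apply: linear_predZ => //; apply: smL; have /andP[-> _] := gl j jl.
have := lb j jl cj; rewrite /= mb ltnS leq_eqVlt => /orP[/eqP|//].
by rewrite -mb => /(pcan_inj pickleK) e; rewrite e eqxx in jm.
Qed.

End GreedyBasis.

(** * A basis of the limit algebra over its parameters *)

Section LimitBasis.
Variables (K : fieldType) (r s : nat).
Local Notation n := (r + s)%N.
Local Notation B := {mpoly K[r + s]}.
Hypothesis char0 : forall m, (m.+1%:R : K) != 0.
Local Notation Agr := (@Agr K r s).
Local Notation Mgr := (@Mgr K r s).
Local Notation xgr := (@xgr K r s).
Local Notation Wsym := (@Wsym K r s).

Definition theta (i : 'I_n) : B := (thetas K r s)`_i.
(** The degrees follow the decreasing order of [elsyms]: r, ..., 1 in the y block and (r+1)s, ...,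
    r+1 in the z block. Only the latter count for the degree in z. *)
Definition tdeg (i : 'I_n) : nat := if (i < r)%N then (r - i)%N else (r.+1 * (s - (i - r)))%N.
Definition tzdeg (i : 'I_n) : nat := if (i < r)%N then 0%N else (r.+1 * (s - (i - r)))%N.

Lemma tdeg_gt0 i : (0 < tdeg i)%N.
Proof.
have := ltn_ord i; rewrite /tdeg; case: (ltnP i r) => ir il; first by rewrite subn_gt0.
by rewrite muln_gt0 subn_gt0; lia.
Qed.

Lemma card_Yset : #|Yset r s| = r.
Proof.
rewrite -sum1_card (eq_bigl (fun i : 'I_n => (i < r)%N)) => [|i]; last by rewrite inE.
by rewrite -(big_ord_widen n (fun=> 1%N)) ?leq_addr // sum1_card card_ord.
Qed.

Lemma card_Zset : #|~: Yset r s| = s.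
Proof. by have := cardsC (Yset r s); rewrite card_Yset card_ord => /addnI. Qed.

Lemma thetaE i : theta i = if (i < r)%N then elsym xgr (Yset r s) (r - i)
  else elsym xgr (~: Yset r s) (s - (i - r)).
Proof.
rewrite /theta /thetas cats0 nth_cat /elsyms size_map size_rev size_iota card_Yset.
have il := ltn_ord i; case: (ltnP i r) => ir.
  rewrite (nth_map 0%N) ?size_rev ?size_iota ?card_Yset // nth_rev ?size_iota //.
  by rewrite nth_iota ?add0n ?subnSK //; lia.
have h : (i - r < s)%N by lia.
rewrite (nth_map 0%N) ?size_rev ?size_iota ?card_Zset // nth_rev ?size_iota //.
by rewrite nth_iota ?add0n ?subnSK //; lia.
Qed.

Lemma homog_prod_const (mf : measure n) (A : {set 'I_n}) (f : 'I_n -> B) e :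
  (forall i, i \in A -> f i \is e.-homog for mf) ->
  \prod_(i in A) f i \is (e * #|A|).-homog for mf.
Proof.
move=> hf; rewrite -sum1_card big_distrr /=.
apply: (big_ind2 (fun (d : nat) (u : B) => u \is d.-homog for mf)).
- exact: dhomog1.
- by move=> d1 u1 d2 u2; apply: dhomogM.
- by move=> i iA; rewrite muln1; apply: hf.
Qed.

Lemma homog_elsym (mf : measure n) (A : {set 'I_n}) k e :
  (forall i, i \in A -> xgr i \is e.-homog for mf) -> elsym xgr A k \is (e * k).-homog for mf.
Proof.
move=> hx; rewrite /elsym; apply: rpred_sum => A' /andP[A'A /eqP <-].
by apply: homog_prod_const => i /(subsetP A'A); apply: hx.
Qed.

Lemma mdeg_xm i : mdeg (xm i : 'X_{1..r + s}) = xexp i.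
Proof. by rewrite /xm mdegMn mdeg1 mul1n. Qed.

Lemma theta_homog i : theta i \is (tdeg i).-homog.
Proof.
rewrite thetaE /tdeg; case: ifP => _.
  rewrite -[X in X.-homog]mul1n; apply: homog_elsym => j; rewrite inE => jr.
  by rewrite dhomogX /= mdeg_xm /xexp jr.
apply: homog_elsym => j; rewrite !inE => jr.
by rewrite dhomogX /= mdeg_xm /xexp (negbTE jr).
Qed.

Lemma zdeg_xm i : zdeg (xm i : 'X_{1..r + s}) = if (i < r)%N then 0%N else r.+1.
Proof.
rewrite /zdeg; case: ltnP => ir.
  apply: big1 => j jr; rewrite xmE; case: (i =P j) => // e.
  by rewrite -e ir in jr.
rewrite (bigD1 i) -?leqNgt //= xmE eqxx /xexp ltnNge ir /= big1 ?addn0 // => j /andP[_ ji].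
by rewrite xmE eq_sym (negbTE ji).
Qed.

Lemma theta_zhomog i : theta i \is (tzdeg i).-homog for (@zdeg r s).
Proof.
rewrite thetaE /tzdeg; case: ifP => _.
  suff : elsym xgr (Yset r s) (r - i) \is (0 * (r - i)).-homog for (@zdeg r s).
    by rewrite mul0n.
  apply: homog_elsym => j; rewrite inE => jr.
  by rewrite dhomogX /= zdeg_xm jr.
apply: homog_elsym => j; rewrite !inE => jr.
by rewrite dhomogX /= zdeg_xm (negbTE jr).
Qed.

Lemma msym_xgr w i : blk w -> msym w (xgr i) = xgr (w i).
Proof.
move=> bw; rewrite /xgr msymX; congr 'X_[_]; apply/mnmP => j.
rewrite mnmE !xmE /xexp (blkP _ bw) -(inj_eq (@perm_inj _ w)) permKV.
by [].
Qed.

Lemma winv_elsym (A : {set 'I_n}) k : (forall w i, blk w -> (w i \in A) = (i \in A)) ->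
  winv (elsym xgr A k).
Proof.
move=> wA w bw; rewrite /elsym raddf_sum /=.
rewrite [RHS](reindex_inj (imset_inj (@perm_inj _ w))) /=.
apply: eq_big => [A'|A' _].
  rewrite card_imset; last exact: perm_inj.
  congr (_ && _); apply/subsetP/subsetP => h i.
    by case/imsetP => j /h jA ->; rewrite wA.
  by move=> iA'; rewrite -(wA w) //; apply: h; apply: imset_f.
rewrite big_imset /=; last by move=> i j _ _; apply: perm_inj.
by rewrite rmorph_prod /=; apply: eq_bigr => i _; rewrite msym_xgr.
Qed.

Lemma Agr_theta i : Agr (theta i).
Proof.
split.
  rewrite -[theta i]mulr1 thetaE; case: ifP => _;
    apply: (elsym_stabilizes (submodule_Mgr K r s) (@stab_xgr K r s)); apply: Mgr1.
rewrite thetaE; case: ifP => _; apply: winv_elsym => w j bw; rewrite !inE.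
  exact: blkP.
by rewrite (blkP _ bw).
Qed.

Definition theta_ideal (k : nat) (f : B) : Prop :=
  exists2 h : 'I_n -> B, (forall i, Agr (h i)) & f = \sum_(i < n | (i < k)%N) theta i * h i.

Lemma linear_theta_ideal k : linear_pred (theta_ideal k).
Proof.
split.
  exists (fun=> 0) => [_|]; first exact: linear_pred0 (linear_Agr K r s).
  by rewrite big1 // => i _; rewrite mulr0.
move=> b _ _ [h Ah ->] [h' Ah' ->]; exists (fun i => b *: h i + h' i) => [i|].
  exact: (linear_pred2 (linear_Agr K r s)).
by rewrite scaler_sumr -big_split; apply: eq_bigr => i _; rewrite mulrDr scalerAr.
Qed.

Lemma theta_ideal_mul (i : 'I_n) f : Agr f -> theta_ideal i.+1 (theta i * f).
Proof.
move=> Af; exists (fun j => if j == i then f else 0) => [j|].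
  by case: ifP => // _; apply: linear_pred0 (linear_Agr K r s).
rewrite (bigD1 i) //= eqxx big1 ?addr0 // => j /andP[_ /negbTE ->].
by rewrite mulr0.
Qed.

Lemma theta_ideal_le k f : theta_ideal k f -> theta_ideal k.+1 f.
Proof.
move=> [h Ah ->]; exists (fun i : 'I_n => if (i < k)%N then h i else 0) => [i|].
  by case: ifP => // _; apply: linear_pred0 (linear_Agr K r s).
rewrite [RHS](bigID (fun i : 'I_n => (i < k)%N)) /= [X in _ + X]big1 => [|i /andP[_ /negbTE ->]].
  rewrite addr0; apply: eq_big => [i|i ->//].
  by rewrite andb_idl // => /leqW.
by rewrite mulr0.
Qed.

(** Regularity on Mgr gives cofactors in Mgr; averaging over S_r x S_s makes them invariant, since f
    and the theta are invariant. *)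
Lemma theta_ideal_reg (i : 'I_n) f : Agr f -> theta_ideal i (theta i * f) -> theta_ideal i f.
Proof.
move=> [Mf If] [h Ah e]; pose h0 k := oapp h 0 (insub k : option 'I_n).
have bigE (g : nat -> B) : \sum_(j < i) (thetas K r s)`_j * g j =
    \sum_(j < n | (j < i)%N) theta j * g j.
  by rewrite (big_ord_widen n (fun j => (thetas K r s)`_j * g j)) // ltnW.
have N0 g : NN (s := s) set0 g <-> g = 0 :> B.
  split=> [[b _ ->]|->]; last exact: linear_pred0 (linear_NN K (s := s) _).
  by rewrite big1 // => j; rewrite inE.
have [||||||||h' Mh' /N0] := @regular_nth B Mgr (NN (s := s) set0) (thetas K r s) i f h0.
- exact: submodule_Mgr.
- exact: submodule_NN.
- move=> u; rewrite /thetas cats0 mem_cat => /orP[] /mapP[k _ ->];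
    exact: (elsym_stabilizes (submodule_Mgr K r s) (@stab_xgr K r s)).
- exact: regular_thetas.
- by rewrite size_thetas.
- by [].
- move=> k; rewrite /h0; case: insubP => [j _ _|_] /=; first by case: (Ah j).
  exact: linear_pred0 (linear_Mgr K r s).
- apply/N0/eqP; rewrite bigE subr_eq0; apply/eqP; rewrite -/(theta i) e.
  by apply: eq_bigr => j _; rewrite /h0 valK.
move/eqP; rewrite subr_eq0 bigE => /eqP ef.
have e' : Wsym f = \sum_(j < n | (j < i)%N) theta j * Wsym (h' j).
  rewrite {1}ef /Wsym; under [RHS]eq_bigr => j _ do rewrite mulr_sumr.
  rewrite [RHS]exchange_big /=; apply: eq_bigr => w bw; rewrite raddf_sum.
  by apply: eq_bigr => j _; rewrite /= msymM (Agr_theta j).2.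
rewrite -[f](scalerK (Worder_neq0 r s char0)) -Wsym_winv //.
apply: (linear_predZ (linear_theta_ideal _)); exists (fun j => Wsym (h' j)) => // j.
exact: Agr_Wsym.
Qed.

(** A basis of A modulo the ideal of the theta, chosen among symmetrised monomials so that its
    members are homogeneous both in total degree and in the degree in z, as lifting requires. *)
Definition lim_free := greedy (@okm r s) (fun m => Wsym 'X_[m]) (theta_ideal n).
Definition lim_index := {m : 'X_{1..r + s} | lim_free m}.
Definition lim_gen (j : lim_index) : B := Wsym 'X_[val j].
Definition lim_mon (k : 'X_{1..r + s} * lim_index) : B := mmap1 theta k.1 * lim_gen k.2.

Lemma Agr_gen j : Agr (lim_gen j).
Proof. by apply: Agr_Wsym; apply: MgrX; case/andP: (valP j). Qed.

Lemma lim_mon_free l c : uniq l -> \sum_(k <- l) c k *: lim_mon k = 0 ->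
  forall k, k \in l -> c k = 0.
Proof.
move=> ul s0; apply: (@free_over_regular K B n theta Agr theta_ideal lim_index lim_gen
  _ linear_theta_ideal _ theta_ideal_mul (fun k f _ => @theta_ideal_le k f)
  theta_ideal_reg Agr_gen _ l c ul).
- exact: linear_Agr.
- by move=> i f; apply: AgrM; apply: Agr_theta.
- move=> l' c' ul' Is j jl'.
  pose c2 m := oapp c' 0 (insub m : option lim_index).
  have := @free_greedy K B _ (@okm r s) (fun m => Wsym 'X_[m])
    (theta_ideal n) (map val l') c2.
  have -> : c' j = c2 (val j) by rewrite /c2 valK.
  apply; first by rewrite (map_inj_uniq val_inj).
  - by move=> _ /mapP[i _ ->]; apply: (valP i).
  - rewrite big_map; move: Is; congr (theta_ideal _ _); apply: eq_bigr => i _.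
    by rewrite /c2 valK.
  - exact: map_f.
- by rewrite s0; apply: linear_pred0 (linear_theta_ideal 0).
Qed.

Lemma Agr_span f (L : B -> Prop) : linear_pred L -> Agr f ->
  (forall m, okm m -> L (Wsym 'X_[m])) -> L f.
Proof.
move=> linL [Mf If] LX.
rewrite -[f](scalerK (Worder_neq0 r s char0)) -Wsym_winv //.
apply: linear_predZ => //; apply: (Mgr_ind (P := fun f => L (Wsym f)) _ LX Mf).
split=> [|k u v Lu Lv]; last by rewrite Wsym_linear; apply: linear_pred2.
by rewrite /Wsym big1 => [|w _]; [apply: linear_pred0 | rewrite msym0].
Qed.

Lemma Wsym_homog (mf : measure n) d (f : B) :
  (forall w (m : 'X_{1..n}), blk w -> mf (m#w) = mf m) -> f \is d.-homog for mf ->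
  Wsym f \is d.-homog for mf.
Proof.
move=> mfw /dhomogP hf; apply: rpred_sum => w bw; apply/dhomogP => m.
by rewrite mcoeff_msupp mcoeff_sym -mcoeff_msupp => /hf; rewrite mfw.
Qed.

Lemma mdeg_mperm (w : 'S_n) (m : 'X_{1..n}) : mdeg (m#w) = mdeg m.
Proof.
rewrite !mdegE [RHS](reindex_inj (@perm_inj _ w)) /=.
by apply: eq_bigr => i _; rewrite mnmE.
Qed.

Definition lim_deg (k : 'X_{1..r + s} * lim_index) : nat :=
  (\sum_i k.1 i * tdeg i + mdeg (val k.2))%N.
Definition lim_zdeg (k : 'X_{1..r + s} * lim_index) : nat :=
  (\sum_i k.1 i * tzdeg i + zdeg (val k.2))%N.

(** Induction on D, as in graded Nakayama: modulo the ideal of the theta, f is a combination of the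
    [lim_gen], and the cofactors of the theta have smaller degree because [tdeg] is positive.
    Applying L after the projection to degree D discards all other components. *)
Lemma lim_mon_span D f (L : B -> Prop) : linear_pred L -> Agr f -> f \is D.-homog ->
  (forall k, lim_deg k = D -> L (lim_mon k)) -> L f.
Proof.
elim/ltn_ind: D f L => D IHD f L linL Af hf LD.
have linD : linear_pred (fun u => L (pihomog mdeg D u)).
  split=> [|b u v Lu Lv]; first by rewrite pihomog0; apply: linear_pred0.
  by rewrite linearP; apply: linear_pred2.
suff : span_mod (fun m => Wsym 'X_[m]) (theta_ideal n) lim_free f.
  move=> /(_ _ linD); rewrite pihomog_dE //; apply.
    move=> _ [h Ah ->]; rewrite raddf_sum /=; apply: linear_pred_sum => // i _ _.
    rewrite mulrC (pihomogM _ _ (theta_homog i)); case: leqP => [di|_]; last exact: linear_pred0.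
    apply: (IHD (D - tdeg i)%N _ (pihomog mdeg (D - tdeg i) (h i)) (fun u => L (u * theta i))).
    - by rewrite ltn_subrL tdeg_gt0 (leq_trans (tdeg_gt0 i)).
    - split=> [|b u v Lu Lv]; first by rewrite mul0r; apply: linear_pred0.
      by rewrite mulrDl -scalerAl; apply: linear_pred2.
    - exact: Agr_pihomog.
    - exact: pihomogP.
    - move=> k dk; have := LD ((U_(i) + k.1)%MM, k.2); rewrite /lim_mon /= mmap1_add.
      rewrite mmap1U -mulrA mulrC; apply.
      rewrite -[RHS](subnKC di) -dk /lim_deg /=.
      under eq_bigr => j _ do rewrite mnmDE mulnDl.
      rewrite big_split /= addnA; congr (_ + _ + _)%N.
      rewrite (bigD1 i) //= mnm1E eqxx mul1n big1 ?addn0 // => j ji.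
      by rewrite mnm1E eq_sym (negbTE ji).
  move=> m lm; pose j : lim_index := exist _ m lm.
  have hm : Wsym 'X_[m] \is (mdeg m).-homog.
    by apply: Wsym_homog => [w m' _|]; [apply: mdeg_mperm | rewrite dhomogX].
  have [e|nD] := eqVneq (mdeg m) D; last first.
    by rewrite (pihomog_ne0 nD hm); apply: linear_pred0.
  rewrite pihomog_dE -?e //; have := LD (0%MM, j); rewrite /lim_mon /= mmap11 mul1r.
  apply; rewrite /lim_deg /= -e big1 // => i _; rewrite mnm0E.
  by [].
apply: span_greedy => L' linL' NL' vL'; exact: Agr_span.
Qed.

(** Exponents of degree at most D suffice, because every theta has positive degree. *)
Definition lim_keys (D : nat) : seq ('X_{1..r + s} * lim_index) :=
  let mons := [seq bmnm m | m <- enum {: 'X_{1..n < D.+1}}] in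
  [seq k <- [seq (a, j) | a <- mons, j <- pmap insub mons] | lim_deg k == D].

Lemma lim_keys_uniq D : uniq (lim_keys D).
Proof.
have um : uniq [seq bmnm m | m <- enum {: 'X_{1..n < D.+1}}].
  by rewrite map_inj_uniq ?enum_uniq // => m m'; apply: val_inj.
by apply/filter_uniq/allpairs_uniq => //; [apply: pmap_sub_uniq | move=> [] ? ? [] ? ?].
Qed.

Lemma mem_lim_keys D k : (k \in lim_keys D) = (lim_deg k == D).
Proof.
rewrite mem_filter; case: eqP => // <- /=; case: k => a j.
have mem m : (mdeg m < (lim_deg (a, j)).+1)%N ->
    m \in [seq bmnm m | m <- enum {: 'X_{1..n < (lim_deg (a, j)).+1}}].
  by move=> hm; apply/mapP; exists (BMultinom hm) => //; rewrite mem_enum.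
apply: allpairs_f; last first.
  by rewrite mem_pmap_sub; apply: mem; rewrite ltnS /lim_deg leq_addl.
apply: mem; rewrite ltnS /lim_deg /= (leq_trans _ (leq_addr _ _)) // mdegE.
by apply: leq_sum => i _; apply: leq_pmulr; apply: tdeg_gt0.
Qed.

End LimitBasis.

(** * Counting sorted monomials *)

Section FormalPowerSeries.
Implicit Types (p q : {poly int}) (G : fps).

Lemma fps_mul_poly p G n m : (m <= n)%N ->
  fps_mul (fps_of_poly p) G m = (p * \poly_(i < n.+1) G i)`_m.
Proof.
move=> mn; rewrite coefM; apply: eq_bigr => i _.
by rewrite coef_poly ltnS (leq_trans (leq_subr _ _) mn).
Qed.

Lemma fps_mulA p q G :
  fps_mul (fps_of_poly (p * q)) G =1 fps_mul (fps_of_poly p) (fps_mul (fps_of_poly q) G).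
Proof.
move=> n; rewrite (fps_mul_poly _ _ (leqnn n)) -mulrA coefM; apply: eq_bigr => i _.
by rewrite -fps_mul_poly ?leq_subr.
Qed.

Lemma fps_inv_unique p G : p`_0 = 1 ->
  fps_mul (fps_of_poly p) G =1 fps_of_poly 1 -> G =1 fps_inv p.
Proof.
move=> p0 e n; elim/ltn_ind: n => n IHn.
have := e n; rewrite -(fps_mulV p0 n) /fps_mul !big_ord_recl /fps_of_poly p0 !mul1r subn0.
have -> : \sum_(i < n) p`_(lift ord0 i) * G (n - lift ord0 i)%N =
    \sum_(i < n) p`_(lift ord0 i) * fps_inv p (n - lift ord0 i)%N.
  apply: eq_bigr => i _; rewrite IHn // lift0.
  by have := ltn_ord i; lia.
exact: addIr.
Qed.

Lemma fps_mul_Xn k G d :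
  fps_mul (fps_of_poly 'X^k) G d = if (k <= d)%N then G (d - k)%N else 0.
Proof.
rewrite (fps_mul_poly _ _ (leqnn d)) coefXnM; case: (leqP k d) => // kd.
by rewrite coef_poly ltnS leq_subr.
Qed.

Lemma qpoch_coef0 m : (qpoch m)`_0 = 1.
Proof.
rewrite -horner_coef0 /qpoch horner_prod big_nat big1 // => i /andP[i0 _].
by rewrite hornerD hornerN hornerXn hornerC expr0n; case: i i0 => //= i _; rewrite subr0.
Qed.

Lemma fps_inv_qpoch0 d : fps_inv (qpoch 0) d = (d == 0%N)%:R.
Proof.
have := fps_mulV (qpoch_coef0 0) d; rewrite /qpoch big_geq // /fps_of_poly coef1 => <-.
by rewrite -/(fps_of_poly 1) (fps_mul_poly _ _ (leqnn d)) mul1r coef_poly ltnSn.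
Qed.

(** The recurrence of partitions into at most r + 1 parts: the last part is zero, or all parts can
    be lowered by 1. *)
Lemma fps_inv_qpochS r d : fps_inv (qpoch r.+1) d =
  fps_inv (qpoch r) d + (if (r < d)%N then fps_inv (qpoch r.+1) (d - r.+1)%N else 0).
Proof.
set G := fps_inv (qpoch r.+1).
have <- : fps_mul (fps_of_poly (1 - 'X^(r.+1))) G d = fps_inv (qpoch r) d.
  apply: fps_inv_unique; first exact: qpoch_coef0.
  move=> n; rewrite -fps_mulA.
  have -> : qpoch r * (1 - 'X^(r.+1)) = qpoch r.+1 by rewrite /qpoch [RHS]big_nat_recr.
  exact: (fps_mulV (qpoch_coef0 _)).
rewrite (fps_mul_poly _ _ (leqnn d)) mulrBl mul1r coefB coef_poly ltnSn coefXnM.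
by case: ltnP => rd; rewrite ?subr0 ?addr0 // coef_poly ltnS leq_subr subrK.
Qed.

End FormalPowerSeries.

Section Partitions.

(* For e = 0 the last condition is vacuous. *)
Definition partition_of (e k d : nat) (x : seq nat) : bool :=
  [&& size x == k, sorted geq x, sumn x == d & all (fun a => (a == 0%N) || (e < a)%N) x].

Lemma path_geq_last a x : path geq a x -> all (leq (last a x)) (a :: x).
Proof.
elim: x a => [|b x IHx] a /=; first by rewrite leqnn.
move=> /andP[ab /IHx /= /andP[lb lx]]; rewrite lb lx !andbT.
exact: leq_trans lb ab.
Qed.

Lemma sorted_rcons0 x : sorted geq (rcons x 0%N) = sorted geq x.
Proof. by case: x => //= a x; rewrite rcons_path /= leq0n andbT. Qed.

Lemma sorted_addn e x : sorted geq [seq (e + a)%N | a <- x] = sorted geq x.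
Proof. by rewrite sorted_map; apply: eq_sorted => a b; rewrite /= leq_add2l. Qed.

Lemma sumn_addn e x : sumn [seq (e + a)%N | a <- x] = (e * size x + sumn x)%N.
Proof. by elim: x => [|a x /= ->]; rewrite ?muln0 //= mulnS; lia. Qed.

(** A nonincreasing sequence with parts zero or above e either ends in 0 or has all parts above e.
    In the second case lowering each part by e + 1 leaves an arbitrary partition, which explains the
    0 in the condition on l2. *)
Lemma partition_step e k d (l1 l2 : seq (seq nat)) :
  uniq l1 -> uniq l2 -> (forall x, (x \in l1) = partition_of e k d x) ->
  (forall x, (x \in l2) =
     (e.+1 * k.+1 <= d)%N && partition_of 0 k.+1 (d - e.+1 * k.+1) x) ->
  let l := [seq rcons x 0%N | x <- l1] ++ [seq [seq (e.+1 + a)%N | a <- x] | x <- l2] in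
  uniq l /\ forall x, (x \in l) = partition_of e k.+1 d x.
Proof.
move=> u1 u2 m1 m2 l; split=> [|x].
  rewrite cat_uniq !map_inj_uniq ?u1 ?u2 //.
  - rewrite andbT; apply/hasPn => _ /mapP[y _ ->]; apply/negP => /mapP[z _ e'].
    have : 0%N \in rcons z 0%N by rewrite mem_rcons mem_head.
    by rewrite -e' => /mapP[a _]; lia.
  - by apply: inj_map => a b /addnI.
  - by move=> y z /rcons_inj[].
rewrite mem_cat; apply/orP/idP => [[/mapP[y yl ->]|/mapP[y yl ->]]|].
- move: yl; rewrite m1 /partition_of => /and4P[sy oy dy ey].
  by rewrite size_rcons eqSS sy sorted_rcons0 oy sumn_rcons addn0 dy all_rcons /= ey.
- move: yl; rewrite m2 /partition_of => /andP[le /and4P[/eqP sy oy /eqP dy _]].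
  rewrite size_map sy eqxx sorted_addn oy sumn_addn sy dy subnKC // eqxx /=.
  by apply/allP => _ /mapP[a _ ->]; apply/orP; right; lia.
rewrite /partition_of => /and4P[/eqP sx ox /eqP dx ex].
case/lastP: x sx ox dx ex => [//|x a]; rewrite size_rcons => -[sx] ox dx ex.
have [a0|a0] := eqVneq a 0%N.
  left; rewrite a0 in ox dx ex *; apply: map_f; rewrite m1 /partition_of.
  move: ex; rewrite all_rcons => /andP[_ ->]; move: ox dx.
  by rewrite sorted_rcons0 sumn_rcons addn0 => -> ->; rewrite sx !eqxx.
right; set y := rcons x a.
have ae : (e < a)%N by move: ex; rewrite all_rcons (negbTE a0) => /andP[].
have ey b : b \in y -> (e.+1 <= b)%N.
  move=> yb; apply: leq_trans ae _; move: ox yb; rewrite /y; case: x {y sx dx ex} => [|c x].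
    by rewrite /= inE => _ /eqP ->.
  by rewrite rcons_cons /= => /path_geq_last; rewrite last_rcons => /allP h /h.
have -> : y = [seq (e.+1 + b)%N | b <- [seq (b - e.+1)%N | b <- y]].
  by rewrite -map_comp -[LHS]map_id; apply/eq_in_map => b /ey /= h; rewrite subnKC.
set y' := [seq (b - e.+1)%N | b <- y]; have yy' : y = [seq (e.+1 + b)%N | b <- y'].
  by rewrite -map_comp -[LHS]map_id; apply/eq_in_map => b /ey /= h; rewrite subnKC.
have sy' : size y' = k.+1 by rewrite size_map size_rcons sx.
have dy : (e.+1 * k.+1 + sumn y')%N = d by rewrite -sy' -sumn_addn -yy'.
apply: map_f; rewrite m2 /partition_of -dy leq_addr addKn sy' !eqxx /=.
rewrite -(sorted_addn e.+1) -yy' ox /=; apply/allP => b _.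
by rewrite lt0n orbN.
Qed.

Lemma enum_partitions r d : exists l : seq (seq nat),
  [/\ uniq l, (forall x, (x \in l) = partition_of 0 r d x) & (size l)%:Z = fps_inv (qpoch r) d].
Proof.
elim: r d => [|r IHr] d.
  rewrite fps_inv_qpoch0; case: d => [|d].
    by exists [:: [::]]; split=> // -[|a x].
  by exists [::]; split=> // -[|a x].
elim/ltn_ind: d => d IHd; have [l1 [u1 m1 s1]] := IHr d.
have [l2 [u2 m2 s2]] : exists l : seq (seq nat), [/\ uniq l,
    (forall x, (x \in l) = (1 * r.+1 <= d)%N && partition_of 0 r.+1 (d - 1 * r.+1) x) &
    (size l)%:Z = if (r < d)%N then fps_inv (qpoch r.+1) (d - r.+1)%N else 0].
  rewrite mul1n; case: ltnP => rd; last by exists [::].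
  by apply: IHd; lia.
have [ul ml] := partition_step u1 u2 m1 m2.
eexists; split; [exact: ul|exact: ml|].
by rewrite size_cat !size_map PoszD s1 s2 -fps_inv_qpochS.
Qed.

(** The i-th summand counts the sequences with exactly i nonzero parts: subtracting e + 1 from each
    of them leaves a partition into at most i parts. *)
Lemma enum_gap_partitions e k d : exists l : seq (seq nat),
  [/\ uniq l, (forall x, (x \in l) = partition_of e k d x) &
    (size l)%:Z = \sum_(i < k.+1) fps_mul (fps_of_poly 'X^(i * e.+1)) (fps_inv (qpoch i)) d].
Proof.
elim: k d => [|k IHk] d.
  rewrite big_ord1 mul0n fps_mul_Xn subn0 fps_inv_qpoch0; case: d => [|d].
    by exists [:: [::]]; split=> // -[|a x].
  by exists [::]; split=> // -[|a x].
have [l1 [u1 m1 s1]] := IHk d.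
have [l2 [u2 m2 s2]] : exists l : seq (seq nat), [/\ uniq l,
    (forall x, (x \in l) = (e.+1 * k.+1 <= d)%N && partition_of 0 k.+1 (d - e.+1 * k.+1) x) &
    (size l)%:Z = fps_mul (fps_of_poly 'X^(k.+1 * e.+1)) (fps_inv (qpoch k.+1)) d].
  rewrite fps_mul_Xn [(k.+1 * _)%N]mulnC; case: (leqP (e.+1 * k.+1) d) => rd; last by exists [::].
  exact: enum_partitions.
have [ul ml] := partition_step u1 u2 m1 m2.
eexists; split; [exact: ul|exact: ml|].
by rewrite size_cat !size_map PoszD s1 s2 [RHS]big_ord_recr.
Qed.

End Partitions.

Lemma uniq_flatten_fibres (S T : eqType) (t : S -> seq T) (key : T -> S) (l : seq S) :
  uniq l -> (forall a, uniq (t a)) -> (forall a x, x \in t a -> key x = a) ->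
  uniq (flatten (map t l)).
Proof.
move=> + ut kt; elim: l => //= a l IHl /andP[al ul].
rewrite cat_uniq ut IHl // andbT; apply/hasPn => x /flatten_mapP[b bl xb].
by apply: contra al => /kt <-; rewrite (kt _ _ xb).
Qed.

Section SortedMonomials.
Variables (r s : nat).
Local Notation n := (r + s)%N.

(** Representatives of the orbits of monomials under S_r x S_s. *)
Definition blk_sorted (m : 'X_{1..r + s}) : bool :=
  [forall i : 'I_n, forall j : 'I_n, ((i <= j)%N && ((i < r)%N == (j < r)%N)) ==> (m j <= m i)%N].

Definition monom_of_seq (x : seq nat) : 'X_{1..r + s} := [multinom nth 0%N x i | i < r + s].

Lemma monom_of_seqK (m : 'X_{1..n}) : monom_of_seq [seq m i | i <- enum 'I_n] = m.
Proof.
apply/mnmP => i; rewrite mnmE (nth_map i) ?nth_ord_enum // size_enum_ord.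
exact: ltn_ord.
Qed.

Lemma monom_of_seq_inj x y : size x = n -> size y = n -> monom_of_seq x = monom_of_seq y ->
  x = y.
Proof.
move=> sx sy e; apply: (@eq_from_nth _ 0%N) => [|i ilt]; first by rewrite sx.
rewrite sx in ilt; move/mnmP: e => /(_ (Ordinal ilt)).
by rewrite !mnmE.
Qed.

Lemma sorted_geqP (x : seq nat) : reflect
  (forall i j, (i <= j < size x)%N -> (nth 0 x j <= nth 0 x i)%N) (sorted geq x).
Proof.
have tr : transitive geq by move=> a b c /= h1 h2; apply: leq_trans h2 h1.
apply: (iffP idP) => [sx i j /andP[ij jx]|h].
  apply: (@sorted_leq_nth _ geq tr leqnn 0%N x sx) => //; rewrite inE //.
  exact: leq_ltn_trans ij jx.
by apply/(sortedP 0%N) => i ix; apply: h; rewrite leqnSn.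
Qed.

Lemma monom_of_catE x y D : size x = r -> size y = s ->
  [&& okm (monom_of_seq (x ++ y)), mdeg (monom_of_seq (x ++ y)) == D &
      blk_sorted (monom_of_seq (x ++ y))] =
  (sumn x <= D)%N && (partition_of 0 r (sumn x) x && partition_of r s (D - sumn x) y).
Proof.
move=> sx sy; set m := monom_of_seq _.
have mE i : m i = if (i < r)%N then nth 0%N x i else nth 0%N y (i - r).
  by rewrite mnmE nth_cat sx.
have dm : mdeg m = (sumn x + sumn y)%N.
  rewrite -sumn_cat mdegE sumnE (big_nth 0%N) size_cat sx sy big_mkord.
  by apply: eq_bigr => i _; rewrite mnmE.
have okE : okm m = all (fun a => (a == 0%N) || (r < a)%N) y.
  apply/forallP/(all_nthP 0%N) => [h j|h i].
    rewrite sy => js; have jn : (r + j < n)%N by rewrite ltn_add2l.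
    by have := h (Ordinal jn); rewrite mE /ok_exp /= ltnNge leq_addr /= addKn.
  rewrite mE /ok_exp; case: ltnP => //= ri; apply: h.
  by rewrite sy; have := ltn_ord i; lia.
have srt : blk_sorted m = sorted geq x && sorted geq y.
  apply/forallP/andP => [h|[/sorted_geqP hx /sorted_geqP hy] i].
    split; apply/sorted_geqP => i j /andP[ij].
      rewrite sx => jr; have ir := leq_ltn_trans ij jr.
      have := forallP (h (Ordinal (ltn_addr s ir))) (Ordinal (ltn_addr s jr)).
      by rewrite !mE /= ij ir jr.
    rewrite sy => js; have is' := leq_ltn_trans ij js.
    have ilt : (r + i < n)%N by rewrite ltn_add2l.
    have jlt : (r + j < n)%N by rewrite ltn_add2l.
    have := forallP (h (Ordinal ilt)) (Ordinal jlt).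
    by rewrite !mE /= leq_add2l ij ltnNge leq_addr ltnNge leq_addr /= !addKn.
  apply/forallP => j; apply/implyP => /andP[ij /eqP b]; rewrite !mE -b.
  have := ltn_ord j; case: (ltnP i r) => ir jn.
    by apply: hx; rewrite ij sx -b.
  by apply: hy; rewrite sy; lia.
rewrite okE dm srt /partition_of sx sy !eqxx /=.
have -> : all (fun a => (a == 0%N) || (0 < a)%N) x.
  by apply/allP => a _; rewrite lt0n orbN.
rewrite andbT; case: (leqP (sumn x) D) => xD.
  rewrite -(eqn_add2l (sumn x) _ (D - _)) subnKC // andbCA /=.
  by case: (_ == D); case: (sorted _ x); case: (sorted _ y); case: (all _ y).
by case: eqP => [e|_]; rewrite ?andbF // -e in xD *; lia.
Qed.

(** The exponents of y form a partition into at most r parts, those of z a partition whose nonzero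
    parts exceed r. The two are chosen independently, hence the product of series. *)
Lemma enum_sorted D : exists l : seq 'X_{1..r + s},
  [/\ uniq l, (forall m, (m \in l) = [&& okm m, mdeg m == D & blk_sorted m]) &
      (size l)%:Z = hilb_rs r s D].
Proof.
have [ly hy] := boolp.choice (enum_partitions r).
have [lz hz] := boolp.choice (enum_gap_partitions r s).
pose t a := [seq x ++ y | x <- ly a, y <- lz (D - a)%N].
have tP a x : x \in t a -> exists y z, [/\ x = y ++ z, partition_of 0 r a y
    & partition_of r s (D - a) z].
  case: (hy a) => _ my _; case: (hz (D - a)%N) => _ mz _.
  by move=> /allpairsP[[y z] /= []]; rewrite my mz => ? ? ->; exists y, z.
have tu a : uniq (t a).
  case: (hy a) => uy my _; case: (hz (D - a)%N) => uz mz _.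
  apply: allpairs_uniq => // -[x y] [x' y'] /allpairsP[[? ?] /= [h1 h2 [-> ->]]].
  move=> /allpairsP[[? ?] /= [h3 h4 [-> ->]]] /= /eqP.
  rewrite eqseq_cat; first by case/andP => /eqP -> /eqP ->.
  by move: h1 h3; rewrite !my => /and4P[/eqP -> _ _ _] /and4P[/eqP -> _ _ _].
have tk a x : x \in t a -> sumn (take r x) = a.
  move=> /tP[y [z [-> /and4P[/eqP sy _ /eqP dy _] _]]].
  by rewrite take_cat sy ltnn subnn take0 cats0.
have ts a x : x \in t a -> size x = n.
  by move=> /tP[y [z [-> /andP[/eqP sy _] /andP[/eqP sz _]]]]; rewrite size_cat sy sz.
pose l0 := flatten (map t (iota 0 D.+1)).
have u0 : uniq l0.
  exact: (@uniq_flatten_fibres _ _ t (fun x => sumn (take r x)) (iota 0 D.+1) (iota_uniq _ _)).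
exists (map monom_of_seq l0); split.
- rewrite map_inj_in_uniq // => x y /flatten_mapP[a _ /ts sx] /flatten_mapP[b _ /ts sy].
  exact: monom_of_seq_inj.
- move=> m; apply/mapP/idP => [[x /flatten_mapP[a aD xa] ->]|].
    rewrite mem_iota /= add0n ltnS in aD.
    have [y [z [-> py pz]]] := tP a x xa.
    have [/andP[/eqP sy _] /andP[/eqP sz _]] := (py, pz).
    have dy : sumn y = a by case/and4P: py => _ _ /eqP.
    by rewrite monom_of_catE // dy py pz aD.
  set x := [seq m i | i <- enum 'I_n] => hm; exists x; last by rewrite monom_of_seqK.
  have sx : size x = n by rewrite size_map size_enum_ord.
  have st : size (take r x) = r by rewrite size_takel // sx leq_addr.
  have sd : size (drop r x) = s by rewrite size_drop sx addKn.
  move: hm; rewrite -{1 2 3}(monom_of_seqK m) -/x -{1 2 3}(cat_take_drop r x) monom_of_catE //.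
  case/andP => le /andP[py pz]; apply/flatten_mapP; exists (sumn (take r x)).
    by rewrite mem_iota /= add0n ltnS.
  rewrite -{1}(cat_take_drop r x); apply: allpairs_f.
    by case: (hy (sumn (take r x))) => _ ->.
  by case: (hz (D - sumn (take r x))%N) => _ ->.
rewrite size_map /l0 size_flatten /shape -map_comp sumnE big_map /hilb_rs /fps_mul.
pose F a := fps_inv (qpoch r) a * \sum_(i < s.+1)
  fps_mul (fps_of_poly 'X^(i * r.+1)) (fps_inv (qpoch i)) (D - a)%N.
rewrite (big_morph Posz PoszD (erefl _)) -[RHS]/(\sum_(i < D.+1) F i).
rewrite -(big_mkord xpredT F) /index_iota subn0.
apply: eq_bigr => a _ /=; rewrite size_allpairs PoszM.
by case: (hy a) => _ _ ->; case: (hz (D - a)%N) => _ _ ->.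
Qed.

(** A block permutation minimising the sum of the i * m (w i) has no inversion inside a block: a
    transposition would lower the sum. *)
Lemma exists_sorted (m : 'X_{1..n}) : exists2 w : 'S_n, blk w &
  blk_sorted [multinom m (w i) | i < n].
Proof.
pose pot (w : 'S_n) := (\sum_(i < n) i * m (w i))%N.
have [w bw wmin] : exists2 w, blk w & forall w', blk w' -> (pot w <= pot w')%N.
  by case: (@arg_minnP _ 1%g (@blk r s) pot (blk1 r s)) => w bw h; exists w.
exists w => //; apply/forallP => i; apply/forallP => j; apply/implyP => /andP[ij /eqP b].
rewrite !mnmE leqNgt; apply/negP => mij.
have nij : i != j by apply/negP => /eqP e; rewrite e ltnn in mij.
have bt : blk (tperm i j * w)%g by rewrite blkM // blk_tperm.
have := wmin _ bt; rewrite /pot (bigD1 i) // [in leqRHS](bigD1 i) //=.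
rewrite (bigD1 j) ?(eq_sym j) // [in leqRHS](bigD1 j) ?(eq_sym j) //= !permM tpermL tpermR.
have -> : (\sum_(k < n | (k != i) && (k != j)) k * m ((tperm i j * w)%g k) =
           \sum_(k < n | (k != i) && (k != j)) k * m (w k))%N.
  by apply: eq_bigr => k /andP[ki kj]; rewrite permM tpermD // eq_sym.
have lij : (i < j)%N by rewrite ltn_neqAle nij.
have arith k l x y S : (k < l)%N -> (x < y)%N ->
    (k * x + (l * y + S) <= k * y + (l * x + S))%N -> False.
  by move=> /subnKC <- /subnKC <-; nia.
exact: arith lij mij.
Qed.

(** If m (w i) exceeded m i, only places before i in its block could carry values as large as m (w
    i); but w sends every place of the block up to i to such a place, one too many. *)
Lemma sorted_mperm_eq (w : 'S_n) (m : 'X_{1..n}) : blk w -> blk_sorted m ->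
  blk_sorted [multinom m (w i) | i < n] -> [multinom m (w i) | i < n] = m.
Proof.
suff le (w' : 'S_n) (m' : 'X_{1..n}) i : blk w' -> blk_sorted m' ->
    blk_sorted [multinom m' (w' i) | i < n] -> (m' (w' i) <= m' i)%N.
  move=> bw sm smw; apply/mnmP => i; apply/eqP; rewrite eqn_leq mnmE le //=.
  have := le w^-1%g [multinom m (w i) | i < n] i (blkV bw) smw.
  by rewrite !mnmE permKV; apply; congr (is_true (blk_sorted _)): sm;
    apply/mnmP => j; rewrite !mnmE permKV.
move=> bw sm smw; rewrite leqNgt; apply/negP => lt.
pose A := [set j : 'I_n | ((j < r)%N == (i < r)%N) && (m' (w' i) <= m' j)%N].
pose B := [set j : 'I_n | ((j < r)%N == (i < r)%N) && (j < i)%N].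
have AB : A \subset B.
  apply/subsetP => j; rewrite !inE => /andP[ij h]; rewrite ij ltnNge /=; apply/negP => le.
  have := forallP (forallP sm i) j; rewrite le eq_sym ij /= => h'.
  by have := leq_trans h h'; rewrite leqNgt lt.
have BA : i |: B \subset w' @^-1: A.
  apply/subsetP => j; rewrite !inE (blkP _ bw) => /orP[/eqP ->|/andP[ij ji]].
    by rewrite eqxx leqnn.
  have := forallP (forallP smw j) i; rewrite !mnmE (ltnW ji) ij /= => ->.
  by [].
have := leq_trans (subset_leq_card BA) _; rewrite card_preimset; last exact: perm_inj.
move=> /(_ _ (subset_leq_card AB)); rewrite cardsU1 inE ltnn andbF add1n ltnn.
by [].
Qed.

End SortedMonomials.

(** * Lifts from the special point *)

Section BlockPowerSums.
Variables (A : nzRingType) (r s : nat).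

Definition ysum (i : nat) : {mpoly A[r + s]} := \sum_(j < r) 'X_(lshift s j) ^+ i.
Definition zsum (i : nat) : {mpoly A[r + s]} := \sum_(j < s) 'X_(rshift r j) ^+ i.

Lemma big_blocks (V : nmodType) (F : 'I_(r + s) -> V) :
  (\sum_(j < r) F (lshift s j) = \sum_(j < r + s | (j < r)%N) F j) *
  (\sum_(j < s) F (rshift r j) = \sum_(j < r + s | ~~ (j < r)%N) F j).
Proof.
split; rewrite [RHS]big_mkcond big_split_ord /=.
  rewrite [X in _ + X]big1 ?addr0 => [|j _]; last by rewrite ltnNge leq_addr.
  by apply: eq_bigr => j _; rewrite ltn_ord.
rewrite [X in X + _]big1 ?add0r => [|j _]; last by rewrite ltn_ord.
by apply: eq_bigr => j _; rewrite ltnNge leq_addr.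
Qed.

Lemma homog_Xn j i : ('X_j ^+ i : {mpoly A[r + s]}) \is i.-homog.
Proof.
rewrite -[i in i.-homog]mul1n; apply: dhomogMn; rewrite dhomogX; apply/eqP.
exact: mdeg1.
Qed.

Lemma ysum_homog i : ysum i \is i.-homog.
Proof. by apply: rpred_sum => j _; apply: homog_Xn. Qed.

Lemma zsum_homog i : zsum i \is i.-homog.
Proof. by apply: rpred_sum => j _; apply: homog_Xn. Qed.

Lemma zdegU (j : 'I_(r + s)) : zdeg (U_(j) : 'X_{1..r + s}) = ~~ (j < r)%N.
Proof.
rewrite /zdeg; case: (boolP (j < r)%N) => jr /=.
  apply: big1 => k kr; rewrite mnm1E; case: eqP => // e.
  by rewrite -e jr in kr.
rewrite (bigD1 j) //= mnm1E eqxx big1 ?addn0 // => k /andP[_ kj].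
by rewrite mnm1E eq_sym (negbTE kj).
Qed.

Lemma zhomog_Xn (j : 'I_(r + s)) i :
  ('X_j ^+ i : {mpoly A[r + s]}) \is (if (j < r)%N then 0%N else i).-homog for (@zdeg r s).
Proof.
suff : ('X_j ^+ i : {mpoly A[r + s]}) \is ((~~ (j < r)%N) * i)%N.-homog for (@zdeg r s).
  by case: (j < r)%N => /=; rewrite ?mul0n ?mul1n.
by apply: dhomogMn; rewrite dhomogX /= zdegU.
Qed.

Lemma ysum_zhomog i : ysum i \is 0.-homog for (@zdeg r s).
Proof.
apply: rpred_sum => j _; have := zhomog_Xn (lshift s j) i.
by rewrite /= ltn_ord.
Qed.

Lemma zsum_zhomog i : zsum i \is i.-homog for (@zdeg r s).
Proof.
apply: rpred_sum => j _; have := zhomog_Xn (rshift r j) i.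
by rewrite /= ltnNge leq_addr.
Qed.

End BlockPowerSums.

Section LowOrder.
Variables (K : fieldType) (r s : nat).
Local Notation n := (r + s)%N.
Local Notation B := {mpoly K[r + s]}.

Definition zlt (e : nat) (f : B) := forall m, f@_m != 0 -> (zdeg m < e)%N.

Lemma linear_zlt e : linear_pred (zlt e).
Proof.
split=> [m|k u v hu hv m]; first by rewrite mcoeff0 eqxx.
rewrite mcoeffD mcoeffZ; case: (eqVneq u@_m 0) => [->|/hu //].
by rewrite mulr0 add0r; apply: hv.
Qed.

Lemma zlt0 e : zlt e 0. Proof. exact: linear_pred0 (linear_zlt e). Qed.

Lemma zlt_le e e' f : (e <= e')%N -> zlt e f -> zlt e' f.
Proof. by move=> le hf m /hf h; apply: leq_trans h le. Qed.

Lemma zlt_homog e f : f \is e.-homog for (@zdeg r s) -> zlt e.+1 f.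
Proof. by move=> /dhomogP hf m; rewrite -mcoeff_msupp => /hf ->. Qed.

Lemma zltM e1 e2 f g : zlt e1.+1 f -> zlt e2 g -> zlt (e1 + e2) (f * g).
Proof.
move=> hf hg; rewrite [f]mpolyE [g]mpolyE mulr_suml.
apply: (linear_pred_sum (linear_zlt _)) => m mf _; rewrite -scalerAl.
apply: (linear_predZ (linear_zlt _)); rewrite mulr_sumr.
apply: (linear_pred_sum (linear_zlt _)) => m' mg _; rewrite -scalerAr.
apply: (linear_predZ (linear_zlt _)); rewrite -mpolyXD => m0; rewrite mcoeffX.
case: ((m + m')%MM =P m0) => [<- _|_]; last by rewrite eqxx.
rewrite zdegD -addnS leq_add //; first by have := hf m; rewrite -mcoeff_msupp => /(_ mf).
by apply: hg; rewrite -mcoeff_msupp.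
Qed.

End LowOrder.

Section Lifts.
Variables (K : fieldType) (r s : nat) (c : K).
Local Notation n := (r + s)%N.
Local Notation B := {mpoly K[r + s]}.
Local Notation S := {mpoly K[2]}.
Local Notation V := {mpoly {mpoly K[2]}[r + s]}.
Hypothesis char0 : forall m, (m.+1%:R : K) != 0.
Hypothesis c_neq0 : c != 0.
Local Notation zlt := (@zlt K r s).
Local Notation zhomog e f := (f \is e.-homog for (@zdeg r s)).

Definition pt (q t : K) : 'I_2 -> K := tnth [tuple q; t].
(** Specialisation of a family whose coefficients are polynomials in q, t. It makes sense at v0 =
    (0, 1), although a_i has a pole at t = 1. *)
Definition ev (v : 'I_2 -> K) : {rmorphism V -> B} := map_mpoly (meval v).
Definition v0 := pt 0 1.
Definition vq : S := 'X_ord0.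
Definition vt : S := 'X_ord_max.

Lemma ev_vq q t : vq.@[pt q t] = q. Proof. by rewrite /vq mevalXU. Qed.
Lemma ev_vt q t : vt.@[pt q t] = t. Proof. by rewrite /vt mevalXU. Qed.

Lemma evZ v a X : ev v (a *: X) = a.@[v] *: ev v X.
Proof. exact: map_mpolyZ. Qed.

Lemma ev_mcoeff v X m : (ev v X)@_m = (X@_m).@[v].
Proof. exact: mcoeff_map_mpoly. Qed.

Lemma evXU v j : ev v 'X_j = 'X_j.
Proof. exact: map_mpolyX. Qed.

Lemma ev_ysum v i : ev v (ysum _ r s i) = ysum _ r s i.
Proof. by rewrite rmorph_sum; apply: eq_bigr => j _; rewrite rmorphXn /= evXU. Qed.

Lemma ev_zsum v i : ev v (zsum _ r s i) = zsum _ r s i.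
Proof. by rewrite rmorph_sum; apply: eq_bigr => j _; rewrite rmorphXn /= evXU. Qed.

Definition LamF (X : V) := forall q t, not_root_of_unity q -> not_root_of_unity t ->
  Lam r s (a_seq c q t) (ev (pt q t) X).

Lemma LamF1 : LamF 1.
Proof. by move=> q t _ _; rewrite rmorph1; apply: Lam1. Qed.

Lemma LamFM X Y : LamF X -> LamF Y -> LamF (X * Y).
Proof. by move=> hX hY q t hq ht; rewrite rmorphM; apply: LamM; [apply: hX | apply: hY]. Qed.

Lemma LamFZ a X : LamF X -> LamF (a *: X).
Proof.
by move=> hX q t hq ht; rewrite evZ; apply: (linear_predZ (linear_Lam _ _ _)); apply: hX.
Qed.

Lemma LamFD X Y : LamF X -> LamF Y -> LamF (X + Y).
Proof.
move=> hX hY q t hq ht; rewrite rmorphD.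
by apply: (linear_predD (linear_Lam _ _ _)); [apply: hX | apply: hY].
Qed.

(** Q_i times 1 - t^i, which is polynomial in q, t. At v0 it is -c^i times the power sum of y. *)
Definition Phat (i : nat) : V :=
  ((vq ^+ i - 1) * (c ^+ i)%:MP) *: ysum _ r s i + (1 - vt ^+ i) *: zsum _ r s i.

Lemma ev_Phat q t i : ev (pt q t) (Phat i) =
  ((q ^+ i - 1) * c ^+ i) *: ysum _ r s i + (1 - t ^+ i) *: zsum _ r s i.
Proof.
rewrite /Phat rmorphD !evZ ev_ysum ev_zsum rmorphM !rmorphB !rmorphXn /= !rmorph1.
by rewrite mevalC ev_vq ev_vt.
Qed.

Lemma LamF_Phat i : (0 < i)%N -> LamF (Phat i).
Proof.
move=> i0 q t hq ht; rewrite ev_Phat.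
have t1 : 1 - t ^+ i != 0 by rewrite subr_eq0 eq_sym ht.
have -> : ((q ^+ i - 1) * c ^+ i) *: ysum _ r s i + (1 - t ^+ i) *: zsum _ r s i =
    (1 - t ^+ i) *: gpsum r s (a_seq c q t) i.
  rewrite /gpsum scalerDr scalerA; congr (_ *: _ + _).
  by rewrite /a_seq [RHS]mulrC -mulrA divfK // mulrC.
by apply: (linear_predZ (linear_Lam _ _ _)); apply: Lam_gpsum.
Qed.

Lemma Phat_homog i : Phat i \is i.-homog.
Proof. by rewrite rpredD // rpredZ // ?ysum_homog ?zsum_homog. Qed.

(* As (q, t) tends to (0, 1), the family X in the algebras Lambda tends to f plus
   terms of smaller degree in z. *)
Definition is_lift (D e : nat) (f : B) (X : V) :=
  [/\ X \is D.-homog, LamF X, zhomog e f & zlt e (ev v0 X - f)].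
Definition liftable D e f := exists X, is_lift D e f X.

Lemma is_liftM D1 e1 f1 X1 D2 e2 f2 X2 : is_lift D1 e1 f1 X1 -> is_lift D2 e2 f2 X2 ->
  is_lift (D1 + D2) (e1 + e2) (f1 * f2) (X1 * X2).
Proof.
move=> [h1 L1 z1 l1] [h2 L2 z2 l2]; split; [exact: dhomogM|exact: LamFM|exact: dhomogM|].
have -> : ev v0 (X1 * X2) - f1 * f2 =
    f1 * (ev v0 X2 - f2) + ev v0 X2 * (ev v0 X1 - f1) by rewrite rmorphM /=; ring.
apply: (linear_predD (linear_zlt K r s _)); first exact: zltM (zlt_homog z1) l2.
rewrite addnC; apply: zltM l1; rewrite -[ev v0 X2](subrK f2).
apply: (linear_predD (linear_zlt K r s _)); last exact: zlt_homog.
exact: zlt_le l2.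
Qed.

Lemma is_lift1 : is_lift 0 0 1 1.
Proof.
split; [exact: dhomog1|exact: LamF1|exact: dhomog1|].
by rewrite rmorph1 subrr; apply: zlt0.
Qed.

Lemma is_lift_mmap1 k (D e : 'I_k -> nat) (f : 'I_k -> B) (X : 'I_k -> V) (m : 'X_{1..k}) :
  (forall i, is_lift (D i) (e i) (f i) (X i)) ->
  is_lift (\sum_i m i * D i) (\sum_i m i * e i) (mmap1 f m) (mmap1 X m).
Proof.
move=> h; rewrite /mmap1; elim: (index_enum _) => [|i l IHl].
  by rewrite !big_nil; apply: is_lift1.
rewrite !big_cons; apply: is_liftM IHl; elim: (m i) => [|j IHj]; first exact: is_lift1.
by rewrite !mulSn !exprS; apply: is_liftM.
Qed.

Lemma linear_liftable D e : linear_pred (liftable D e).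
Proof.
split.
  exists 0; split; rewrite ?rpred0 //; last by rewrite rmorph0 subrr; apply: zlt0.
  by move=> q t _ _; rewrite rmorph0; apply: linear_pred0 (linear_Lam _ _ _).
move=> k f1 f2 [X1 [h1 L1 z1 l1]] [X2 [h2 L2 z2 l2]]; exists (k%:MP *: X1 + X2); split.
- by rewrite rpredD ?rpredZ.
- by apply: LamFD => //; apply: LamFZ.
- by rewrite rpredD ?rpredZ.
have -> : ev v0 (k%:MP *: X1 + X2) - (k *: f1 + f2) =
    k *: (ev v0 X1 - f1) + (ev v0 X2 - f2).
  by rewrite rmorphD evZ mevalC /= scalerBr addrACA opprD.
exact: (linear_pred2 (linear_zlt K r s _)).
Qed.

Lemma liftableM D1 e1 f1 D2 e2 f2 : liftable D1 e1 f1 -> liftable D2 e2 f2 ->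
  liftable (D1 + D2) (e1 + e2) (f1 * f2).
Proof. by move=> [X1 h1] [X2 h2]; exists (X1 * X2); apply: is_liftM. Qed.

Lemma liftable_ysum i : (0 < i)%N -> liftable i 0 (ysum _ r s i).
Proof.
move=> i0; have ci : (- c ^+ i) != 0 by rewrite oppr_eq0 expf_neq0.
rewrite -[ysum _ r s i](scalerK ci); apply: (linear_predZ (linear_liftable _ _)).
exists (Phat i); split; [exact: Phat_homog|exact: LamF_Phat| |].
  by rewrite rpredZ // ysum_zhomog.
rewrite ev_Phat expr0n (gtn_eqF i0) /= expr1n subrr scale0r addr0 sub0r mulN1r subrr.
exact: zlt0.
Qed.

Section ZPowerSums.
Variable M : nat.

(** Newton's identities need true power sums, but the factor q^i - 1 in [Phat i] is not an i-th
    power. Scaling by [kap 0 ^+ i.-1 * kap i] turns it into [kap 0 ^+ i], since [kap 0] omits no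
    factor, and so into the i-th power sum of the [wv j]. Nothing is divided by q^i - 1, and the
    scaling is nonzero at q = 0. *)
Definition kap (i : nat) : S := \prod_(1 <= j < M.+1 | j != i) (vq ^+ j - 1).

Lemma kapE i : (0 < i <= M)%N -> kap 0 = (vq ^+ i - 1) * kap i.
Proof.
move=> /andP[i0 iM]; have ii : i \in index_iota 1 M.+1 by rewrite mem_index_iota i0 ltnS.
have -> : kap 0 = \prod_(1 <= j < M.+1) (vq ^+ j - 1).
  rewrite /kap big_nat_cond [RHS]big_nat_cond; apply: eq_bigl => j.
  by case: j => [|j] //=; rewrite andbT.
by rewrite /kap (bigD1_seq i) ?iota_uniq.
Qed.

Lemma kap_neq0 i : (kap i).@[v0] != 0.
Proof.
rewrite /kap rmorph_prod /= big_nat_cond prodf_seq_neq0; apply/allP => j _.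
apply/implyP => /andP[/andP[j0 _] _].
by rewrite rmorphB rmorphXn /= rmorph1 ev_vq expr0n gtn_eqF //= sub0r oppr_eq0 oner_neq0.
Qed.

Definition wv (j : 'I_r) : V := (kap 0 * c%:MP) *: 'X_(lshift s j).
Definition wsum (i : nat) : V := \sum_(j < r) wv j ^+ i.
Definition xhat (i : nat) : V := (kap 0 ^+ i.-1 * kap i) *: Phat i.
Definition bhat (i : nat) : V :=
  ((\sum_(k < i) vt ^+ k) * (kap 0 ^+ i.-1 * kap i)) *: zsum _ r s i.

Lemma wsumE i : wsum i = (kap 0 ^+ i * (c ^+ i)%:MP) *: ysum _ r s i.
Proof.
rewrite /wsum /ysum scaler_sumr; apply: eq_bigr => j _.
by rewrite exprZn exprMn rmorphXn.
Qed.

Lemma xhatE i : (0 < i <= M)%N -> xhat i = wsum i + (1 - vt) *: bhat i.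
Proof.
move=> iM; have [i0 _] := andP iM.
have e : 1 - vt ^+ i = (1 - vt) * \sum_(k < i) vt ^+ k by rewrite -opprB subrX1 -mulNr opprB.
rewrite /xhat /Phat scalerDr; congr (_ + _).
  rewrite [LHS]scalerA wsumE; congr (_ *: _).
  by rewrite mulrA -(mulrA _ (kap i)) [kap i * _]mulrC -(kapE iM) -exprSr prednK.
rewrite [LHS]scalerA [RHS]scalerA; congr (_ *: _).
by rewrite e mulrC -mulrA.
Qed.

Lemma xhat_homog i : xhat i \is i.-homog.
Proof. by rewrite rpredZ // Phat_homog. Qed.

Lemma bhat_homog i : bhat i \is i.-homog.
Proof. by rewrite rpredZ // zsum_homog. Qed.

Lemma LamF_xhat i : (0 < i)%N -> LamF (xhat i).
Proof. by move=> i0; apply/LamFZ/LamF_Phat. Qed.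

(* Y is the value at t = 1 of a family X in the algebras Lambda whose first-order
   term W has degree at most r in z. So are the power sums wsum i, first for
   i <= r and then for i > r by Newton's identities, so that (xhat i - X) / (1 - t)
   lifts a multiple of zsum i. *)
Definition deform (d : nat) (Y : V) := exists X W, [/\ X \is d.-homog, W \is d.-homog, LamF X,
  X = Y + (1 - vt) *: W & zlt r.+1 (ev v0 W) /\ zlt 1 (ev v0 Y)].

Lemma deform_homog d Y : deform d Y -> Y \is d.-homog.
Proof.
by move=> [X [W [hX hW _ e _]]]; rewrite -[Y](addrK ((1 - vt) *: W)) -e rpredB // rpredZ.
Qed.

Lemma deformZ d a Y : deform d Y -> deform d (a *: Y).
Proof.
move=> [X [W [hX hW LX e [zW zY]]]]; exists (a *: X), (a *: W); split.
- by rewrite rpredZ.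
- by rewrite rpredZ.
- exact: LamFZ.
- by rewrite e scalerDr !scalerA mulrC.
by rewrite !evZ; split; apply: (linear_predZ (linear_zlt K r s _)).
Qed.

Lemma deformD d Y1 Y2 : deform d Y1 -> deform d Y2 -> deform d (Y1 + Y2).
Proof.
move=> [X1 [W1 [h1 g1 L1 e1 [z1 y1]]]] [X2 [W2 [h2 g2 L2 e2 [z2 y2]]]].
exists (X1 + X2), (W1 + W2); split.
- by rewrite rpredD.
- by rewrite rpredD.
- exact: LamFD.
- by rewrite e1 e2 scalerDr addrACA.
by rewrite !rmorphD; split; apply: (linear_predD (linear_zlt K r s _)).
Qed.

(** At v0 the first-order term of the product is Y1 W2 + W1 Y2, where Y1 and Y2 are free of z. So
    the degrees in z of the first-order terms do not add up, and the bound r is kept. *)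
Lemma deformM d1 d2 Y1 Y2 : deform d1 Y1 -> deform d2 Y2 -> deform (d1 + d2) (Y1 * Y2).
Proof.
move=> T1 T2; have hY1 := deform_homog T1; have hY2 := deform_homog T2.
move: T1 T2 => [X1 [W1 [h1 g1 L1 e1 [z1 y1]]]] [X2 [W2 [h2 g2 L2 e2 [z2 y2]]]].
exists (X1 * X2), (Y1 * W2 + W1 * Y2 + (1 - vt) *: (W1 * W2)); split.
- exact: dhomogM.
- by rewrite rpredD ?rpredZ ?rpredD // dhomogM.
- exact: LamFM.
- rewrite e1 e2 mulrDl !mulrDr !scalerDr -!scalerAl -!scalerAr !addrA.
  by rewrite -!addrA; congr (_ + _); rewrite !addrA; congr (_ + _ + _).
have e0 : (1 - vt).@[v0] = 0 by rewrite rmorphB /= rmorph1 ev_vt subrr.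
split; last by rewrite rmorphM; apply: (zltM (e1 := 0%N)).
rewrite !rmorphD !rmorphM evZ e0 scale0r addr0 /=; apply: (linear_predD (linear_zlt K r s _)).
  exact: (zltM (e1 := 0%N)).
by rewrite mulrC; apply: (zltM (e1 := 0%N)).
Qed.

Lemma deformM_eq d d1 d2 Y1 Y2 : (d1 + d2)%N = d -> deform d1 Y1 -> deform d2 Y2 ->
  deform d (Y1 * Y2).
Proof. by move=> <-; apply: deformM. Qed.

Lemma deform0 d : deform d 0.
Proof.
exists 0, 0; rewrite !rpred0 scaler0 addr0 rmorph0; split=> //; last by split; apply: zlt0.
by move=> q t _ _; rewrite rmorph0; apply: linear_pred0 (linear_Lam _ _ _).
Qed.

Lemma deform1 : deform 0 1.
Proof.
exists 1, 0; split; rewrite ?rpred0 ?dhomog1 ?scaler0 ?addr0 //; first exact: LamF1.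
rewrite rmorph0 rmorph1; split; [exact: zlt0|apply: zlt_homog; exact: dhomog1].
Qed.

Lemma zlt_wsum i : zlt 1 (ev v0 (wsum i)).
Proof.
rewrite wsumE evZ ev_ysum; apply: (linear_predZ (linear_zlt K r s _)).
exact: zlt_homog (ysum_zhomog _ _ _ _).
Qed.

Lemma zlt_bhat i : zlt i.+1 (ev v0 (bhat i)).
Proof.
rewrite evZ ev_zsum; apply: (linear_predZ (linear_zlt K r s _)).
exact: zlt_homog (zsum_zhomog _ _ _ _).
Qed.

Lemma deform_wsum_low i : (0 < i <= M)%N -> (i <= r)%N -> deform i (wsum i).
Proof.
move=> iM ir; have [i0 _] := andP iM; exists (xhat i), (bhat i).
split; [exact: xhat_homog|exact: bhat_homog|exact: LamF_xhat|exact: xhatE|].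
by split; [apply: (zlt_le _ (@zlt_bhat i)) | apply: zlt_wsum].
Qed.

Let E : {poly V} := \prod_(j < r) (1 - wv j *: 'X).

Lemma wprod_size k : (r < k)%N -> E`_k = 0.
Proof.
move=> rk; apply: nth_default; apply: leq_trans (size_prod_leq _ _) _.
rewrite leq_subLR cardT size_enum_ord.
have : (\sum_(j < r) size (1 - wv j *: 'X)%R <= \sum_(j < r) 2)%N.
  apply: leq_sum => j _; apply: leq_trans (size_polyD _ _) _.
  rewrite size_poly1 size_polyN geq_max /=; apply: leq_trans (size_scale_leq _ _) _.
  by rewrite size_polyX.
rewrite sum_nat_const card_ord => h; apply: leq_trans (_ : (r * 2).+1 <= _)%N; first by rewrite ltnS.
lia.
Qed.

Lemma wprod_newton k : (k < M)%N ->
  E`_k.+1 *+ k.+1 + \sum_(i < k.+1) wsum i.+1 * E`_(k - i) = 0.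
Proof.
move=> kM; have := @newton_prod _ M 'I_r (index_enum _) wv k kM.
rewrite coefD coef_deriv coefM => h; rewrite -[RHS]h; congr (_ + _).
by apply: eq_bigr => i _; rewrite coef_poly (leq_trans _ kM).
Qed.

Lemma wprod0 : E`_0 = 1.
Proof.
rewrite -horner_coef0 horner_prod big1 // => j _.
by rewrite hornerD hornerN hornerZ hornerX hornerC mulr0 subr0.
Qed.

Lemma deform_wprod k : (k <= r)%N -> (k <= M)%N -> deform k E`_k.
Proof.
elim/ltn_ind: k => -[|k] IHk kr kM; first by rewrite wprod0; apply: deform1.
have k0 : (k.+1%:R : K) != 0 by apply: char0.
have -> : E`_k.+1 = (- (k.+1%:R^-1)%:MP) *: (\sum_(i < k.+1) wsum i.+1 * E`_(k - i)).
  have /eqP := wprod_newton kM; rewrite addr_eq0 => /eqP e.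
  rewrite -[X in _ *: X]opprK -e scalerN scaleNr opprK -scaler_nat scalerA.
  by rewrite -(rmorph_nat (@mpolyC 2 K)) -rmorphM /= mulVf // mpolyC1 scale1r.
apply: deformZ; apply: big_ind; [exact: deform0|exact: deformD|] => i _.
have ik : (i <= k)%N by rewrite -ltnS.
apply: (@deformM_eq _ i.+1 (k - i)); first by rewrite addSn subnKC.
  by apply: deform_wsum_low; [rewrite /= (leq_trans _ kM) | rewrite (leq_trans _ kr)].
by apply: IHk; lia.
Qed.

Lemma deform_wsum i : (0 < i <= M)%N -> deform i (wsum i).
Proof.
elim/ltn_ind: i => -[//|k] IHk /= kM; case: (ltnP r k.+1) => [rk|]; last first.
  by move=> ?; apply: deform_wsum_low.
(* Since k.+1 > r, the coefficient E_(k+1) vanishes, and Newton's identity expresses [wsum k.+1] by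
   lower power sums and the E_j with j <= r, which can all be deformed already. *)
have := wprod_newton kM; rewrite wprod_size // mul0rn add0r big_ord_recr /= subnn wprod0 mulr1.
move/eqP; rewrite addrC addr_eq0 => /eqP ->; rewrite -scaleN1r; apply: deformZ.
apply: big_ind; [exact: deform0|exact: deformD|] => i _.
have ik := ltn_ord i; case: (ltnP r (k - i)) => h.
  by rewrite wprod_size // mulr0; apply: deform0.
apply: (@deformM_eq _ i.+1 (k - i)); first by rewrite addSn subnKC // ltnW.
  2: by apply: deform_wprod => //; lia.
by apply: IHk; rewrite /= ?ltnS // (leq_trans _ kM) // ltnS ltnW.
Qed.

End ZPowerSums.

Lemma liftable_zsum m : (r < m)%N -> liftable m m (zsum _ r s m).
Proof.
move=> rm; have m0 : (0 < m <= m)%N by rewrite leqnn (leq_ltn_trans _ rm).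
have [X [W [hX hW LX e [zW zY]]]] := deform_wsum (M := m) m0.
(* The coefficient of [zsum] in [bhat m m] at v0: the sum becomes m at t = 1, and the other factors
   are nonzero at q = 0. The degree in z of W is at most r, hence below m. *)
pose u := ((\sum_(k < m) vt ^+ k) * (kap m 0 ^+ m.-1 * kap m m)).@[v0].
have u0 : u != 0.
  rewrite /u rmorphM mulf_neq0 //=.
    rewrite rmorph_sum /= (eq_bigr (fun=> 1)) => [|k _]; last first.
      by rewrite rmorphXn /= ev_vt expr1n.
    by rewrite sumr_const card_ord; case: (m) rm => // k _; apply: char0.
  by rewrite rmorphM rmorphXn /= mulf_neq0 ?expf_neq0 ?kap_neq0.
rewrite -[zsum _ r s m](scalerK u0); apply: (linear_predZ (linear_liftable _ _)).
exists (bhat m m - W); split.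
- by rewrite rpredB ?bhat_homog.
- move=> q t hq ht; have t1 : 1 - t != 0 by rewrite subr_eq0 eq_sym -[t]expr1 ht.
  rewrite -[ev _ _](scalerK t1); apply: (linear_predZ (linear_Lam _ _ _)).
  have -> : (1 - t) *: ev (pt q t) (bhat m m - W) = ev (pt q t) (xhat m m + (-1) *: X).
    rewrite xhatE // e scaleN1r opprD addrACA subrr add0r -scalerBr evZ.
    by congr (_ *: _); rewrite rmorphB /= rmorph1 ev_vt.
  by apply: LamFD => //; [apply: LamF_xhat; case/andP: m0 | apply: LamFZ].
- by rewrite rpredZ ?zsum_zhomog.
rewrite rmorphB /= {1}/bhat evZ ev_zsum -/u addrAC subrr add0r.
by apply: (linear_predN (linear_zlt K r s _)); apply: zlt_le zW.
Qed.

End Lifts.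

Section LiftSymmetrized.
Variables (K : fieldType) (r s : nat) (c : K).
Local Notation n := (r + s)%N.
Local Notation B := {mpoly K[r + s]}.
Hypothesis char0 : forall m, (m.+1%:R : K) != 0.
Hypothesis c_neq0 : c != 0.
Local Notation zhomog e f := (f \is e.-homog for (@zdeg r s)).

Local Notation liftable := (@liftable K r s c).
Local Notation linear_liftable := (@linear_liftable K r s c).
Local Notation Wsym := (@Wsym K r s).
Local Notation Agr := (@Agr K r s).

Lemma Wsym_msym w f : blk w -> Wsym (msym w f) = Wsym f.
Proof.
move=> bw; rewrite /Wsym [RHS](reindex_inj (mulgI w)) /=.
apply: eq_big => v; last by move=> _; rewrite msymMm.
by apply/idP/idP => [bv|bwv]; [rewrite blkM | rewrite -[v](mulKg w) blkM ?blkV].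
Qed.

Definition blksum (i : 'I_n) (e : nat) : B := \sum_(j < n | (j < r)%N == (i < r)%N) 'X_j ^+ e.

Lemma liftable_blksum i e : (0 < e)%N -> ok_exp i e ->
  liftable e (if (i < r)%N then 0 else e) (blksum i e).
Proof.
move=> e0; rewrite /ok_exp (gtn_eqF e0) /blksum; case: (i < r)%N => /= h.
  rewrite (eq_bigl (fun j : 'I_n => (j < r)%N)) => [|j]; last by rewrite eqb_id.
  by rewrite -(big_blocks (fun j => 'X_j ^+ e)).1; apply: liftable_ysum.
rewrite (eq_bigl (fun j : 'I_n => ~~ (j < r)%N)) => [|j]; last by rewrite eqbF_neg.
by rewrite -(big_blocks (fun j => 'X_j ^+ e)).2; apply: liftable_zsum.
Qed.

Lemma winv_blksum i e : winv (blksum i e).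
Proof.
move=> w bw; rewrite /blksum raddf_sum /= [RHS](reindex_inj (@perm_inj _ w)) /=.
apply: eq_big => j; first by rewrite (blkP _ bw).
move=> _; rewrite rmorphXn /= msymX; congr ('X_[_] ^+ _); apply/mnmP => k.
by rewrite mnmE !mnm1E -(inj_eq (@perm_inj _ w) j) permKV.
Qed.

(* Multiplying Wsym X^m', for m' = m without its i-th variable, by the power sum
   of the block of i gives a multiple of Wsym X^m and terms with fewer variables. *)
Lemma liftable_Wsym m : okm m -> liftable (mdeg m) (zdeg m) (Wsym 'X_[m]).
Proof.
have [N] := ubnP #|[set j | m j != 0%N]|; elim: N m => // N IHN m mN om.
have linL := linear_liftable (mdeg m) (zdeg m).
have [m0|[i mi]] : m = 0%MM \/ exists i, m i != 0%N.
  have [->|mn0] := eqVneq m 0%MM; [by left|right; apply: contrapT => nex].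
  case/eqP: mn0; apply/mnmP => i; rewrite mnm0E; apply/eqP/contraT => h.
  by case: nex; exists i.
  rewrite m0 mpolyX0 Wsym_winv; last exact: winv1.
  rewrite mdeg0 zdeg0; apply: (linear_predZ (linear_liftable _ _)).
  by exists 1; apply: is_lift1.
pose e := m i; pose m' := [multinom (if j == i then 0%N else m j) | j < n].
pose mj j := (m' + U_(j) *+ e)%MM.
have m'i : m' i = 0%N by rewrite mnmE eqxx.
have mi' : mj i = m.
  apply/mnmP => j; rewrite mnmDE mulmnE mnmE mnm1E [i == j]eq_sym.
  by case: (j =P i) => [->|_]; rewrite ?mul1n ?mul0n ?addn0.
have oi : ok_exp i e := forallP om i.
have om' : okm m'.
  apply/forallP => j; rewrite mnmE; case: (j =P i) => _; first by rewrite /ok_exp eqxx orbT.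
  exact: (forallP om).
have sub (m1 : 'X_{1..n}) : (forall j, m1 j != 0%N -> m j != 0%N) -> m1 i = 0%N ->
    (#|[set j | m1 j != 0%N]| < N)%N.
  move=> h m1i; rewrite -ltnS (leq_trans _ mN) // ltnS; apply: proper_card.
  apply/properP; split; first by apply/subsetP => j; rewrite !inE; apply: h.
  by exists i; rewrite !inE ?mi ?m1i.
have Lm' : liftable (mdeg m') (zdeg m') (Wsym 'X_[m']).
  apply: (IHN m' _ om'); apply: (sub m') => [j|//].
  by rewrite mnmE; case: (j =P i).
have okj (j : 'I_n) : (j < r)%N == (i < r)%N -> okm (mj j).
  move=> /eqP ji; apply/forallP => k; rewrite mnmDE mulmnE mnm1E; apply: ok_expD.
    exact: (forallP om').
  case: (j =P k) => [<-|_]; rewrite ?mul1n ?mul0n; last by rewrite /ok_exp eqxx orbT.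
  by move: oi; rewrite /ok_exp ji.
have degj (j : 'I_n) : mdeg (mj j) = mdeg m by rewrite -[in RHS]mi' !mdegD !mdegMn !mdeg1.
have zdegMn (l : 'X_{1..n}) k : zdeg (l *+ k)%MM = (zdeg l * k)%N.
  elim: k => [|k IHk]; first by rewrite mulm0n zdeg0 muln0.
  by rewrite mulmS zdegD IHk mulnS.
have zdegj (j : 'I_n) : (j < r)%N == (i < r)%N -> zdeg (mj j) = zdeg m.
  by move=> /eqP ji; rewrite -[in RHS]mi' !zdegD !zdegMn !zdegU ji.
have prodE : blksum i e * Wsym 'X_[m'] =
    \sum_(j < n | (j < r)%N == (i < r)%N) Wsym 'X_[mj j].
  rewrite -WsymM; last exact: winv_blksum.
  rewrite /Wsym [RHS]exchange_big /=; apply: eq_bigr => w _; rewrite mulr_suml raddf_sum.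
  by apply: eq_bigr => j _; rewrite /= /mj addmC mpolyXD mpolyXn.
rewrite (bigID (fun j : 'I_n => m' j == 0%N)) /= in prodE.
(* If the exponent e lands on a variable of the same block that does not occur in m', the result is
   m with i and j exchanged. *)
have conj (j : 'I_n) : ((j < r)%N == (i < r)%N) && (m' j == 0%N) -> Wsym 'X_[mj j] = Wsym 'X_[m].
  move=> /andP[/eqP ji /eqP m'j]; rewrite -(@Wsym_msym (tperm i j)) ?blk_tperm //.
  congr (Wsym _); rewrite msymX -mi'; congr 'X_[_]; apply/mnmP => k.
  rewrite mnmE tpermV !mnmDE !mulmnE !mnm1E; congr (_ + _ * _)%N.
    by case: tpermP => [->|->|//]; rewrite ?m'i ?m'j.
  by rewrite -(inj_eq (@perm_inj _ (tperm i j)) i) tpermL; congr (nat_of_bool (_ == _));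
    rewrite ?tpermK.
rewrite (eq_bigr (fun=> Wsym 'X_[m]) conj) sumr_const in prodE.
set k := #|_| in prodE.
have k0 : (k%:R : K) != 0.
  have : (0 < k)%N by apply/card_gt0P; exists i; rewrite unfold_in /= eqxx m'i eqxx.
  by case: (k).
rewrite -[Wsym 'X_[m]](scalerK k0); apply: (linear_predZ linL).
rewrite scaler_nat -[_ *+ k](addrK (\sum_(j < n | ((j < r)%N == (i < r)%N) && (m' j != 0%N))
  Wsym 'X_[mj j])) -prodE; apply: (linear_predB linL).
  have -> : mdeg m = (e + mdeg m')%N by rewrite -mi' mdegD mdegMn mdeg1 mul1n addnC.
  have -> : zdeg m = ((if (i < r)%N then 0%N else e) + zdeg m')%N.
    rewrite -{1}mi' zdegD zdegMn zdegU addnC.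
    by case: (i < r)%N; rewrite ?mul1n.
  by apply: liftableM Lm'; apply: liftable_blksum; rewrite ?lt0n.
apply: (linear_pred_sum linL) => j _ /andP[ji m'j].
rewrite -(degj j) -(zdegj j ji); apply: IHN; last exact: okj.
have nji : j != i by apply: contraNneq m'j => ->; rewrite m'i.
apply: sub => [l|]; last by rewrite mnmDE mulmnE mnm1E (negbTE nji) m'i.
rewrite mnmDE mulmnE mnm1E; case: (j =P l) => [<- _|_].
  by move: m'j; rewrite mnmE (negbTE nji).
by rewrite mul0n addn0 mnmE; case: (l =P i).
Qed.

Lemma liftable_Agr D e f : Agr f -> f \is D.-homog -> zhomog e f -> liftable D e f.
Proof.
move=> [Mf If] /dhomogP hf /dhomogP zf; have linL := linear_liftable D e.
rewrite -[f](scalerK (Worder_neq0 r s char0)); apply: (linear_predZ linL).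
rewrite -Wsym_winv // [f]mpolyE.
have linLW : linear_pred (fun u => liftable D e (Wsym u)).
  split=> [|k u v Lu Lv]; last by rewrite Wsym_linear; apply: (linear_pred2 linL).
  by rewrite /Wsym big1 => [|w _]; [apply: (linear_pred0 linL) | rewrite msym0].
apply: (linear_pred_sum linLW) => m mf _; apply: (linear_predZ linLW).
rewrite -(hf m mf) -(zf m mf); apply: liftable_Wsym; apply: Mf.
by rewrite -mcoeff_msupp.
Qed.

End LiftSymmetrized.

(** * Relations on Lambda *)

Section Merging.
Variables (K : fieldType) (r s : nat) (j k : 'I_(r + s)).
Local Notation n := (r + s)%N.
Local Notation B := {mpoly K[r + s]}.

Definition merged (m : 'X_{1..r + s}) : 'X_{1..r + s} :=
  [multinom (if i == j then m j + m k else if i == k then 0 else m i)%N | i < r + s].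

Definition merge_val (u v : K) (i : 'I_n) : B :=
  if i == j then u *: 'X_j else if i == k then v *: 'X_j else 'X_i.

(** Sets the j-th variable to u w and the k-th to v w, with 'X_j itself in the role of w. *)
Definition merge (u v : K) (f : B) : B :=
  f \mPo [tuple merge_val u v i | i < r + s].

Lemma merge0 u v : merge u v 0 = 0. Proof. exact: rmorph0. Qed.
Lemma merge1 u v : merge u v 1 = 1. Proof. exact: rmorph1. Qed.

Lemma merge_linear u v b f g : merge u v (b *: f + g) = b *: merge u v f + merge u v g.
Proof. by rewrite /merge comp_mpolyD comp_mpolyZ. Qed.

Lemma mergeM u v f g : merge u v (f * g) = merge u v f * merge u v g.
Proof. exact: rmorphM. Qed.

Hypothesis jk : j != k.

Lemma mergeX u v m : merge u v 'X_[m] = (u ^+ m j * v ^+ m k) *: 'X_[merged m].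
Proof.
rewrite /merge comp_mpolyX (bigD1 j) // (bigD1 k) 1?eq_sym //= !tnth_mktuple.
rewrite /merge_val eqxx eq_sym (negbTE jk) eqxx !exprZn -!scalerAl -scalerAr scalerA.
congr (_ *: _); rewrite [RHS]mpolyXE_id [in RHS](bigD1 j) //= [in RHS](bigD1 k) 1?eq_sym //=.
rewrite !mnmE eqxx eq_sym (negbTE jk) eqxx expr0 mul1r mulrA -exprD; congr (_ * _).
by apply: eq_bigr => i /andP[/negbTE ij /negbTE ik]; rewrite tnth_mktuple mnmE ij ik.
Qed.

Lemma mdeg_merged m : mdeg (merged m) = mdeg m.
Proof.
rewrite !mdegE (bigD1 j) // [RHS](bigD1 j) //= mnmE eqxx.
rewrite (bigD1 k) 1?eq_sym //= [in RHS](bigD1 k) 1?eq_sym //= mnmE eqxx eq_sym (negbTE jk).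
rewrite add0n -addnA; congr (_ + (_ + _))%N.
by apply: eq_bigr => i /andP[/negbTE ij /negbTE ik]; rewrite mnmE ij ik.
Qed.

Lemma merge_sum (I : Type) (l : seq I) (P : pred I) (x : I -> K) (m : I -> 'X_{1..n}) u v :
  merge u v (\sum_(i <- l | P i) x i *: 'X_[m i]) =
  \sum_(i <- l | P i) (x i * (u ^+ m i j * v ^+ m i k)) *: 'X_[merged (m i)].
Proof.
rewrite /merge raddf_sum /=; apply: eq_bigr => i _.
by rewrite comp_mpolyZ -/(merge _ _ _) mergeX scalerA.
Qed.

End Merging.

Section LamRelations.
Variables (K : fieldType) (r s : nat) (c q t : K).
Local Notation n := (r + s)%N.
Local Notation B := {mpoly K[r + s]}.
Local Notation a := (a_seq c q t).
Hypothesis ht : not_root_of_unity t.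

Lemma gpsum_blocks (b : nat -> K) i : gpsum r s b i =
  b i *: (\sum_(j < n | (j < r)%N) 'X_j ^+ i) + \sum_(j < n | ~~ (j < r)%N) 'X_j ^+ i.
Proof.
rewrite /gpsum (big_blocks (fun j => 'X_j ^+ i)).1.
by rewrite (big_blocks (fun j => 'X_j ^+ i)).2.
Qed.

Lemma Lam_winv f : Lam r s a f -> winv f.
Proof.
apply: Lam_ind; [exact: linear_winv|exact: winv1|exact: winvM|] => i _ w bw.
rewrite gpsum_blocks msymD msymZ; congr (_ *: _ + _); rewrite raddf_sum /=.
  rewrite [RHS](reindex_inj (@perm_inj _ w)) /=.
  apply: eq_big => j; first by rewrite (blkP _ bw).
  by move=> _; rewrite rmorphXn /= msymX; congr ('X_[_] ^+ _); apply/mnmP => k;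
    rewrite mnmE !mnm1E -(inj_eq (@perm_inj _ w) j) permKV.
rewrite [RHS](reindex_inj (@perm_inj _ w)) /=.
apply: eq_big => j; first by rewrite (blkP _ bw).
by move=> _; rewrite rmorphXn /= msymX; congr ('X_[_] ^+ _); apply/mnmP => k;
  rewrite mnmE !mnm1E -(inj_eq (@perm_inj _ w) j) permKV.
Qed.

(** This is what the a_i are made for: a_i (1 - t^i) = c^i (q^i - 1) says that a_i u^i + v^i takes
    the same value at (u, v) = (1, c) and at (t, c q). *)
Lemma Lam_merge f (j k : 'I_n) : (j < r)%N -> (r <= k)%N -> Lam r s a f ->
  merge j k 1 c f = merge j k t (c * q) f.
Proof.
move=> jr rk; have kr : ~~ (k < r)%N by rewrite -leqNgt.
have kj : (k == j) = false by apply/negbTE/eqP => e; rewrite e jr in kr.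
move: f; apply: (Lam_ind (P := fun f => merge j k 1 c f = merge j k t (c * q) f)).
- split=> [|b u v hu hv]; first by rewrite !merge0.
  by rewrite !merge_linear hu hv.
- by rewrite !merge1.
- by move=> u v hu hv; rewrite !mergeM hu hv.
move=> i i0; have t1 : 1 - t ^+ i != 0 by rewrite subr_eq0 eq_sym ht.
have mE u v : merge j k u v (gpsum r s a i) =
    (a i *: (\sum_(l < n | (l < r)%N && (l != j)) 'X_l ^+ i) +
     \sum_(l < n | ~~ (l < r)%N && (l != k)) 'X_l ^+ i) + (a i * u ^+ i + v ^+ i) *: 'X_j ^+ i.
  rewrite gpsum_blocks /merge rmorphD /= comp_mpolyZ !rmorph_sum /=.
  have XE l : 'X_l ^+ i \mPo [tuple merge_val j k u v i0 | i0 < n] = merge_val j k u v l ^+ i.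
    by rewrite rmorphXn /= comp_mpolyXU -tnth_nth tnth_mktuple.
  have -> : \sum_(l < n | (l < r)%N) ('X_l ^+ i \mPo [tuple merge_val j k u v i0 | i0 < n]) =
      u ^+ i *: 'X_j ^+ i + \sum_(l < n | (l < r)%N && (l != j)) 'X_l ^+ i.
    rewrite (bigD1 j) //= XE /merge_val eqxx exprZn; congr (_ + _).
    apply: eq_bigr => l /andP[lr /negbTE lj]; rewrite XE /merge_val lj.
    by case: (l =P k) => // e; rewrite -e lr in kr.
  have -> : \sum_(l < n | ~~ (l < r)%N) ('X_l ^+ i \mPo [tuple merge_val j k u v i0 | i0 < n]) =
      v ^+ i *: 'X_j ^+ i + \sum_(l < n | ~~ (l < r)%N && (l != k)) 'X_l ^+ i.
    rewrite (bigD1 k) //= XE /merge_val kj eqxx exprZn; congr (_ + _).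
    apply: eq_bigr => l /andP[lr /negbTE lk]; rewrite XE /merge_val lk.
    by case: (l =P j) => // e; rewrite e jr in lr.
  by rewrite scalerDr scalerA scalerDl addrACA addrC.
rewrite !mE; congr (_ + _ *: _); rewrite /a_seq expr1n mulr1 exprMn.
by field.
Qed.

End LamRelations.

Section SpecialPoint.
Variables (K : fieldType) (r s : nat) (c : K).
Local Notation n := (r + s)%N.
Local Notation B := {mpoly K[r + s]}.
Hypothesis c_neq0 : c != 0.

(* A monomial of maximal degree in z with an exponent e, 0 < e <= r, at z_k would
   make f - f(z_k = 0) a nonzero polynomial of degree at most r in z_k, with the
   r + 1 roots 0 and c y_j. *)
Lemma merge_special f :
  (forall (j k : 'I_n), (j < r)%N -> (r <= k)%N -> merge j k 1 c f = merge j k 1 0 f) ->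
  (forall m, okm m -> f@_m = 0) -> f = 0.
Proof.
move=> mf okf; apply/eqP/contraT => f0.
have [m0 m0f] : exists m0, m0 \in msupp f.
  case E : (msupp f) => [|m0 l]; last by exists m0; rewrite mem_head.
  by rewrite -msupp_eq0 E eqxx in f0.
have [m [mf0 mmax]] : exists m, m \in msupp f /\ forall m1, m1 \in msupp f -> (zdeg m1 <= zdeg m)%N.
  have h0 : (index m0 (msupp f) < size (msupp f))%N by rewrite index_mem.
  case: (@arg_maxnP _ (Ordinal h0) xpredT (fun i => zdeg (tnth (in_tuple (msupp f)) i)) isT).
  move=> i _ hi; exists (tnth (in_tuple (msupp f)) i); split; first exact: mem_tnth.
  by move=> m1 /seq_tnthP[i1 ->]; apply: hi.
have [k kr mk] : exists2 k : 'I_n, (r <= k)%N & (0 < m k <= r)%N.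
  have : ~~ okm m by apply: contraL mf0 => /okf fm; rewrite mcoeff_msupp fm eqxx.
  rewrite negb_forall => /existsP[k]; rewrite /ok_exp !negb_or -!leqNgt.
  by move=> /and3P[h1 h2 h3]; exists k => //; rewrite lt0n h2.
(* Only the monomials that agree with m at every z other than z_k are kept; p regards them as a
   polynomial in z_k. Merging y_j with z_k preserves this selection, and by the maximality of m the
   degree of p is at most m k. *)
pose beta (m1 : 'X_{1..n}) := [forall l : 'I_n, (r <= l)%N && (l != k) ==> (m1 l == m l)].
pose del (m1 : 'X_{1..n}) : 'X_{1..n} := [multinom if l == k then 0%N else m1 l | l < n].
pose p : {poly B} := \sum_(m1 <- msupp f | beta m1) (f@_m1 *: 'X_[del m1])%:P * 'X^(m1 k).
have mergedE (j : 'I_n) m1 : (j < r)%N -> beta (merged j k m1) = beta m1.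
  move=> jr; apply: eq_forallb => l; case: (boolP ((r <= l)%N && (l != k))) => //= /andP[rl lk].
  rewrite mnmE (negbTE lk); case: (l =P j) => // e.
  by rewrite e leqNgt jr in rl.
have evalE (j : 'I_n) v m' : (j < r)%N ->
    (p.[v *: 'X_j])@_m' = if beta m' then (merge j k 1 v f)@_m' else 0.
  move=> jr; have jk : j != k by apply: contraTneq jr => ->; rewrite -leqNgt.
  rewrite [f in merge _ _ _ _ f]mpolyE merge_sum // /p horner_sum raddf_sum raddf_sum /=.
  have termE m1 : ((f@_m1 *: 'X_[del m1])%:P * 'X^(m1 k)).[v *: 'X_j] =
      (f@_m1 * (1 ^+ m1 j * v ^+ m1 k)) *: 'X_[merged j k m1].
    rewrite hornerM hornerC hornerXn exprZn -scalerAl -scalerAr scalerA expr1n mul1r.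
    congr (_ *: _); rewrite mpolyXn -mpolyXD; congr 'X_[_]; apply/mnmP => l.
    rewrite mnmDE mulmnE mnm1E !mnmE [j == l]eq_sym.
    case: (l =P j) => [->|_]; first by rewrite (negbTE jk) mul1n.
    by rewrite mul0n addn0.
  under eq_bigr => m1 _ do rewrite termE mcoeffZ mcoeffX.
  case: ifP => bm'.
    rewrite big_mkcond; apply: eq_bigr => m1 _; rewrite mcoeffZ mcoeffX.
    case: (merged j k m1 =P m') => [e|_]; last by rewrite mulr0 if_same.
    by rewrite -(mergedE j) // e bm'.
  apply: big1 => m1 b1; case: (merged j k m1 =P m') => [e|_]; last by rewrite mulr0.
  by rewrite -e mergedE // b1 in bm'.
have evalC (j : 'I_n) : (j < r)%N -> p.[c *: 'X_j] = p.[0].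
  move=> jr; rewrite -[in RHS](scale0r 'X_j); apply/mpolyP => m'.
  by rewrite (evalE j c m' jr) (evalE j 0 m' jr) (mf j k jr kr).
have size_p : (size p <= r.+1)%N.
  apply: leq_trans (size_sum _ _ _) _; apply/bigmax_leqP_seq => m1 m1f b1.
  apply: leq_trans (size_mul_leq _ _) _; rewrite size_polyXn addnS /=.
  apply: leq_trans (leq_add (size_polyC_leq1 _) (leqnn _)) _; rewrite add1n ltnS.
  apply: leq_trans (_ : m k <= r)%N; last by case/andP: mk.
  have := mmax m1 m1f; rewrite /zdeg (bigD1 k) -?leqNgt //= [in leqRHS](bigD1 k) -?leqNgt //=.
  rewrite (eq_bigr m) ?leq_add2r // => l /andP[lr lk].
  by have := forallP b1 l; rewrite leqNgt lr lk => /eqP.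
pose g := p - (p.[0])%:P.
pose rts : seq B := 0 :: [seq c *: 'X_j | j : 'I_n <- enum 'I_n & (j < r)%N].
have g0 : g = 0.
  apply/eqP/contraT => gn0; have := max_poly_roots gn0 (rs := rts).
  have -> : size rts = r.+1.
    rewrite /= size_map size_filter -sum1_count big_enum_cond /=.
    by rewrite -(big_ord_widen n (fun=> 1%N)) ?leq_addr // sum1_card card_ord.
  have -> : (r.+1 < size g)%N = false.
    apply/negbTE; rewrite -leqNgt; apply: leq_trans (size_polyD _ _) _.
    rewrite geq_max size_p size_polyN.
    by apply: leq_trans (size_polyC_leq1 _) _.
  apply.
    apply/allP => x; rewrite inE rootE /g hornerD hornerN hornerC subr_eq0.
    case/orP => [/eqP -> //|/mapP[j]]; rewrite mem_filter => /andP[jr _] ->.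
    by apply/eqP; apply: evalC.
  rewrite /rts cons_uniq; apply/andP; split.
    apply/mapP => -[j _ /esym/eqP]; rewrite scaler_eq0 (negbTE c_neq0) /=.
    by rewrite -msupp_eq0 msuppX.
  rewrite map_inj_uniq ?(filter_uniq _ (enum_uniq _)) // => j j' /(scalerI c_neq0) /eqP.
  by move/eqP => e; have := congr1 (mcoeff U_(j')) e; rewrite !mcoeffX eqxx eq_mnm1;
    case: (j =P j') => // _ /eqP; rewrite eq_sym oner_eq0.
have pk : p`_(m k) = 0.
  have := congr1 (fun u : {poly B} => u`_(m k)) g0; rewrite coef0 coefB coefC.
  by case: (m k) mk => //= e _; rewrite subr0.
have := congr1 (mcoeff (del m)) pk; rewrite mcoeff0 /p coef_sum raddf_sum /=.
have bm : beta m by apply/forallP => l; apply/implyP.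
rewrite big_mkcond (bigD1_seq m) ?msupp_uniq //= bm.
rewrite coefCM coefXn eqxx mulr1 mcoeffZ mcoeffX eqxx mulr1 big1 => [|m1 m1m].
  by rewrite addr0 => fm; rewrite mcoeff_msupp fm eqxx in mf0.
case: ifP => [b1|_ //].
rewrite coefCM coefXn; case: (m k =P m1 k) => [e|_]; last by rewrite mulr0 mcoeff0.
rewrite mulr1 mcoeffZ mcoeffX; case: (del m1 =P del m) => [ed|_]; last by rewrite mulr0.
case/eqP: m1m; apply/mnmP => l; have [->|lk] := eqVneq l k; first by rewrite e.
by move/mnmP: ed => /(_ l); rewrite !mnmE (negbTE lk).
Qed.

End SpecialPoint.

Section UpperBound.
Variables (K : fieldType) (r s : nat) (c : K).
Local Notation n := (r + s)%N.
Local Notation B := {mpoly K[r + s]}.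
Hypothesis c_neq0 : c != 0.

(** The coefficients of f solve a linear system with polynomial entries in q, t. The three kinds of
    index in T2 are vanishing on L and outside degree D, invariance under S_r x S_s, and the
    relations of [Lam_merge]. At (0, 1) only zero solves it, by [merge_special], and
    [generic_injective] spreads this to generic points. *)
Lemma generic_upper_bound (D : nat) (L : seq 'X_{1..r + s}) :
  (forall m, okm m -> mdeg m = D -> exists2 w : 'S_n, blk w & m#w \in L) ->
  exists2 F : {mpoly K[2]}, F != 0 & forall q t : K, F.@[pt q t] != 0 ->
    not_root_of_unity t -> forall f : B, Lam r s (a_seq c q t) f -> f \is D.-homog ->
    (forall m, m \in L -> f@_m = 0) -> f = 0.
Proof.
move=> hL; pose T1 := 'X_{1..n < D.+1}.
pose T2 := ((T1 + ('S_n * T1)) + ('I_n * 'I_n * T1))%type.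
pose rho (m : T1) (z : T2) : {mpoly K[2]} := match z with
  | inl (inl m') => if (bmnm m' \in L) || (mdeg m' != D) then (bmnm m == m')%:R else 0
  | inl (inr (w, m')) =>
      if blk w then (bmnm m == m')%:R - (bmnm m == bmnm m' # w)%:R else 0
  | inr (j, k, m') => if (j < r)%N && (r <= k)%N then
      ((c ^+ m k)%:MP * (1 - vt K ^+ m j * vq K ^+ m k)) * (merged j k m == m')%:R else 0
  end.
pose P (x : T1 -> K) : B := \sum_m x m *: 'X_[m].
have PE x m' : (P x)@_m' = \sum_m x m * (bmnm m == m')%:R.
  by rewrite raddf_sum; apply: eq_bigr => m _; rewrite /= mcoeffZ mcoeffX.
have natE (b : bool) v : (b%:R : {mpoly K[2]}).@[v] = b%:R by rewrite rmorph_nat.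
have rhoE x q t z : \sum_m x m * (rho m z).@[pt q t] = match z with
  | inl (inl m') => if (bmnm m' \in L) || (mdeg m' != D) then (P x)@_m' else 0
  | inl (inr (w, m')) => if blk w then (P x)@_m' - (P x)@_(bmnm m' # w) else 0
  | inr (j, k, m') => if (j < r)%N && (r <= k)%N then
      (merge j k 1 c (P x) - merge j k t (c * q) (P x))@_m' else 0
  end.
  case: z => [[m'|[w m']]|[[j k] m']] /=.
  - case: ifP => _; last by rewrite big1 // => m _; rewrite meval0 mulr0.
    by rewrite PE; apply: eq_bigr => m _; rewrite natE.
  - case: ifP => _; last by rewrite big1 // => m _; rewrite meval0 mulr0.
    rewrite !PE -sumrB; apply: eq_bigr => m _.
    by rewrite mevalB !natE mulrBr.
  case: ifP => [/andP[jr rk]|_]; last by rewrite big1 // => m _; rewrite meval0 mulr0.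
  have jk : j != k by apply: contraTneq jr => ->; rewrite -leqNgt.
  have mc (G : T1 -> B) : (\sum_m G m)@_m' = \sum_m (G m)@_m' by apply: raddf_sum.
  rewrite mcoeffB /P !merge_sum // !mc -sumrB; apply: eq_bigr => m _ /=.
  rewrite !mcoeffZ !mcoeffX mevalM natE mevalM mevalC mevalB mevalM !rmorphXn /= rmorph1.
  rewrite ev_vq ev_vt -mulrBl -mulrBr mulrA expr1n mul1r; congr (_ * _ * _).
  by rewrite exprMn; ring.
have Pcoef x (m : T1) : (P x)@_m = x m.
  rewrite PE (bigD1 m) //= eqxx mulr1 big1 ?addr0 // => m1 m1m.
  by rewrite (inj_eq val_inj) (negbTE m1m) mulr0.
have [|F F0 hF] := @generic_injective K 2 T1 T2 rho (v0 K).
  move=> x hx m.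
  suff P0 : P x = 0 by rewrite -Pcoef P0 mcoeff0.
  apply: (@merge_special K r s c c_neq0) => [j k jr rk|m1 om1].
    apply/mpolyP => m'; case: (ltnP (mdeg m') D.+1) => hm'; last first.
      have jk : j != k by apply: contraTneq jr => ->; rewrite -leqNgt.
      rewrite /P !merge_sum // !raddf_sum !big1 // => m1 _ /=; rewrite mcoeffZ mcoeffX;
        case: eqP => [e|_]; rewrite ?mulr0 //;
        by move: hm'; rewrite -e mdeg_merged // leqNgt bmdeg.
    have := hx (inr (j, k, BMultinom hm')); rewrite rhoE jr rk /= mulr0 mcoeffB.
    by move/eqP; rewrite subr_eq0 => /eqP.
  case: (ltnP (mdeg m1) D.+1) => hm1; last first.
    rewrite PE big1 // => m2 _; case: eqP => [e|_]; last by rewrite mulr0.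
    by move: hm1; rewrite -e leqNgt bmdeg.
  have := hx (inl (inl (BMultinom hm1))); rewrite rhoE /=.
  have [dm1|] := eqVneq (mdeg m1) D; last by rewrite orbT.
  move=> _; have [w bw wL] := hL m1 om1 dm1.
  have := hx (inl (inr (w, BMultinom hm1))); rewrite rhoE /= bw => /eqP.
  rewrite subr_eq0 => /eqP ->.
  have hw : (mdeg (m1#w) < D.+1)%N by rewrite mdeg_mperm.
  by have := hx (inl (inl (BMultinom hw))); rewrite rhoE /= wL.
exists F; first by apply: contraNneq F0 => ->; rewrite meval0.
move=> q t Fqt ht f Lf hf f0; have szf : (msize f <= D.+1)%N.
  by rewrite msizeE; apply/bigmax_leqP_seq => m /(dhomogP _ _ _ hf) /= -> _.
have fE : f = P (fun m => f@_m) by rewrite {1}(mpolywE szf).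
rewrite fE /P big1 // => m _; rewrite (hF _ Fqt (fun m => f@_m)) ?scale0r // => z.
rewrite rhoE -fE; case: z => [[m'|[w m']]|[[j k] m']].
- case: ifP => // /orP[/f0 //|h]; apply: (dhomog_nemf_coeff hf h).
- case: ifP => // bw; have := congr1 (mcoeff m') (Lam_winv Lf bw).
  by rewrite mcoeff_sym => ->; rewrite subrr.
by case: ifP => // /andP[jr rk]; rewrite (Lam_merge ht jr rk Lf) subrr mcoeff0.
Qed.

End UpperBound.

(** * Bases at generic points *)

Section CountingBases.
Variables (K : fieldType) (V : lmodType K) (W : V -> Prop) (tr : V -> V).
Hypothesis linW : linear_pred W.
Hypothesis tr_lin : forall k u v, tr (k *: u + v) = k *: tr u + tr v.
Hypothesis tr_inj : forall x, W x -> tr x = 0 -> x = 0.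
Variables (I : eqType) (L : seq I) (u : I -> V).
Hypothesis tr_span : forall x, span_on L u (tr x).

Lemma free_size_le (J : eqType) (l : seq J) (v : J -> V) :
  uniq l -> (forall j, j \in l -> W (v j)) -> free_on l v -> (size l <= size L)%N.
Proof.
have tr0 : tr 0 = 0.
  by have := tr_lin (-1) 0 0; rewrite scaler0 addr0 scaleN1r addNr.
have trS (l' : seq J) (c : J -> K) (v' : J -> V) :
    tr (\sum_(j <- l') c j *: v' j) = \sum_(j <- l') c j *: tr (v' j).
  by elim: l' => [|j l' IHl]; rewrite ?big_nil // !big_cons tr_lin IHl.
move=> ul Wv fv; apply: (steinitz (v := fun j => tr (v j)) ul _ (fun j _ => tr_span (v j))).
move=> c; rewrite -trS => s0; apply: fv; apply: tr_inj s0.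
by apply: linear_pred_sum => // j jl _; apply: linear_predZ => //; apply: Wv.
Qed.

End CountingBases.

(** Otherwise x, under the index [None], could be added to a free family that already has the
    largest possible size. *)
Lemma span_of_size (K : fieldType) (V : lmodType K) (W : V -> Prop) (N : nat) :
  (forall (J : eqType) (l : seq J) (v : J -> V), uniq l -> (forall j, j \in l -> W (v j)) ->
     free_on l v -> (size l <= N)%N) ->
  forall (J : eqType) (l : seq J) (v : J -> V) x,
  uniq l -> (forall j, j \in l -> W (v j)) -> free_on l v -> (N <= size l)%N -> W x ->
  span_on l v x.
Proof.
move=> bnd J l v x ul Wv fv Nl Wx; apply: contrapT => nspan.
have := bnd _ (None :: map Some l) (fun j => oapp v x j).
rewrite /= size_map => h; suff : (size l < size l)%N by rewrite ltnn.
apply: leq_trans Nl; apply: h.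
- by rewrite (map_inj_uniq (@Some_inj _)) ul andbT; apply/mapP => -[].
- by move=> [j|//]; rewrite inE /= => /mapP[i il [->]]; apply: Wv.
move=> c; rewrite big_cons big_map /= => s0.
have c0 : c None = 0.
  apply/eqP/contraT => cn0; case: nspan; rewrite -[x](scalerK cn0).
  have -> : c None *: x = - \sum_(j <- l) c (Some j) *: v j by apply/eqP; rewrite -addr_eq0 s0.
  apply: (linear_predZ (linear_span_on _ _)); apply: (linear_predN (linear_span_on _ _)).
  by exists (fun j => c (Some j)).
rewrite c0 scale0r add0r in s0.
move=> [j|//]; rewrite inE /= => /mapP[i il [->]]; exact: (fv (fun j => c (Some j))).
Qed.

Lemma Lam_pihomog (K : fieldType) (r s : nat) (a : nat -> K) f d :
  Lam r s a f -> Lam r s a (pihomog mdeg d f).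
Proof.
move=> Lf; move: d; apply: (Lam_ind (P := fun f => forall d, Lam r s a (pihomog mdeg d f))) Lf.
- split=> [d|k u v hu hv d]; first by rewrite pihomog0; apply: linear_pred0 (linear_Lam _ _ _).
  by rewrite linearP; apply: (linear_pred2 (linear_Lam r s a) _ (hu d) (hv d)).
- move=> d; have [<-|d0] := eqVneq 0%N d.
    by rewrite pihomog_dE; [apply: Lam1 | apply: dhomog1].
  by rewrite (pihomog_ne0 d0); [apply: linear_pred0 (linear_Lam _ _ _) | apply: dhomog1].
- move=> u v hu hv d; rewrite {1}[v](pihomog_partitionE (mf := mdeg) (leqnn _)) mulr_sumr raddf_sum /=.
  apply: (linear_pred_sum (linear_Lam _ _ _)) => e _ _; rewrite (pihomogM _ _ (pihomogP _ _ _)).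
  by case: ifP => _; [apply: LamM | apply: linear_pred0 (linear_Lam _ _ _)].
move=> i i0 d; have [<-|id] := eqVneq i d.
  by rewrite pihomog_dE ?dhomog_gpsum //; apply: Lam_gpsum.
rewrite (pihomog_ne0 id) ?dhomog_gpsum //; exact: linear_pred0 (linear_Lam _ _ _).
Qed.

Section GenericBasis.
Variables (K : fieldType) (r s : nat) (c : K).
Local Notation n := (r + s)%N.
Local Notation B := {mpoly K[r + s]}.
Local Notation V := {mpoly {mpoly K[2]}[r + s]}.
Local Notation key := ('X_{1..r + s} * lim_index K r s)%type.
Hypothesis char0 : forall m, (m.+1%:R : K) != 0.
Hypothesis c_neq0 : c != 0.

(** The symmetrised sorted monomials belong to distinct orbits, so they are independent, and the
    [lim_mon] of degree D span them. *)
Lemma sorted_le_keys (D : nat) (L : seq 'X_{1..r + s}) : uniq L ->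
  (forall m : 'X_{1..r + s}, (m \in L) = [&& okm m, mdeg m == D & blk_sorted m]) ->
  (size L <= size (lim_keys K r s D))%N.
Proof.
move=> uL mL; pose v (m : 'X_{1..r + s}) : B := Wsym 'X_[m].
apply: (@steinitz K B _ _ L (lim_keys K r s D) v (@lim_mon K r s) uL).
  move=> b s0 m mL0; have := mL m; rewrite mL0 => /esym/and3P[om _ sm].
  have coefE m1 : m1 \in L -> m1 != m -> (v m1)@_m = 0.
    rewrite mL => /and3P[_ _ sm1] m1m; rewrite raddf_sum /= big1 // => w bw.
    rewrite mcoeff_sym mcoeffX; case: eqP => // e.
    by case/eqP: m1m; rewrite e in sm1 *; apply: sorted_mperm_eq.
  have := congr1 (mcoeff m) s0; rewrite mcoeff0 raddf_sum (bigD1_seq m) //= big_seq_cond.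
  rewrite big1 ?addr0 => [|m1 /andP[m1L m1m]]; last by rewrite mcoeffZ coefE // mulr0.
  rewrite mcoeffZ => /eqP; rewrite mulf_eq0 => /orP[/eqP //|].
  (* The coefficient is the order of the stabiliser of m, which is positive and so nonzero in K. *)
  have -> : (v m)@_m = (\sum_(w : 'S_n | blk w) (m == [multinom m (w i) | i < n]))%:R.
    rewrite raddf_sum natr_sum; apply: eq_bigr => w _.
    by rewrite /= mcoeff_sym mcoeffX.
  rewrite (bigD1 1%g) ?blk1 //=; have -> : (m == [multinom m ((1%g : 'S_n) i) | i < n]) = true.
    by apply/eqP/mnmP => i; rewrite mnmE perm1.
  by rewrite add1n (negbTE (char0 _)).
move=> m; rewrite mL => /and3P[om /eqP dm _].
apply: (lim_mon_span char0 (D := D) (linear_span_on _ _)).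
- by apply: Agr_Wsym; apply: MgrX.
- by apply: Wsym_homog => [w m1 _|]; [apply: mdeg_mperm | rewrite dhomogX /= dm].
by move=> k dk; apply: mem_span_on (lim_keys_uniq _ _ _ _) _; rewrite mem_lim_keys dk.
Qed.

Variables (Th : 'I_n -> V) (G : lim_index K r s -> V).
Hypothesis ThP : forall i : 'I_n, is_lift c (tdeg i) (tzdeg i) (theta K i) (Th i).
Hypothesis GP : forall j, is_lift c (mdeg (val j)) (zdeg (val j)) (lim_gen j) (G j).

Definition key_lift (k : key) : V := mmap1 Th k.1 * G k.2.

Lemma key_liftP k : is_lift c (lim_deg k) (lim_zdeg k) (lim_mon k) (key_lift k).
Proof. by apply: is_liftM (GP _); apply: is_lift_mmap1. Qed.

Lemma ev_homog v D (X : V) : X \is D.-homog -> ev r s v X \is D.-homog.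
Proof.
move=> hX; apply/dhomogP => m; rewrite mcoeff_msupp ev_mcoeff => h.
apply: (dhomogP _ _ _ hX); rewrite mcoeff_msupp; apply: contraNneq h => ->.
by rewrite meval0.
Qed.

Lemma key_lift_homog v k : ev r s v (key_lift k) \is (lim_deg k).-homog.
Proof. by apply: ev_homog; case: (key_liftP k). Qed.

Lemma pihomog_zlt e b (f : B) : zlt e f -> (e <= b)%N -> pihomog (@zdeg r s) b f = 0.
Proof.
move=> zf eb; rewrite pihomogE big_seq_cond big_pred0 // => m; apply/negbTE/negP.
case/andP; rewrite mcoeff_msupp => /zf h /eqP e'.
by move: h; rewrite e' ltnNge eb.
Qed.

(** A relation among the lifts at v0, projected to the highest degree in z that occurs, becomes a
    relation among the [lim_mon], which are independent. *)
Lemma key_lift_free_special D :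
  free_on (lim_keys K r s D) (fun k => ev r s (v0 K) (key_lift k)).
Proof.
move=> x s0; suff main b : (forall k, k \in lim_keys K r s D -> x k != 0 -> (lim_zdeg k < b)%N) ->
    forall k, k \in lim_keys K r s D -> x k = 0.
  apply: (main (\max_(k <- lim_keys K r s D) (lim_zdeg k).+1)%N) => k kl _.
  exact: (@leq_bigmax_seq _ _ xpredT (fun k : key => (lim_zdeg k).+1)).
elim: b => [|b IHb] lb; first by move=> k kl; apply/eqP/contraT => /(lb k kl).
apply: IHb => k kl xk; have := lb k kl xk; rewrite ltnS leq_eqVlt => /orP[/eqP kb|//].
case/eqP: xk; pose y k := if lim_zdeg k == b then x k else 0.
have -> : x k = y k by rewrite /y kb eqxx.
apply: (lim_mon_free char0 (lim_keys_uniq K r s D)) kl.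
have := congr1 (pihomog (@zdeg r s) b) s0; rewrite pihomog0 raddf_sum /= => e.
rewrite -[RHS]e; apply: eq_big_seq => k1 k1l; rewrite linearZ /=.
have [x0|xn0] := eqVneq (x k1) 0; first by rewrite /y x0 if_same !scale0r.
have [_ _ z1 l1] := key_liftP k1; have k1b := lb k1 k1l xn0.
rewrite -[ev _ _ _ _](subrK (lim_mon k1)) pihomogD (pihomog_zlt l1) // add0r /y.
have [e1|ne] := eqVneq (lim_zdeg k1) b; first by rewrite pihomog_dE -?e1.
by rewrite (pihomog_ne0 ne z1) scaler0 scale0r.
Qed.

Lemma key_lift_free_generic D : exists2 F : {mpoly K[2]}, F != 0 & forall q t,
  F.@[pt q t] != 0 -> free_on (lim_keys K r s D) (fun k => ev r s (pt q t) (key_lift k)).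
Proof.
set l := lim_keys K r s D; have ul : uniq l by apply: lim_keys_uniq.
pose kk (i : 'I_(size l)) := tnth (in_tuple l) i.
pose rho (i : 'I_(size l)) (m : 'X_{1..n < D.+1}) : {mpoly K[2]} := (key_lift (kk i))@_m.
have rhoE v (x : 'I_(size l) -> K) : (forall m, \sum_i x i * (rho i m).@[v] = 0) <->
    \sum_i x i *: ev r s v (key_lift (kk i)) = 0.
  have coefE m : (\sum_i x i *: ev r s v (key_lift (kk i)))@_m =
      \sum_i x i * ((key_lift (kk i))@_m).@[v].
    by rewrite raddf_sum; apply: eq_bigr => i _; rewrite /= mcoeffZ ev_mcoeff.
  split=> [h|h m]; last by rewrite -coefE h mcoeff0.
  apply/mpolyP => m; rewrite coefE mcoeff0; case: (ltnP (mdeg m) D.+1) => hm.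
    exact: (h (BMultinom hm)).
  apply: big1 => i _; rewrite -ev_mcoeff (dhomog_nemf_coeff (key_lift_homog v (kk i))) ?mulr0 //.
  have : kk i \in l by apply: mem_tnth.
  by rewrite mem_lim_keys => /eqP ->; rewrite gtn_eqF.
have [|F F0 hF] := @generic_injective K 2 _ _ rho (v0 K).
  have fl := (free_onP (fun k => ev r s (v0 K) (key_lift k)) ul).1 (@key_lift_free_special D).
  by move=> x /rhoE; apply: fl.
exists F; first by apply: contraNneq F0 => ->; rewrite meval0.
by move=> q t Fqt; apply/(free_onP _ ul) => x /rhoE; apply: hF.
Qed.

(** A count from both sides. Truncation to L is injective on the degree D part of Lambda, so free
    families there have at most [size L] members; the lifts are free and at least that many by
    [sorted_le_keys]. Hence they span and their number is [size L]. *)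
Lemma generic_basis D : exists2 F : {mpoly K[2]}, F != 0 & forall q t,
  F.@[pt q t] != 0 -> not_root_of_unity q -> not_root_of_unity t ->
  [/\ free_on (lim_keys K r s D) (fun k => ev r s (pt q t) (key_lift k)),
      forall f, Lam r s (a_seq c q t) f -> f \is D.-homog ->
        span_on (lim_keys K r s D) (fun k => ev r s (pt q t) (key_lift k)) f
    & (size (lim_keys K r s D))%:Z = hilb_rs r s D].
Proof.
have [L [uL mL sL]] := enum_sorted r s D.
have [F1 F1n h1] := key_lift_free_generic D.
have [|F2 F2n h2] := @generic_upper_bound K r s c c_neq0 D L.
  move=> m om dm; have [w bw sw] := exists_sorted m; exists w => //.
  by rewrite mL sw okm_mperm // om mdeg_mperm dm eqxx.
exists (F1 * F2); first by rewrite mulf_neq0.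
move=> q t; rewrite mevalM mulf_eq0 negb_or => /andP[n1 n2] hq ht.
have fr := h1 q t n1.
pose W f := Lam r s (a_seq c q t) f /\ f \is D.-homog.
have linW : linear_pred W.
  split; first by split; [apply: linear_pred0 (linear_Lam _ _ _) | rewrite rpred0].
  move=> k u v [Lu hu] [Lv hv]; split; first exact: (linear_pred2 (linear_Lam _ _ _)).
  by rewrite rpredD ?rpredZ.
pose tr (f : B) : B := \sum_(m <- L) f@_m *: 'X_[m].
have tr_lin k (u v : B) : tr (k *: u + v) = k *: tr u + tr v.
  rewrite /tr scaler_sumr -big_split; apply: eq_bigr => m _.
  by rewrite mcoeffD mcoeffZ scalerDl scalerA.
have tr_inj f : W f -> tr f = 0 -> f = 0.
  move=> [Lf hf] t0; apply: (h2 q t n2 ht f Lf hf) => m mL0.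
  have := congr1 (mcoeff m) t0; rewrite mcoeff0 raddf_sum (bigD1_seq m) //= big1 ?addr0.
    by rewrite mcoeffZ mcoeffX eqxx mulr1.
  by move=> m1 m1m; rewrite mcoeffZ mcoeffX (negbTE m1m) mulr0.
have tr_span (f : B) : span_on L (fun m => 'X_[m] : B) (tr f) by exists (fun m => f@_m).
have bnd (J : eqType) (l : seq J) (v : J -> B) :=
  @free_size_le K B W tr linW tr_lin tr_inj _ L _ tr_span J l v.
have WK k : k \in lim_keys K r s D -> W (ev r s (pt q t) (key_lift k)).
  rewrite mem_lim_keys => /eqP dk; split; last by rewrite -dk; apply: key_lift_homog.
  by case: (key_liftP k) => _ h _ _; apply: h.
have ul := lim_keys_uniq K r s D; have le := sorted_le_keys uL mL.
have ge := bnd _ _ _ ul WK fr; split=> //.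
  move=> f Lf hf; apply: (@span_of_size K B W (size L) bnd _ _ _ f ul WK fr le).
  by split.
by rewrite -sL; congr Posz; apply/eqP; rewrite eqn_leq le ge.
Qed.

Lemma ev_key_lift v (k : key) :
  ev r s v (key_lift k) = mmap1 (fun i => ev r s v (Th i)) k.1 * ev r s v (G k.2).
Proof.
rewrite rmorphM; congr (_ * _); rewrite /mmap1 rmorph_prod; apply: eq_bigr => i _.
exact: rmorphXn.
Qed.

Section AtGenericPoint.
Variables (q t : K).
Hypotheses (hq : not_root_of_unity q) (ht : not_root_of_unity t).
Local Notation a := (a_seq c q t).
Local Notation A := (Lambda r s a).
Local Notation ek := (fun k => ev r s (pt q t) (key_lift k)).
Hypothesis free_ek : forall D, free_on (lim_keys K r s D) ek.
Hypothesis span_ek : forall D f, Lam r s a f -> f \is D.-homog -> span_on (lim_keys K r s D) ek f.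

Lemma Lam_lift D e f X : is_lift c D e f X -> Lam r s a (ev r s (pt q t) X).
Proof. by case=> _ h _ _; apply: h. Qed.

Definition theta_lift (i : 'I_n) : A := to_Lambda (Lam_lift (ThP i)).
Definition gen_lift (j : lim_index K r s) : A := to_Lambda (Lam_lift (GP j)).

Lemma val_lift (k : key) : val (mmap1 theta_lift k.1 * gen_lift k.2) = ek k.
Proof.
rewrite Lambda_valM ev_key_lift; congr (_ * _).
exact: Lambda_val_mmap1.
Qed.

Lemma free_lift l (x : key -> K) : uniq l ->
  \sum_(k <- l) x k *: (mmap1 theta_lift k.1 * gen_lift k.2) = 0 ->
  forall k, k \in l -> x k = 0.
Proof.
move=> ul s0 k kl; pose D := lim_deg k.
pose y k := if k \in l then x k else 0.
have -> : x k = y k by rewrite /y kl.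
apply: (free_ek (D := D)); last by rewrite mem_lim_keys.
have s1 : \sum_(k <- l) x k *: ek k = 0.
  rewrite -[RHS]/(val (0 : A)) -s0 Lambda_val_sum; apply: eq_bigr => k1 _.
  by rewrite -val_lift.
have := congr1 (pihomog mdeg D) s1; rewrite pihomog0 raddf_sum /= => s2.
transitivity (\sum_(k <- l | lim_deg k == D) x k *: ek k).
  transitivity (\sum_(k <- lim_keys K r s D | k \in l) x k *: ek k).
    rewrite [RHS]big_mkcond; apply: eq_bigr => k1 _; rewrite /y.
    by case: ifP => _ //; rewrite scale0r.
  rewrite -[LHS]big_filter -[RHS]big_filter; apply: perm_big; apply: uniq_perm.
  - by rewrite filter_uniq // lim_keys_uniq.
  - by rewrite filter_uniq.
  by move=> k1; rewrite mem_filter [LHS]mem_filter mem_lim_keys andbC.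
rewrite -[RHS]s2 big_mkcond; apply: eq_bigr => k1 _; rewrite linearZ /=.
have [e|ne] := eqVneq (lim_deg k1) D.
  by rewrite pihomog_dE // -e key_lift_homog.
by rewrite (pihomog_ne0 ne) ?key_lift_homog // scaler0.
Qed.

Lemma span_lift (f : A) : exists l : seq key, exists x : key -> K,
  f = \sum_(k <- l) x k *: (mmap1 theta_lift k.1 * gen_lift k.2).
Proof.
have Lf := Lam_val f; set g : B := val f in Lf.
have /boolp.choice[x hx] d : exists x : key -> K,
    pihomog mdeg d g = \sum_(k <- lim_keys K r s d) x k *: ek k.
  by apply: span_ek; [apply: Lam_pihomog | apply: pihomogP].
exists (flatten [seq lim_keys K r s d | d <- iota 0 (msize g)]), (fun k => x (lim_deg k) k).
apply: val_inj; rewrite Lambda_val_sum big_flatten /= big_map -/g.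
rewrite [LHS](pihomog_partitionE (mf := mdeg) (leqnn _)).
rewrite -[LHS](big_mkord xpredT (fun d => pihomog mdeg d g)) /index_iota subn0; apply: eq_bigr => d _; rewrite hx; apply: eq_big_seq => k.
by rewrite mem_lim_keys => /eqP ->; rewrite -val_lift.
Qed.

Lemma lift_has_dim D : has_dim (@Lambda_homog K r s a D) (size (lim_keys K r s D)).
Proof.
set l := lim_keys K r s D; have ul : uniq l by apply: lim_keys_uniq.
pose b (i : 'I_(size l)) : A :=
  mmap1 theta_lift (tnth (in_tuple l) i).1 * gen_lift (tnth (in_tuple l) i).2.
have valE (x : 'I_(size l) -> K) :
    val (\sum_i x i *: b i) = \sum_i x i *: ek (tnth (in_tuple l) i) :> B.
  by rewrite Lambda_val_sum; apply: eq_bigr => i _; rewrite -val_lift.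
exists b; split=> [x s0|f].
  have fl := (free_onP ek ul).1 (@free_ek D).
  by apply: fl; rewrite -valE s0.
split=> [hf|[x ->]].
  have [x fx] := span_ek (Lam_val f) hf.
  by exists (fun i => x (tnth (in_tuple l) i)); apply: val_inj; rewrite valE fx big_tnth.
rewrite unfold_in valE rpred_sum // => i _; rewrite rpredZ //.
have : tnth (in_tuple l) i \in l by apply: mem_tnth.
by rewrite mem_lim_keys => /eqP <-; apply: key_lift_homog.
Qed.

End AtGenericPoint.

End GenericBasis.

Lemma generic_lifts (K : fieldType) (r s : nat) (c : K) :
  (forall m, (m.+1%:R : K) != 0) -> c != 0 ->
  exists Th : 'I_(r + s) -> {mpoly {mpoly K[2]}[r + s]},
  exists G : lim_index K r s -> {mpoly {mpoly K[2]}[r + s]},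
    (forall i, is_lift c (tdeg i) (tzdeg i) (theta K i) (Th i)) /\
    (forall j, is_lift c (mdeg (val j)) (zdeg (val j)) (lim_gen j) (G j)).
Proof.
move=> char0 c0.
have /boolp.choice[Th ThP] : forall i : 'I_(r + s), liftable c (tdeg i) (tzdeg i) (theta K i).
  move=> i; apply: (liftable_Agr char0 c0).
  - exact: Agr_theta.
  - exact: theta_homog.
  - exact: theta_zhomog.
have /boolp.choice[G GP] : forall j : lim_index K r s,
    liftable c (mdeg (val j)) (zdeg (val j)) (lim_gen j).
  move=> j; apply: (liftable_Agr char0 c0); first exact: Agr_gen.
  - by apply: Wsym_homog => [w m _|]; [apply: mdeg_mperm | rewrite dhomogX].
  - by apply: Wsym_homog => [w m bw|]; [apply: zdeg_mperm | rewrite dhomogX].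
by exists Th, G.
Qed.

(** Its nonvanishing is the condition of part (i), from which part (ii) obtains that Lambda is
    Noetherian and the polynomial ring integral over it. *)
Definition qt_relations (K : fieldType) (r s : nat) : {mpoly K[2]} :=
  \prod_(i < r) \prod_(j < s) (vq K ^+ i.+1 - vt K ^+ j.+1).

Lemma qt_relations_eval (K : fieldType) (r s : nat) (q t : K) :
  (qt_relations K r s).@[pt q t] = \prod_(i < r) \prod_(j < s) (q ^+ i.+1 - t ^+ j.+1).
Proof.
rewrite rmorph_prod; apply: eq_bigr => i _; rewrite rmorph_prod; apply: eq_bigr => j _.
by rewrite rmorphB !rmorphXn /= ev_vq ev_vt.
Qed.

Lemma qt_relations_neq0 (K : fieldType) (r s : nat) : qt_relations K r s != 0.
Proof.
apply: (contra_neq (z1 := (qt_relations K r s).@[pt 0 1]) (z2 := 0)) => [->|].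
  exact: meval0.
rewrite qt_relations_eval; apply/prodf_neq0 => i _; apply/prodf_neq0 => j _.
by rewrite expr0n expr1n sub0r oppr_eq0 oner_neq0.
Qed.

Theorem theorem3p2 (R : realType) (r s : nat) (c : R[i]) :
  (1 <= r)%N -> (1 <= s)%N -> c != 0 ->
  (forall q t : R[i], not_root_of_unity q -> not_root_of_unity t ->
     finitely_generated (Lambda r s (a_seq c q t)) <->
     (forall m n : nat, (1 <= m <= r)%N -> (1 <= n <= s)%N ->
        q ^+ m <> t ^+ n)) /\
  Weil_generically (fun q t : R[i] =>
     not_root_of_unity q -> not_root_of_unity t ->
     Cohen_Macaulay (Lambda r s (a_seq c q t)) /\
     has_hilbert_series r s (a_seq c q t) (hilb_rs r s)).
Proof.
move=> r_gt0 s_gt0 c_neq0; split=> [q t hq ht|].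
  split=> [fg m n mr ns qt|hqt]; last exact: Lambda_finitely_generated.
  by apply: (not_finitely_generated (@complex_char0 R) c_neq0 hq ht mr ns qt fg).
have [Th [G [ThP GP]]] := generic_lifts r s (@complex_char0 R) c_neq0.
have /boolp.choice[F hF] D : exists F : {mpoly R[i][2]}, F != 0 /\ _ :=
  let: ex_intro2 F F0 h := generic_basis (@complex_char0 R) c_neq0 ThP GP D in
  ex_intro _ F (conj F0 h).
(* The factor q makes every polynomial nonconstant, as the equation of a curve must be, even where
   [F D] is a constant. *)
exists (fun D => F D * qt_relations _ r s * vq _); split=> [D|q t Fqt hq ht].
  have F0 : F D * qt_relations _ r s != 0 by rewrite mulf_neq0 ?qt_relations_neq0 // (hF D).1.
  rewrite msizeM // ?msuppX; last by rewrite -msupp_eq0 msuppX.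
  rewrite msizeX mdeg1 /=; rewrite -msize_poly_eq0 in F0.
  by rewrite addnS /= addn1 ltnS lt0n.
have key D : (F D).@[pt q t] != 0 /\ (qt_relations _ r s).@[pt q t] != 0.
  have := Fqt D; rewrite -/(pt q t) !mevalM !mulf_eq0 !negb_or.
  by case/andP => /andP[].
have hqt m n : (1 <= m <= r)%N -> (1 <= n <= s)%N -> q ^+ m <> t ^+ n.
  case: m n => [//|m] [//|n] /= mr ns e; have [_] := key 0%N.
  rewrite qt_relations_eval (bigD1 (Ordinal mr)) //= (bigD1 (Ordinal ns)) //=.
  by rewrite e subrr !mul0r eqxx.
have fr D : free_on (lim_keys _ r s D) (fun k => ev r s (pt q t) (key_lift Th G k)).
  by have [? _ _] := (hF D).2 q t (key D).1 hq ht.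
have sp D f : Lam r s (a_seq c q t) f -> f \is D.-homog ->
    span_on (lim_keys _ r s D) (fun k => ev r s (pt q t) (key_lift Th G k)) f.
  by have [_ h _] := (hF D).2 q t (key D).1 hq ht; apply: h.
split.
  apply: (Cohen_Macaulay_of_basis r_gt0 s_gt0 c_neq0 hq ht hqt
    (theta := theta_lift ThP hq ht) (g := gen_lift GP hq ht)) => [l x ul s0 k kl|x].
    exact: (free_lift fr ul s0 kl).
  exact: (span_lift ThP GP hq ht sp).
move=> D; exists (size (lim_keys R[i] r s D)); first exact: (lift_has_dim ThP GP hq ht fr sp).
by have [_ _ ->] := (hF D).2 q t (key D).1 hq ht.
Qed.
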